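(* Let $(\mathbb{M},g)$ be an $n$-dimensional Riemannian manifold such that the Laplace-Beltrami operator $\Delta$ has discrete spectrum and $$\lim_{\lambda\to\infty}\frac{N(\lambda)}{\lambda^{n/2}}=\infty.$$ Let $\{\phi_i\}_{i\in\mathbb{N}}$ be a complete set of normalized eigenfunctions of $-\Delta$, associated with eigenvalues $\lambda_i$ arranged in non-decreasing order. Then there exists a density one subset $\Sigma\subseteq\mathbb{N}$ such that for every compact set $U\subset\mathbb{M}$ it holds $$\lim_{\substack{i\to\infty\\ i\in\Sigma}}\int_U|\phi_i|^2d\mu_g=0.$$
   Context: $\mu_g$ is the Riemannian measure. The Laplace-Beltrami operator $\Delta$ is the Friedrichs extension, i.e. the self-adjoint operator in $L^2(\mathbb{M},d\mu_g)$ associated with the closure of the quadratic form $Q(u)=\int_{\mathbb{M}}|\nabla u|^2d\mu_g$, $u\in C_c^\infty(\mathbb{M})$. $N(\lambda)$ is the number of eigenvalues of $-\Delta$ in $[0,\lambda]$, counted with multiplicity. The eigenfunctions are normalized in $L^2(\mathbb{M},d\mu_g)$ and form an orthonormal basis. A subset $\Sigma\subseteq\mathbb{N}$ has density $a\in[0,1]$ if $\lim_{\ell\to\infty}\frac1\ell\sum_{k=0}^{\ell-1}\mathbf{1}_\Sigma(k)=a$. *)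

(* Defs.v *)
From HB Require Import structures.
From mathcomp Require Import all_boot all_order all_algebra.
From mathcomp Require Import complex.
From mathcomp Require Import all_classical all_reals all_analysis.

Set Implicit Arguments.
Unset Strict Implicit.
Unset Printing Implicit Defensive.

Import Order.TTheory GRing.Theory Num.Theory.
Import numFieldNormedType.Exports.

Local Open Scope classical_set_scope.
Local Open Scope complex_scope.
Local Open Scope ring_scope.

Section Euclidean.
Variable R : realType.

Definition partial n (a : 'I_n) (f : 'rV[R]_n -> R) : 'rV[R]_n -> R :=
  'D_(delta_mx 0 a) f.

(* f is of class C^k on the open set A. *)
Fixpoint class_C n (k : nat) (A : set 'rV[R]_n) (f : 'rV[R]_n -> R) : Prop :=
  (forall x, A x -> {for x, continuous f}) /\
  if k is k'.+1 then
    forall a : 'I_n, (forall x, A x -> derivable f x (delta_mx 0 a)) /\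
                     class_C k' A (partial a f)
  else True.

Definition smooth_on n (A : set 'rV[R]_n) (f : 'rV[R]_n -> R) : Prop :=
  forall k, class_C k A f.

(* Integral of a nonnegative Borel function on R^n against n-dimensional
   Lebesgue measure, i.e. the n-fold product of [lebesgue_measure], as an
   iterated integral (Tonelli). *)
Fixpoint integral_rV n : ('rV[R]_n -> \bar R) -> \bar R :=
  if n is m.+1 then
    fun f => (\int[@lebesgue_measure R]_t
      integral_rV (fun y : 'rV[R]_m => f (row_mx (const_mx t : 'rV_1) y)))%E
  else fun f => f 0.

End Euclidean.

(* A smooth atlas, not necessarily maximal, modelled on R^n without boundary.
   [chart_map i] and [chart_inv i] are only meaningful on [chart_dom i] and on
   [chart_map i @` chart_dom i]; [chart_at] selects a chart around each point. *)
Record smooth_atlas (R : realType) (n : nat) (M : ptopologicalType) := SmoothAtlas {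
  chart : Type;
  chart_dom : chart -> set M;
  chart_map : chart -> M -> 'rV[R]_n;
  chart_inv : chart -> 'rV[R]_n -> M;
  chart_at : M -> chart;
  chart_atP : forall x, chart_dom (chart_at x) x;
  open_chart_dom : forall i, open (chart_dom i);
  open_chart_codom : forall i, open (chart_map i @` chart_dom i);
  chart_mapK : forall i x, chart_dom i x -> chart_inv i (chart_map i x) = x;
  chart_map_continuous : forall i x, chart_dom i x -> {for x, continuous (chart_map i)};
  chart_inv_continuous : forall i y, (chart_map i @` chart_dom i) y ->
    {for y, continuous (chart_inv i)};
  transition_smooth : forall i j (b : 'I_n),
    smooth_on (chart_map i @` (chart_dom i `&` chart_dom j))
              (fun y => chart_map j (chart_inv i y) 0 b)
}.

(* A Riemannian metric as its Gram matrices in the charts.  The row-vector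
   convention of ['J] is ('J f y) a b = d_a f_b. *)
Record riemannian_metric (R : realType) (n : nat) (M : ptopologicalType)
    (A : smooth_atlas R n M) := RiemannianMetric {
  gram : chart A -> 'rV[R]_n -> 'M[R]_n;
  gram_smooth : forall i (a b : 'I_n),
    smooth_on (chart_map i @` chart_dom i) (fun y => gram i y a b);
  gram_sym : forall i y, (chart_map i @` chart_dom i) y -> (gram i y)^T = gram i y;
  gram_pos : forall i y, (chart_map i @` chart_dom i) y -> forall v : 'rV[R]_n, v != 0 ->
    0 < (v *m gram i y *m v^T) 0 0;
  gram_transition : forall i j y, (chart_map i @` (chart_dom i `&` chart_dom j)) y ->
    let tau := chart_map j \o chart_inv i in
    gram i y = 'J tau y *m gram j (tau y) *m ('J tau y)^T
}.

Definition borel (M : ptopologicalType) := g_sigma_algebraType (@open M).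

(* [mu] is the Riemannian measure of [g]: on each chart domain it has density
   sqrt(det g) in coordinates.  On a second countable manifold this determines
   a unique Borel measure. *)
Definition riemannian_measure (R : realType) (n : nat) (M : ptopologicalType)
    (A : smooth_atlas R n M) (g : riemannian_metric A)
    (mu : {measure set (borel M) -> \bar R}) : Prop :=
  forall (i : chart A) (B : set (borel M)), measurable B -> B `<=` chart_dom i ->
    mu B = integral_rV (fun y =>
      (\1_(chart_map i @` B) y * Num.sqrt (\det (gram g i y)))%:E).

Section Hilbert.
Context {R : realType} {d : measure_display} {T : measurableType d}.
Variable mu : {measure set T -> \bar R}.
Implicit Types u v f h : T -> R[i].

Definition csq (z : R[i]) : R := complex.Re z ^+ 2 + complex.Im z ^+ 2.

Definition cintegral f : R[i] :=
  (\int[mu]_x complex.Re (f x))%R +i* (\int[mu]_x complex.Im (f x))%R.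

Definition l2_normsq f : \bar R := (\int[mu]_x (csq (f x))%:E)%E.

(* Elements of L^2 are represented by functions; the L^2 notions below depend
   only on their classes modulo almost everywhere equality. *)
Definition in_L2 f : Prop :=
  [/\ measurable_fun setT (fun x => complex.Re (f x)),
      measurable_fun setT (fun x => complex.Im (f x)) &
      (l2_normsq f < +oo)%E].

Definition inner f h : R[i] := cintegral (fun x => f x * conjc (h x)).

Definition L2_cvg (f_ : nat -> T -> R[i]) f : Prop :=
  (fun k => l2_normsq (f_ k \- f)) @ \oo --> 0%E.

Definition orthonormal_basis (phi : nat -> T -> R[i]) : Prop :=
  [/\ forall i, in_L2 (phi i),
      forall i j, inner (phi i) (phi j) = (i == j)%:R &
      forall f, in_L2 f ->
        L2_cvg (fun k x => \sum_(i < k) inner f (phi i) * phi i x) f].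

(* An unbounded operator on L^2 is given by its graph
   [G u f], "u is in the domain and maps to f". *)
Implicit Type G : (T -> R[i]) -> (T -> R[i]) -> Prop.

Definition eigenfunction G (z : R[i]) u : Prop := G u (fun x => z * u x).

(* G - z is a bijection from the domain onto L^2 with bounded inverse. *)
Definition in_resolvent_set G (z : R[i]) : Prop :=
  (forall u, eigenfunction G z u -> {ae mu, forall x, u x = 0}) /\
  exists c : R, forall f, in_L2 f ->
    exists2 u, G u (fun x => z * u x + f x) &
               (l2_normsq u <= c%:E * l2_normsq f)%E.

Definition spectrum G : set R[i] := [set z | ~ in_resolvent_set G z].

Definition lin_indep m (f : 'I_m -> T -> R[i]) : Prop :=
  forall c : 'I_m -> R[i],
    {ae mu, forall x, \sum_(j < m) c j * f j x = 0} -> forall j, c j = 0.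

(* Dimension of the eigenspace at z; it is 0 if z is not an eigenvalue. *)
Definition multiplicity G (z : R[i]) : \bar R :=
  ereal_sup [set m%:R%:E | m in [set m | exists f : 'I_m -> T -> R[i],
    (forall j, eigenfunction G z (f j)) /\ lin_indep f]].

(* The spectrum consists of isolated eigenvalues of finite multiplicity. *)
Definition discrete_spectrum G : Prop :=
  forall z, spectrum G z ->
    (0 < multiplicity G z < +oo)%E /\
    exists2 e : R[i], 0 < e &
      forall w, spectrum G w -> `|w - z| < e -> w = z.

Definition counting_function G (lambda : R) : \bar R :=
  \esum_(s in [set s : R | 0 <= s <= lambda]) multiplicity G s%:C.

End Hilbert.

Section Laplacian.
Context {R : realType} {n : nat} {M : ptopologicalType}.
Context {A : smooth_atlas R n M}.
Variables (g : riemannian_metric A) (mu : {measure set (borel M) -> \bar R}).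
Implicit Types u v f : borel M -> R[i].

(* Complex-valued C_c^oo(M). *)
Definition test_function u : Prop :=
  (forall i : chart A,
     smooth_on (chart_map i @` chart_dom i) (fun y => complex.Re (u (chart_inv i y))) /\
     smooth_on (chart_map i @` chart_dom i) (fun y => complex.Im (u (chart_inv i y)))) /\
  compact (closure [set x : M | u x != 0]).

(* Coordinates at y of the differential of u in the chart i. *)
Definition differential (i : chart A) u (y : 'rV[R]_n) : 'rV[R[i]]_n :=
  \row_a (partial a (fun z => complex.Re (u (chart_inv i z))) y +i*
          partial a (fun z => complex.Im (u (chart_inv i z))) y).

(* The Hermitian product of the gradients of u and v at x, g^{ab} d_a u
   (d_b v)^*; for smooth u and v it does not depend on the chart. *)
Definition grad_dot u v (x : M) : R[i] :=
  let i := chart_at A x in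
  let y := chart_map i x in
  (differential i u y *m map_mx (real_complex R) (invmx (gram g i y))
     *m (map_mx conjc (differential i v y))^T) 0 0.

Definition dirichlet_form u v : R[i] := cintegral mu (grad_dot u v).

Definition dirichlet_energy u : \bar R :=
  (\int[mu]_x (complex.Re (grad_dot u u x))%:E)%E.

(* u_ is a sequence of test functions, Cauchy for the form norm, with limit u
   in L^2. *)
Definition form_approx (u_ : nat -> borel M -> R[i]) u : Prop :=
  [/\ forall k, test_function (u_ k),
      L2_cvg mu u_ u &
      forall e : R, 0 < e -> exists N, forall k l, (N <= k)%N -> (N <= l)%N ->
        (dirichlet_energy (u_ k \- u_ l)%R < e%:E)%E].

(* Domain of the closure of the form. *)
Definition form_domain u : Prop :=
  in_L2 mu u /\ exists u_ : nat -> borel M -> R[i], form_approx u_ u.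

(* For u and v in [form_domain], the closure of the Dirichlet form takes the
   value z at (u, v).  As the form is closable, the limit does not depend on the
   approximating sequences. *)
Definition closed_form u v (z : R[i]) : Prop :=
  forall u_ v_ : nat -> borel M -> R[i], form_approx u_ u -> form_approx v_ v ->
    (fun k => complex.Re (dirichlet_form (u_ k) (v_ k))) @ \oo
       --> complex.Re z /\
    (fun k => complex.Im (dirichlet_form (u_ k) (v_ k))) @ \oo
       --> complex.Im z.

(* Graph of the Laplace-Beltrami operator (Friedrichs extension):
   the closed form satisfies q(u, v) = - (f, v) for every v in its domain. *)
Definition laplace_beltrami u f : Prop :=
  [/\ form_domain u, in_L2 mu f &
      forall v, form_domain v -> closed_form u v (- inner mu f v)].

Definition neg_laplace_beltrami u f : Prop :=
  laplace_beltrami u (fun x => - f x).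

End Laplacian.

Definition has_density (R : realType) (S : set nat) (a : R) : Prop :=
  (fun l : nat => l%:R^-1 * \sum_(k < l) (\1_S (k : nat) : R)) @ \oo --> a.

(* Main.v *)
Require Import Defs.
From HB Require Import structures.
From mathcomp Require Import all_boot all_order all_algebra.
From mathcomp Require Import complex.
From mathcomp Require Import all_classical all_reals all_analysis.
From mathcomp Require Import measurable_realfun ring lra.

(** The theorem compares two Weyl laws.  The hypothesis on the counting function
    says that the eigenvalues are much denser than on a compact manifold; but inside
    a fixed small coordinate ball the mass of the eigenfunctions still obeys the
    Euclidean upper bound.  Hence, on average, only a vanishing fraction of the mass
    of each eigenfunction can sit in that ball.

    Local Weyl bound ([local_weyl_bound]).  Around a point take smooth cutoffs
    chi_0 <= chi_1 <= ... <= 1 with support in one compact coordinate box and with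
    |grad chi_j|^2 <= C 16^j chi_(j+1)^2 ([localizer], [exists_localizer]; they are
    built from exp (- c_j / w) with decreasing rates c_j).  Let F_j be the sum over
    i < l of the integrals of chi_j^2 |phi_i|^2, and let Lam >= 1 bound the first l
    eigenvalues.  Divide the box into kappa_j^n cells, kappa_j = 4^j kappa.  On each
    cell the Poincare inequality ([poincare_cell]) bounds the integral of
    |chi_j phi_i|^2 by the squared integral of chi_j phi_i divided by the measure of
    the cell, plus C / kappa_j^2 times the Dirichlet energy of chi_j phi_i.  Summed
    over i, the first terms contribute at most a constant per cell, by Bessel's
    inequality ([bessel]).  The Caccioppoli
    inequality ([caccioppoli]) and the equation satisfied by phi_i bound the energy
    by 16^j Lam times the integral of chi_(j+1)^2 |phi_i|^2 ([eigen_poincare]).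
    Therefore
      F_j <= 4 kappa^n 4^(n j) + C (Lam / kappa^2) F_(j+1)
    ([local_mass_recursion]).  With kappa of order sqrt Lam the coefficient of F_(j+1)
    is at most 4^(-n) / 2, and since F_j <= l for every j the recursion can be
    iterated without end, giving F_0 <= C kappa^n <= C' Lam^(n/2) ([geometric_recursion]).  The
    inequalities that involve gradients are proved for test functions approximating
    phi_i in the form norm, and the limit is taken in [eigen_poincare].

    Cesaro means ([cesaro_local]).  If lambda_i > t for all i >= l, then every
    eigenfunction with eigenvalue at most t is a combination of the first l of the
    phi_i, so N(t) <= l ([counting_function_le]).  Taken at t = lambda_l / 2, the
    hypothesis says that l is large compared with lambda_l^(n/2), so F_0 / l tends
    to 0.

    Density ([density_one_of_local]).  A sequence in [0, 1] whose Cesaro means tend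
    to 0 tends to 0 along a set of density one (Koopman and von Neumann,
    [density_one_of_cesaro]).  By second countability countably many of the small
    neighbourhoods suffice; one density-one set serves all of them
    ([common_density_one]), and a compact set is covered by finitely many. *)

Import Order.TTheory GRing.Theory Num.Theory.
Import numFieldNormedType.Exports.

Local Open Scope classical_set_scope.
Local Open Scope complex_scope.
Local Open Scope ring_scope.
Set Implicit Arguments.
Unset Strict Implicit.
Unset Printing Implicit Defensive.

(** * Differentiability from continuous partial derivatives *)

Lemma MVT_line {R : realType} (n : nat) (f : 'rV[R]_n -> R) (z e : 'rV[R]_n) (t : R) :
  (forall s : R, `|s| <= `|t| -> derivable f (z + s *: e) e) ->
  exists2 s : R, `|s| <= `|t| & f (z + t *: e) - f z = t * 'D_e f (z + s *: e).
Proof.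
move=> df.
pose g (s : R) := f (z + s *: e).
have dg (s : R) : `|s| <= `|t| -> is_derive s 1 g ('D_e f (z + s *: e)).
  move=> /df dfs; have /derivable1P dfs1 := dfs.
  rewrite /g; apply: DeriveDef.
    apply/derivable1P.
    rewrite (_ : (fun _ => _) = (fun h : R => f (h *: e + (z + s *: e)))) //.
    by apply/funext => h /=; rewrite scalerDl [h%:A]mulr1 addrCA addrA.
  rewrite /derive /g; set u1 := fun _ => _; set u2 := fun _ => _.
  suff -> : u1 = u2 by [].
  by rewrite /u1 /u2; apply/funext => h /=; rewrite [h%:A]mulr1 scalerDl addrCA.
have cg : forall a b, `|a| <= `|t| -> `|b| <= `|t| -> {within `[a, b], continuous g}.
  move=> a b at1 bt1; apply: derivable_within_continuous => x.
  rewrite in_itv /= => /andP[ax xb]; apply: (@ex_derive _ _ _ _ _ _ _ (dg x _)).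
  rewrite ler_norml; apply/andP; split.
    by apply: le_trans ax; move: at1; rewrite ler_norml => /andP[].
  by apply: le_trans xb _; move: bt1; rewrite ler_norml => /andP[].
have g0 : g 0 = f z by rewrite /g scale0r addr0.
have [t0|t0] := leP 0 t.
  have [|x xt||c ct Hc] := @MVT_segment R g (fun s => 'D_e f (z + s *: e)) 0 t.
  - exact: t0.
  - apply: dg; move: xt; rewrite in_itv /= => /andP[? ?].
    by rewrite (ger0_norm t0) ger0_norm ?ltW.
  - by apply: cg; rewrite ?normr0 ?normr_ge0.
  exists c; last by rewrite mulrC -g0 -/(g t) Hc subr0.
  by move: ct; rewrite in_itv /= => /andP[? ?]; rewrite !ger0_norm.
have [|x xt||c ct Hc] := @MVT_segment R g (fun s => 'D_e f (z + s *: e)) t 0.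
- exact: ltW.
- apply: dg; move: xt; rewrite in_itv /= => /andP[? ?].
  by rewrite !ltr0_norm // lerN2 ltW.
- by apply: cg; rewrite ?normr0 ?normr_ge0.
exists c.
  move: ct; rewrite in_itv /= => /andP[? ?].
  by rewrite (ltr0_norm t0) ler0_norm // lerN2.
by rewrite -g0 -/(g t) -opprB Hc sub0r mulrN opprK mulrC.
Qed.

Lemma rV_norm_coord {R : realType} (n : nat) (h : 'rV[R]_n) (b : 'I_n) : `|h 0 b| <= `|h|.
Proof.
rewrite [in leRHS]/Num.Def.normr/= mx_normrE.
exact: (le_bigmax _ (fun ij => `|h ij.1 ij.2|) (0, b)).
Qed.

Lemma rV_norm_le {R : realType} (n : nat) (h : 'rV[R]_n) (c : R) :
  0 <= c -> (forall b, `|h 0 b| <= c) -> `|h| <= c.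
Proof.
move=> c0 hc; rewrite [in leLHS]/Num.Def.normr/= mx_normrE.
by apply/bigmax_leP; split => // -[i j] _ /=; rewrite ord1.
Qed.

Section C1_differentiable.
Context {R : realType} (n : nat).
Implicit Types (f : 'rV[R]_n -> R) (x h : 'rV[R]_n).

Definition total_linear (l : 'I_n -> R) h : R := \sum_b l b * h 0 b.

Lemma total_linear_is_linear l : linear (total_linear l).
Proof.
move=> k u v; rewrite /total_linear scaler_sumr -big_split /=.
by apply: eq_bigr => b _; rewrite !mxE mulrDr mulrCA.
Qed.
HB.instance Definition _ l :=
  GRing.isLinear.Build _ _ _ _ (total_linear l) (@total_linear_is_linear l).

Lemma total_linear_continuous l : continuous (total_linear l).
Proof.
move=> x; rewrite /total_linear.
have -> : (fun h : 'rV[R]_n => \sum_b l b * h 0 b) = \sum_b (fun h => l b * h 0 b).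
  by apply/funext => h; rewrite fct_sumE.
apply: differentiable_continuous; apply: differentiable_sum => b.
rewrite (_ : (fun _ => _) = l b \*: (fun h : 'rV[R]_n => h 0 b)) //.
apply: differentiableZ; exact: differentiable_coord.
Qed.

(** Keeps the first [k] coordinates: the increments along [head_part 0 h], ...,
    [head_part n h] move one coordinate at a time. *)
Definition head_part (k : nat) h : 'rV[R]_n := \row_b (if (b < k)%N then h 0 b else 0).

Lemma head_partS (k : 'I_n) h : head_part k.+1 h = head_part k h + h 0 k *: delta_mx 0 k.
Proof.
apply/rowP => b; rewrite !mxE eqxx /= ltnS leq_eqVlt.
have [->|bk] := eqVneq b k; first by rewrite eqxx ltnn mulr1 add0r.
by rewrite -val_eqE /= in bk; rewrite (negbTE bk) /= mulr0 addr0.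
Qed.

(** Telescoping over the coordinates, each increment is a partial derivative at an
    intermediate point by the mean value theorem. *)
Lemma partials_increment f x (e d : R) : 0 < d ->
  (forall y, `|y - x| < d -> forall b : 'I_n,
     derivable f y (delta_mx 0 b) /\ `|partial b f y - partial b f x| <= e) ->
  forall h, `|h| < d ->
  `|f (x + h) - f x - total_linear (fun b => partial b f x) h| <= n%:R * e * `|h|.
Proof.
move=> d0 H h hd.
have -> : f (x + h) - f x = \sum_(k < n) (f (x + head_part k.+1 h) - f (x + head_part k h)).
  rewrite -(big_mkord xpredT (fun k => f (x + head_part k.+1 h) - f (x + head_part k h))).
  rewrite telescope_sumr //; congr (f (_ + _) - f _).
    by apply/rowP => b; rewrite !mxE ltn_ord.
  by apply/rowP => b; rewrite !mxE /= addr0.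
rewrite /total_linear -sumrB (le_trans (ler_norm_sum _ _ _)) //.
rewrite -mulrA -[n in n%:R]card_ord mulr_natl -sumr_const ler_sum // => k _.
have hd' (s : R) : `|s| <= `|h 0 k| -> `|x + head_part k h + s *: delta_mx 0 k - x| < d.
  move=> sh; rewrite -!addrA addrC -!addrA addNr addr0; apply: le_lt_trans hd.
  apply: rV_norm_le => // b; rewrite !mxE eqxx /=.
  have [->|bk] := eqVneq b k; first by rewrite ltnn mulr1 add0r (le_trans sh) ?rV_norm_coord.
  by rewrite mulr0 addr0; case: ifP => _; rewrite ?normr0 // rV_norm_coord.
rewrite head_partS addrA.
have [s|s sh ->] := @MVT_line R n f (x + head_part k h) (delta_mx 0 k) (h 0 k).
  by move=> sh; apply: (H _ (hd' s sh) k).1.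
rewrite [X in _ - X]mulrC -mulrBr normrM mulrC ler_pM ?rV_norm_coord //.
exact: (H _ (hd' s sh) k).2.
Qed.

Lemma partials_continuous_differentiable f x :
  (forall b : 'I_n, \forall y \near x, derivable f y (delta_mx 0 b)) ->
  (forall b : 'I_n, {for x, continuous (partial b f)}) ->
  differentiable f x /\ forall v, 'd f x v = \sum_b partial b f x * v 0 b.
Proof.
move=> df cf.
pose L : {linear 'rV[R]_n -> R} := total_linear (fun b => partial b f x).
have Lc : continuous L by exact: total_linear_continuous.
have dfo : (f \o shift x : 'rV[R]_n -> R) = cst (f x) + L +o_ (0 : 'rV[R]_n) id.
  apply/eqaddoP => e e0.
  pose e' := e / (n%:R + 1).
  have e'0 : 0 < e' by rewrite divr_gt0 // ltr_wpDl.
  have : \forall y \near x, forall b : 'I_n,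
     derivable f y (delta_mx 0 b) /\ `|partial b f y - partial b f x| <= e'.
    near=> y; near: y; apply: filter_forall => b.
    have cb : \forall y \near x, `|partial b f y - partial b f x| <= e'.
      move/cvgrPdist_le : (cf b) => /(_ _ e'0).
      by apply: filterS => y; rewrite distrC.
    exact: (filterI (df b) cb).
  move=> /nbhs_ballP[d /= d0 Hd].
  apply/nbhs_ballP; exists d => //= h; rewrite -ball_normE /= sub0r normrN => hd.
  have H := @partials_increment f x e' d d0 _ h hd.
  have -> : (f \o shift x - (cst (f x) + L)) h = f (x + h) - f x - L h.
    by rewrite -addrA -opprD (addrC x).
  apply: (le_trans (H _)).
    by move=> y yx b; apply: Hd; rewrite -ball_normE /= distrC.
  apply: ler_wpM2r => //; rewrite /e' mulrCA ger_pMr // ler_pdivrMr ?ltr_wpDl //.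
  by rewrite mul1r lerDl.
have Hd := diff_unique Lc dfo.
split; last by move=> v; rewrite Hd.
by apply/diff_locallyP; rewrite Hd.
Unshelve. all: by end_near. Qed.

End C1_differentiable.

(** * Functions of class C^k *)

Section class_C_theory.
Context {R : realType}.

Lemma class_C_continuous n k (A : set 'rV[R]_n) f x :
  class_C k A f -> A x -> {for x, continuous f}.
Proof. by case: k => [|k] [+ _]; apply. Qed.

Lemma class_C_derivable n k (A : set 'rV[R]_n) f x (a : 'I_n) :
  class_C k.+1 A f -> A x -> derivable f x (delta_mx 0 a).
Proof. by move=> [_ /(_ a)[+ _]]; apply. Qed.

Lemma class_C_partial n k (A : set 'rV[R]_n) f (a : 'I_n) :
  class_C k.+1 A f -> class_C k A (partial a f).
Proof. by move=> [_ /(_ a)[]]. Qed.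

Lemma class_CS n k (A : set 'rV[R]_n) f : class_C k.+1 A f -> class_C k A f.
Proof.
elim: k f => [|k IH] f /= [cf df]; first by split.
by split => // a; split; [exact: (df a).1 | apply: IH; exact: (df a).2].
Qed.

Lemma class_C_subset n k (A B : set 'rV[R]_n) f :
  B `<=` A -> class_C k A f -> class_C k B f.
Proof.
move=> BA; elim: k f => [|k IH] f /= [cf df].
  by split => // x /BA; exact: cf.
split => [x /BA|a]; first exact: cf.
by split => [x /BA|]; [exact: (df a).1|apply: IH; exact: (df a).2].
Qed.

(** [class_C] is a condition on the derivatives at each point of the set separately. *)
Lemma class_C_local n k (A : set 'rV[R]_n) f :
  (forall x, A x -> exists2 B, B x & class_C k B f) -> class_C k A f.
Proof.
elim: k f => [|k IH] f H.
  by split => // x /H[B Bx /class_C_continuous]; apply.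
split => [x /H[B Bx /class_C_continuous]|a]; first exact.
split => [x /H[B Bx Cf]|]; first exact: class_C_derivable Cf Bx.
by apply: IH => x /H[B Bx Cf]; exists B => //; exact: class_C_partial.
Qed.

Lemma near_partial n (f g : 'rV[R]_n -> R) x (a : 'I_n) :
  (\near x, f x = g x) -> partial a f x = partial a g x.
Proof. exact: near_eq_derive. Qed.

Lemma near_open_eq n (A : set 'rV[R]_n) (f g : 'rV[R]_n -> R) x : open A ->
  (forall y, A y -> f y = g y) -> A x -> \near x, f x = g x.
Proof. by move=> oA fg Ax; apply: filterS (open_nbhs_nbhs (conj oA Ax)). Qed.

Lemma near_continuous n (f g : 'rV[R]_n -> R) x :
  (\near x, f x = g x) -> {for x, continuous f} -> {for x, continuous g}.
Proof.
move=> nfg cf; rewrite /prop_for /continuous_at -(nbhs_singleton nfg).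
exact: (cvg_trans (near_eq_cvg nfg) cf).
Qed.

Lemma class_C_eq n k (A : set 'rV[R]_n) f g : open A ->
  (forall x, A x -> f x = g x) -> class_C k A f -> class_C k A g.
Proof.
move=> oA; elim: k f g => [|k IH] f g fg /= [cf df].
  by split => // x Ax; apply: near_continuous (near_open_eq oA fg Ax) (cf x Ax).
split => [x Ax|a].
  exact: near_continuous (near_open_eq oA fg Ax) (cf x Ax).
split => [x Ax|].
  apply: near_eq_derivable ((df a).1 x Ax); exact: near_open_eq oA fg Ax.
apply: IH (df a).2 => x Ax; apply: near_partial; exact: near_open_eq oA fg Ax.
Qed.

Lemma partial_cst n (a : 'I_n) (c : R) : partial a (cst c) = cst 0.
Proof. by apply/funext => x; rewrite /partial derive_cst. Qed.

Lemma class_C_cst n k (A : set 'rV[R]_n) (c : R) : class_C k A (cst c).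
Proof.
elim: k c => [|k IH] c /=; first by split => // x _; exact: cst_continuous.
split => [x _|a]; first exact: cst_continuous.
by rewrite partial_cst; split => [x _|]; [exact: derivable_cst|exact: IH].
Qed.

Lemma derivable_coord n (a b : 'I_n) (x : 'rV[R]_n) :
  derivable (fun y : 'rV[R]_n => y 0 b) x (delta_mx 0 a).
Proof. apply: diff_derivable; exact: differentiable_coord. Qed.

Lemma partial_coord n (a b : 'I_n) :
  partial a (fun y : 'rV[R]_n => y 0 b) = cst (a == b)%:R.
Proof.
apply/funext => x; rewrite /partial.
have := @derive_mx R _ _ _ id x (delta_mx 0 a : 'rV[R]_n) (@derivable_id _ _ _ _).
by rewrite derive_id => /matrixP /(_ 0 b); rewrite !mxE eqxx /= eq_sym => ->.
Qed.

Lemma class_C_coord n k (A : set 'rV[R]_n) (b : 'I_n) :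
  class_C k A (fun y => y 0 b).
Proof.
have cb x : {for x, continuous (fun y : 'rV[R]_n => y 0 b)}.
  exact: coord_continuous.
case: k => [|k] /=; first by split.
split => // a; rewrite partial_coord; split; last exact: class_C_cst.
by move=> x _; exact: derivable_coord.
Qed.

Lemma partialD n (a : 'I_n) (f g : 'rV[R]_n -> R) x :
  derivable f x (delta_mx 0 a) -> derivable g x (delta_mx 0 a) ->
  partial a (f \+ g) x = partial a f x + partial a g x.
Proof. by move=> df dg; rewrite /partial; exact: deriveD. Qed.

Lemma partialM n (a : 'I_n) (f g : 'rV[R]_n -> R) x :
  derivable f x (delta_mx 0 a) -> derivable g x (delta_mx 0 a) ->
  partial a (f \* g) x = f x * partial a g x + g x * partial a f x.
Proof. by move=> df dg; rewrite /partial; exact: deriveM. Qed.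

Lemma class_CD n k (A : set 'rV[R]_n) f g : open A ->
  class_C k A f -> class_C k A g -> class_C k A (f \+ g).
Proof.
move=> oA; elim: k f g => [|k IH] f g /= [cf df] [cg dg].
  by split => // x Ax; apply: continuousD; [exact: cf|exact: cg].
split => [x Ax|a].
  by apply: continuousD; [exact: cf|exact: cg].
split => [x Ax|].
  by apply: derivableD; [exact: (df a).1|exact: (dg a).1].
apply: (@class_C_eq _ _ _ (partial a f \+ partial a g)) => // [x Ax|].
  by rewrite partialD //; [exact: (df a).1|exact: (dg a).1].
by apply: IH; [exact: (df a).2|exact: (dg a).2].
Qed.

Lemma class_CM n k (A : set 'rV[R]_n) f g : open A ->
  class_C k A f -> class_C k A g -> class_C k A (f \* g).
Proof.
move=> oA; elim: k f g => [|k IH] f g Cf Cg.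
  by split => // x Ax; apply: continuousM; [exact: Cf.1|exact: Cg.1].
split => [x Ax|a]; first by apply: continuousM; [exact: Cf.1|exact: Cg.1].
split => [x Ax|].
  by apply: derivableM; [exact: (Cf.2 a).1|exact: (Cg.2 a).1].
apply: (@class_C_eq _ _ _ ((f \* partial a g) \+ (g \* partial a f))) => // [x Ax|].
  by rewrite partialM //; [exact: (Cf.2 a).1|exact: (Cg.2 a).1].
apply: class_CD => //; apply: IH.
- exact: class_CS.
- exact: (Cg.2 a).2.
- exact: class_CS.
- exact: (Cf.2 a).2.
Qed.

Lemma class_CZ n k (A : set 'rV[R]_n) (c : R) f : open A ->
  class_C k A f -> class_C k A (fun x => c * f x).
Proof. by move=> oA; apply: (@class_CM _ _ _ (cst c)) => //; exact: class_C_cst. Qed.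

Lemma class_CN n k (A : set 'rV[R]_n) f : open A ->
  class_C k A f -> class_C k A (fun x => - f x).
Proof.
move=> oA Cf; apply: (class_C_eq oA _ (class_CZ (-1) oA Cf)) => x _.
by rewrite mulN1r.
Qed.

Lemma class_C_sum n k (A : set 'rV[R]_n) m (F : 'I_m -> 'rV[R]_n -> R) : open A ->
  (forall b, class_C k A (F b)) -> class_C k A (fun x => \sum_b F b x).
Proof.
move=> oA; elim: m F => [|m IH] F CF.
  apply: (class_C_eq oA _ (class_C_cst k A 0)) => x _; by rewrite big_ord0.
have := class_CD oA (IH (fun b => F (widen_ord (leqnSn m) b)) (fun b => CF _)) (CF ord_max).
apply: class_C_eq => // x _; by rewrite big_ord_recr.
Qed.

Lemma class_C1_differentiable n k (A : set 'rV[R]_n) f x : open A ->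
  class_C k.+1 A f -> A x ->
  differentiable f x /\ forall v, 'd f x v = \sum_b partial b f x * v 0 b.
Proof.
move=> oA Cf Ax; apply: partials_continuous_differentiable => b.
  apply: filterS (open_nbhs_nbhs (conj oA Ax)) => y Ay.
  exact: class_C_derivable Cf Ay.
exact: class_C_continuous (class_C_partial b Cf) Ax.
Qed.

Lemma differentiable_rV n m (g : 'rV[R]_n -> 'rV[R]_m) x :
  (forall b, differentiable (fun y => g y 0 b) x) -> differentiable g x.
Proof.
move=> dg.
rewrite (_ : g = \sum_b (fun y => g y 0 b *: (delta_mx 0 b : 'rV[R]_m))).
  by apply: differentiable_sum => b; exact: differentiableZl.
by apply/funext => y; rewrite fct_sumE -row_sum_delta.
Qed.

Lemma derive_rV_coord n m (g : 'rV[R]_n -> 'rV[R]_m) x (a : 'I_n) b :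
  differentiable g x -> 'd g x (delta_mx 0 a) 0 b = partial a (fun y => g y 0 b) x.
Proof.
move=> dg; rewrite -deriveE // derive_mx ?mxE //; exact: diff_derivable.
Qed.

(** The differential of [f] is required in coordinates, since existence of the
    partial derivatives alone does not give the chain rule. *)
Lemma partial_comp n m (f : 'rV[R]_m -> R) (g : 'rV[R]_n -> 'rV[R]_m) x (a : 'I_n) :
  differentiable f (g x) -> (forall v, 'd f (g x) v = \sum_b partial b f (g x) * v 0 b) ->
  (forall b, differentiable (fun y => g y 0 b) x) ->
  derivable (f \o g) x (delta_mx 0 a) /\
  partial a (f \o g) x = \sum_b partial b f (g x) * partial a (fun y => g y 0 b) x.
Proof.
move=> df dfE dg; have dgx := differentiable_rV dg.
have dfg : differentiable (f \o g) x by exact: differentiable_comp.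
split; first exact: diff_derivable.
rewrite /partial deriveE // diff_comp //= dfE.
by apply: eq_bigr => b _; rewrite derive_rV_coord.
Qed.

Lemma cvg_rV (T : Type) (F : set_system T) (FF : Filter F) m (g : T -> 'rV[R]_m) (l : 'rV[R]_m) :
  (forall b, g y 0 b @[y --> F] --> l 0 b) -> g @ F --> l.
Proof.
move=> gl; apply/cvgrPdist_le => e e0; near=> y.
apply: rV_norm_le; first exact: ltW.
near: y; apply: filter_forall => b.
have /cvgrPdist_le /(_ _ e0) := gl b.
by apply: filterS => y; rewrite !mxE.
Unshelve. all: by end_near. Qed.

Lemma class_C_comp n m k (A : set 'rV[R]_n) (B : set 'rV[R]_m) f
    (g : 'rV[R]_n -> 'rV[R]_m) : open A -> open B ->
  (forall x, A x -> B (g x)) -> (forall b, class_C k A (fun x => g x 0 b)) ->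
  class_C k B f -> class_C k A (f \o g).
Proof.
move=> oA oB AB.
have cg k' x : (forall b, class_C k' A (fun x => g x 0 b)) -> A x ->
    {for x, continuous g}.
  by move=> Cg Ax; apply: (@cvg_rV _ (nbhs x) _ m g (g x)) => b; exact: (class_C_continuous (Cg b) Ax).
elim: k f => [|k IH] f Cg Cf.
  split => // x Ax; apply: continuous_comp; first exact: cg Cg Ax.
  exact: class_C_continuous Cf (AB _ Ax).
have Hp x (a : 'I_n) : A x -> derivable (f \o g) x (delta_mx 0 a) /\
    partial a (f \o g) x = \sum_b partial b f (g x) * partial a (fun y => g y 0 b) x.
  move=> Ax; have [d1 d2] := class_C1_differentiable oB Cf (AB _ Ax).
  by apply: partial_comp => // b; exact: (class_C1_differentiable oA (Cg b) Ax).1.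
split => [x Ax|a].
  apply: continuous_comp; first exact: cg Cg Ax.
  exact: class_C_continuous Cf (AB _ Ax).
split => [x Ax|]; first exact: (Hp x a Ax).1.
apply: (@class_C_eq _ _ _ (fun x => \sum_b ((partial b f \o g) \* partial a (fun y => g y 0 b)) x)) => //.
  by move=> x Ax; rewrite (Hp x a Ax).2.
apply: class_C_sum => // b; apply: class_CM => //.
  apply: IH; last exact: class_C_partial.
  by move=> c; exact: class_CS.
exact: class_C_partial.
Qed.

End class_C_theory.

(** * Bump functions whose gradient is controlled by the next bump *)

Section flat_function.
Context {R : realType} (c : R).
Hypothesis c_gt0 : 0 < c.

(** The negative powers are carried along because differentiation produces them:
    the family is closed under derivation, see [is_derive_flat]. *)
Definition flat (m : nat) (x : R) : R :=
  if 0 < x then x ^- m * expR (- (c / x)) else 0.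

Lemma flat_gt0 m x : 0 < x -> flat m x = x ^- m * expR (- (c / x)).
Proof. by rewrite /flat => ->. Qed.

Lemma flat_le0 m x : x <= 0 -> flat m x = 0.
Proof. by rewrite /flat ltNge => ->. Qed.

Lemma flat_ge0 m x : 0 <= flat m x.
Proof.
rewrite /flat; case: ifP => // x0.
by rewrite mulr_ge0 ?expR_ge0 // invr_ge0 exprn_ge0 // ltW.
Qed.

Lemma expR_ge_exprn (N : nat) (t : R) : 0 <= t -> (t / N.+1%:R) ^+ N.+1 <= expR t.
Proof.
move=> t0; rewrite -[X in expR X](divfK (_ : N.+1%:R != 0)) ?pnatr_eq0 // expRM_natr.
apply: lerXn2r; rewrite ?nnegrE ?expR_ge0 ?divr_ge0 //.
by apply: le_trans (expR_ge1Dx _); rewrite lerDr.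
Qed.

Definition flat_bound (m : nat) : R := (m.+2%:R / c) ^+ m.+2.

Lemma flat_bound_ge0 m : 0 <= flat_bound m.
Proof. by rewrite exprn_ge0 // divr_ge0 // ltW. Qed.

(** Since [expR t] dominates every power of [t], [flat] vanishes to second order
    at 0; this makes it differentiable there. *)
Lemma flat_le_sqr m x : flat m x <= flat_bound m * x ^+ 2.
Proof.
have [x0|x0] := leP x 0.
  by rewrite flat_le0 // mulr_ge0 ?flat_bound_ge0 ?sqr_ge0.
rewrite flat_gt0 // expRN.
have cx0 : 0 < c / x by rewrite divr_gt0.
have H := expR_ge_exprn m.+1 (ltW cx0).
have H0 : 0 < (c / x / m.+2%:R) ^+ m.+2 by rewrite exprn_gt0 // divr_gt0.
rewrite mulrC ler_pdivrMr ?exprn_gt0 //.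
apply: (@le_trans _ _ ((c / x / m.+2%:R) ^+ m.+2)^-1).
  by rewrite lef_pV2 ?posrE ?expR_gt0.
rewrite -[flat_bound m * _ * _]mulrA -exprD add2n /flat_bound -exprMn -exprVn.
rewrite le_eqVlt; apply/orP; left; apply/eqP; congr (_ ^+ _).
by field; rewrite !gt_eqF // ltr_wpDl.
Qed.

Lemma near0_flat m : is_derive (0 : R) 1 (flat m) 0.
Proof.
have H : (fun h : R => h^-1 *: ((flat m \o shift 0) (h *: 1) - flat m 0)) @ 0^' --> (0 : R).
  have K1 : 0 < flat_bound m + 1 by rewrite ltr_wpDl ?flat_bound_ge0.
  apply/cvgrPdist_le => e e0; near=> h.
  have h0 : h != 0 by near: h; exact: nbhs_dnbhs_neq.
  rewrite sub0r normrN /= addr0 [h%:A]mulr1 [flat m 0]flat_le0 // subr0 [_ *: _]mulrC.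
  rewrite normrM normfV ler_pdivrMr ?normr_gt0 // (ger0_norm (flat_ge0 _ _)).
  apply: le_trans (flat_le_sqr _ _) _.
  rewrite -real_normK ?num_real // expr2 mulrA ler_wpM2r //.
  apply: (@le_trans _ _ ((flat_bound m + 1) * `|h|)).
    by rewrite ler_wpM2r // lerDl.
  rewrite mulrC -ler_pdivlMr //.
  near: h; apply: dnbhs0_le; exact: divr_gt0.
apply: DeriveDef; first by apply/cvg_ex; exists 0.
by apply/cvg_lim.
Unshelve. all: by end_near. Qed.

Lemma is_derive_flat m x :
  is_derive (x : R) 1 (flat m) (c * flat m.+2 x - m%:R * flat m.+1 x).
Proof.
have [x0|x0|->] := ltgtP x 0; last first.
- rewrite !flat_le0 // !mulr0 subr0; exact: near0_flat.
- have nx : \near x, x ^- m * expR (- (c / x)) = flat m x.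
    near=> y; rewrite flat_gt0 //; near: y; exact: lt_nbhsr.
  apply: near_eq_is_derive nx _.
  have xn0 : x != 0 by rewrite gt_eqF.
  have dinv : is_derive x (1 : R) (fun y : R => y^-1) (- x ^- 2).
    apply: DeriveDef; first exact: (@derivableV R R id).
    by rewrite (@deriveV R R id) // derive_id [_ *: _]mulr1.
  have de : is_derive x (1 : R) (fun y : R => expR (- (c / y))) (expR (- (c / x)) * (c * x ^- 2)).
    have dN : is_derive x (1 : R) (fun y : R => - (c / y)) (c * x ^- 2).
      have dZ : is_derive x (1 : R) (fun y : R => c / y) (c * - x ^- 2) := is_deriveZ c dinv.
      have := is_deriveN dZ; rewrite mulrN opprK; exact.
    have := @is_derive1_comp R expR _ x _ _ (is_derive_expR _) dN; exact.
  have dm : is_derive x (1 : R) (fun y : R => y ^- m) (- (m%:R * x ^- m.+1)).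
    have := is_deriveX m dinv.
    rewrite [_ *: _](_ : _ = - (m%:R * x ^- m.+1)).
      rewrite (_ : (_ ^+ m)%R = (fun y : R => y ^- m)) //.
      by apply/funext => y; rewrite exprfctE exprVn.
    case: m => [|m]; first by rewrite !mul0r scale0r oppr0.
    by rewrite [_ *: _]mulrN -mulrA -exprVn -exprVn -exprD addn2.
  rewrite !flat_gt0 //.
  have := is_deriveM dm de; rewrite /GRing.scale /=.
  set u := _ + _; set v := _ - _.
  have -> // : u = v.
  rewrite /u /v -!exprVn !exprS; ring.
- have nx : \near x, 0 = flat m x.
    near=> y; rewrite flat_le0 // ltW //; near: y; exact: lt_nbhsl.
  rewrite !flat_le0 ?ltW // !mulr0 subr0.
  apply: near_eq_is_derive nx _; exact: is_derive_cst.
Unshelve. all: by end_near. Qed.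

End flat_function.

Section flat_theory.
Context {R : realType}.
Implicit Types c x r : R.

Lemma flat_comp_derive n (c : R) m (w : 'rV[R]_n -> R) y (a : 'I_n) : 0 < c ->
  differentiable w y ->
  derivable (flat c m \o w) y (delta_mx 0 a) /\
  partial a (flat c m \o w) y =
    (c * flat c m.+2 (w y) - m%:R * flat c m.+1 (w y)) * partial a w y.
Proof.
move=> c0 dw; have [df dfE] := is_derive_flat c0 m (w y).
have dF : differentiable (flat c m) (w y) by exact/derivable1_diffP.
have dFw : differentiable (flat c m \o w) y by exact: differentiable_comp.
split; first exact: diff_derivable.
rewrite /partial deriveE // diff_comp //= -(deriveE _ dw) diff1E // derive1E dfE.
by rewrite [LHS]mulrC.
Qed.

Lemma class_C_flat n k m c (A : set 'rV[R]_n) w : 0 < c -> open A ->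
  class_C k A w -> class_C k A (flat c m \o w).
Proof.
move=> c0 oA; elim: k m => [|k IH] m Cw.
  split => // y Ay; apply: continuous_comp; first exact: class_C_continuous Cw Ay.
  apply: differentiable_continuous; apply/derivable1_diffP.
  by have [] := is_derive_flat c0 m (w y).
have H y a : A y -> _ := fun Ay => flat_comp_derive m a c0 (class_C1_differentiable oA Cw Ay).1.
split => [y Ay|a].
  apply: continuous_comp; first exact: class_C_continuous Cw Ay.
  apply: differentiable_continuous; apply/derivable1_diffP.
  by have [] := is_derive_flat c0 m (w y).
split => [y Ay|]; first exact: (H y a Ay).1.
have Cw' := class_CS Cw.
apply: (@class_C_eq _ _ _ _ (((fun y => c * (flat c m.+2 \o w) y) \+
   (fun y => - m%:R * (flat c m.+1 \o w) y)) \* partial a w)) => //.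
  by move=> y Ay; rewrite (H y a Ay).2 /= mulNr.
apply: class_CM => //; last exact: class_C_partial.
by apply: class_CD => //; apply: class_CZ => //; exact: IH.
Qed.

Lemma flat0_le1 c x : 0 < c -> flat c 0 x <= 1.
Proof.
move=> c0; rewrite /flat; case: ifP => // x0.
by rewrite expr0 invr1 mul1r -expR0 ler_expR oppr_le0 divr_ge0 // ltW.
Qed.

Lemma flat0_anti c c' x : c' <= c -> flat c 0 x <= flat c' 0 x.
Proof.
move=> cc'; rewrite /flat; case: ifP => // x0.
by rewrite expr0 invr1 !mul1r ler_expR lerN2 ler_wpM2r // invr_ge0 ltW.
Qed.

(** The factor [x ^- 2] is absorbed by lowering the rate: with [t = (c - c') / x] it
    is a multiple of [t ^+ 2], and [expR (- t)] is at most [4 / t ^+ 2]. *)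
Lemma flat2_le c c' x : c' < c -> flat c 2 x <= 4 / (c - c') ^+ 2 * flat c' 0 x.
Proof.
move=> cc'; rewrite /flat; case: ifP => x0; last by rewrite mulr0.
have d0 : 0 < c - c' by rewrite subr_gt0.
rewrite expr0 invr1 mul1r.
have -> : - (c / x) = - ((c - c') / x) + - (c' / x) by rewrite mulrBl; ring.
rewrite expRD mulrA ler_wpM2r ?expR_ge0 // expRN.
rewrite ler_pdivrMr ?expR_gt0 // -ler_pdivrMl ?divr_gt0 ?exprn_gt0 //.
have H := expR_ge_exprn 1 (ltW (divr_gt0 d0 x0)).
apply: le_trans H; rewrite le_eqVlt; apply/orP; left; apply/eqP.
by field; rewrite !gt_eqF.
Qed.

Section bump.
Context (n : nat) (y0 : 'rV[R]_n) (r : R).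
Hypothesis r_gt0 : 0 < r.

Definition paraboloid (y : 'rV[R]_n) : R := r ^+ 2 - \sum_b (y 0 b - y0 0 b) ^+ 2.

Lemma class_C_paraboloid k : class_C k setT paraboloid.
Proof.
have Cb b : class_C k setT ((fun y : 'rV[R]_n => y 0 b) \+ cst (- y0 0 b)).
  apply: class_CD openT _ _; [exact: class_C_coord|exact: class_C_cst].
have Cs : class_C k setT (fun y : 'rV[R]_n => \sum_b (y 0 b - y0 0 b) ^+ 2).
  apply: (class_C_sum openT) => b; have := class_CM openT (Cb b) (Cb b).
  by apply: (class_C_eq openT) => y _; rewrite /= expr2.
have := class_CD openT (class_C_cst k setT (r ^+ 2)) (class_CN openT Cs).
exact: (class_C_eq openT).
Qed.

Lemma partial_paraboloid a y : partial a paraboloid y = - (2 * (y 0 a - y0 0 a)).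
Proof.
have dc b : is_derive y (delta_mx 0 a : 'rV[R]_n) (fun y : 'rV[R]_n => y 0 b - y0 0 b) (a == b)%:R.
  have d1 : is_derive y (delta_mx 0 a : 'rV[R]_n) (fun y : 'rV[R]_n => y 0 b) (a == b)%:R.
    apply: DeriveDef; first exact: derivable_coord.
    by have := congr1 (fun f => f y) (partial_coord a b).
  have := is_deriveB d1 (is_derive_cst (y0 0 b) y (delta_mx 0 a : 'rV[R]_n)).
  by rewrite subr0.
have dsq b : is_derive y (delta_mx 0 a : 'rV[R]_n) (fun y : 'rV[R]_n => (y 0 b - y0 0 b) ^+ 2)
    (2 * (y 0 b - y0 0 b) * (a == b)%:R).
  by have := is_deriveX 2 (dc b); rewrite expr1; exact.
have ds := is_derive_sum dsq.
have := is_deriveB (is_derive_cst (r ^+ 2) y (delta_mx 0 a : 'rV[R]_n)) ds.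
have -> : \sum_b 2 * (y 0 b - y0 0 b) * (a == b)%:R = 2 * (y 0 a - y0 0 a).
  rewrite (bigD1 a) //= eqxx mulr1 big1 ?addr0 // => b ba.
  by rewrite eq_sym (negbTE ba) mulr0.
rewrite sub0r; move=> [_ <-]; rewrite /partial /paraboloid; congr (derive _ _ _).
by apply/funext => z; rewrite fctE fct_sumE.
Qed.

Lemma paraboloid_gt0 y : 0 < paraboloid y -> forall b, `|y 0 b - y0 0 b| < r.
Proof.
rewrite subr_gt0 => H b; rewrite -ltr_sqr ?nnegrE // ?ltW // real_normK ?num_real //.
apply: le_lt_trans H; rewrite (bigD1 b) //= lerDl.
by apply: sumr_ge0 => i _; exact: sqr_ge0.
Qed.

(** Decreasing rates make the bumps increase with [j], while their gaps [2 ^- j.+1]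
    lose only a geometric factor in [flat2_le]. *)
Definition rate (j : nat) : R := 1 + 2 ^- j.

Lemma rate_gt0 j : 0 < rate j.
Proof. by rewrite /rate addr_gt0 // invr_gt0 exprn_gt0. Qed.

Lemma rateB j : rate j - rate j.+1 = 2 ^- j.+1.
Proof. by rewrite /rate exprS; field; rewrite expf_neq0. Qed.

Lemma rate_le2 j : rate j <= 2.
Proof.
by rewrite /rate -[leRHS]/(1 + 1) lerD2l invf_le1 ?exprn_gt0 // exprn_ege1 // ler1n.
Qed.

Definition bump (j : nat) : 'rV[R]_n -> R := flat (rate j) 0 \o paraboloid.

Lemma class_C_bump j k : class_C k setT (bump j).
Proof. exact: (class_C_flat 0 (rate_gt0 j) openT (class_C_paraboloid k)). Qed.

Lemma bump_ge0 j y : 0 <= bump j y. Proof. exact: flat_ge0. Qed.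

Lemma bump_le1 j y : bump j y <= 1. Proof. exact: flat0_le1 (rate_gt0 j). Qed.

Lemma bump_le j y : bump j y <= bump j.+1 y.
Proof. by apply: flat0_anti; rewrite -subr_ge0 rateB invr_ge0 exprn_ge0. Qed.

Lemma bump_supp j y : bump j y != 0 -> forall b, `|y 0 b - y0 0 b| < r.
Proof.
move=> H; apply: paraboloid_gt0; rewrite ltNge; apply: contra H => w0.
by rewrite /bump /= flat_le0.
Qed.

Lemma bump_center j : 0 < bump j y0.
Proof.
have w0 : 0 < paraboloid y0.
  rewrite /paraboloid big1 ?subr0 ?exprn_gt0 // => b _; by rewrite subrr expr0n.
by rewrite /bump /= flat_gt0 // mulr_gt0 ?expR_gt0 // invr_gt0 exprn_gt0.
Qed.

(** This self-improving bound is what lets the local estimate be iterated: an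
    ordinary cutoff would give a bound by the indicator of its support instead of by a
    smooth function of the same family. *)
Lemma partial_bump_le j a y :
  (partial a (bump j) y) ^+ 2 <= (64 * r) ^+ 2 * 16 ^+ j * bump j.+1 y ^+ 2.
Proof.
have dw : differentiable paraboloid y.
  exact: (class_C1_differentiable openT (class_C_paraboloid 1) I).1.
rewrite (flat_comp_derive 0 a (rate_gt0 j) dw).2 mul0r subr0 partial_paraboloid.
have [w0|w0] := leP (paraboloid y) 0.
  rewrite flat_le0 // mulr0 mul0r expr0n /= mulr_ge0 ?sqr_ge0 //.
  by rewrite mulr_ge0 ?sqr_ge0 ?exprn_ge0.
have F0 := flat_ge0 (rate j) 2 (paraboloid y).
have F : flat (rate j) 2 (paraboloid y) <= 16 * 4 ^+ j * bump j.+1 y.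
  have gap : rate j.+1 < rate j by rewrite -subr_gt0 rateB invr_gt0 exprn_gt0.
  apply: le_trans (flat2_le _ gap) _; rewrite rateB.
  rewrite (_ : 4 / (2 ^- j.+1) ^+ 2 = 16 * 4 ^+ j) //.
  rewrite exprVn invrK -exprM mulnC exprM exprS (_ : (2 : R) ^+ 2 = 4); ring.
have Y := paraboloid_gt0 w0 a.
have -> : (64 * r) ^+ 2 * 16 ^+ j * bump j.+1 y ^+ 2 =
   (2 * (16 * 4 ^+ j * bump j.+1 y) * (2 * r)) ^+ 2.
  rewrite (_ : (16 : R) ^+ j = 4 ^+ j * 4 ^+ j); first by ring.
  by rewrite -exprMn; congr (_ ^+ _); ring.
rewrite -[leLHS]real_normK ?num_real // ler_sqr ?nnegrE ?normr_ge0 //; last first.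
  by rewrite !mulr_ge0 ?exprn_ge0 ?bump_ge0 // ltW.
rewrite !normrM normrN normrM (ger0_norm F0) (ger0_norm (ltW (rate_gt0 j))).
rewrite (ger0_norm (_ : 0 <= 2)) //.
have Rg := ltW (rate_gt0 j).
apply: ler_pM; [by rewrite mulr_ge0|by rewrite mulr_ge0| |].
  by apply: ler_pM => //; exact: rate_le2.
by apply: ler_wpM2l => //; exact: ltW.
Qed.

End bump.
End flat_theory.

(** * Measurability and Lebesgue measure on row vectors *)

Section integral_monotonicity.
Local Open Scope ereal_scope.
Context d (T : measurableType d) (R : realType).
Import HBNNSimple.

(** For arbitrary functions: the integral of a nonnegative function is a supremum over
    the simple functions below it. *)
Lemma ge0_le_integral_set (m : {measure set T -> \bar R}) (D : set T) (f g : T -> \bar R) :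
  (forall x, D x -> 0 <= f x) -> (forall x, D x -> f x <= g x) ->
  \int[m]_(x in D) f x <= \int[m]_(x in D) g x.
Proof.
move=> f0 fg; have g0 x : D x -> 0 <= g x by move=> Dx; apply: le_trans (f0 x Dx) (fg x Dx).
rewrite !ge0_integralE //; apply: ereal_sup_le => _ [h hf <-].
exists h => // x; apply: le_trans (hf x) _.
by rewrite /patch; case: ifPn => //; rewrite inE; exact: fg.
Qed.

Lemma le_measure_ge0_integral (m1 m2 : {measure set T -> \bar R}) (f : T -> \bar R) :
  (forall S, measurable S -> m1 S <= m2 S) -> (forall x, 0 <= f x) ->
  \int[m1]_x f x <= \int[m2]_x f x.
Proof.
move=> m12 f0; rewrite !ge0_integralTE //; apply: ge_ereal_sup => _ [h hf <-].
apply: le_trans (le_measure_sintegral m12 h) _.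
by apply: ereal_sup_ubound; exists h.
Qed.

End integral_monotonicity.

Lemma measurable_sqr_EFin d (T : measurableType d) (R : realType) (a : T -> R) :
  measurable_fun setT a -> measurable_fun setT (fun x => ((a x) ^+ 2)%:E).
Proof. by move=> ma; apply/measurable_EFinP; exact: measurable_funX. Qed.

Section borel_sets.
Context {T : ptopologicalType}.

Lemma borel_open (A : set T) : open A -> measurable (A : set (borel T)).
Proof. by move=> oA; exact: sub_gen_smallest. Qed.

Lemma borel_closed (A : set T) : closed A -> measurable (A : set (borel T)).
Proof. by rewrite -openC => /borel_open /measurableC; rewrite setCK. Qed.

Lemma borel_map_on d (U : measurableType d) (G : set (set U)) (A : set T) (f : T -> U) :
  @measurable _ U = <<s G>> -> open A ->
  (forall B, G B -> open (A `&` f @^-1` B)) ->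
  measurable_fun (A : set (borel T)) (f : borel T -> U).
Proof.
move=> mG oA fG; apply: (measurability _ mG) => _ [B GB <-].
by apply: borel_open; exact: fG.
Qed.

Lemma open_preimage_on (S : topologicalType) (A : set T) (f : T -> S) (B : set S) :
  open A -> (forall x, A x -> {for x, continuous f}) -> open B ->
  open (A `&` f @^-1` B).
Proof.
move=> oA cf oB; rewrite openE => x [Ax Bfx].
apply: filterI; first exact: open_nbhs_nbhs.
exact: (cf x Ax _ (open_nbhs_nbhs (conj oB Bfx))).
Qed.

Lemma borel_continuous_on (S : ptopologicalType) (A : set T) (f : T -> S) : open A ->
  (forall x, A x -> {for x, continuous f}) ->
  measurable_fun (A : set (borel T)) (f : borel T -> borel S).
Proof.
move=> oA cf; apply: (@borel_map_on _ (borel S) (@open S)) => // B oB.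
exact: open_preimage_on.
Qed.

Lemma borel_real_on (R : realType) (A : set T) (f : T -> R) : open A ->
  (forall x, A x -> {for x, continuous f}) ->
  measurable_fun (A : set (borel T)) (f : borel T -> R).
Proof.
move=> oA cf; apply: (borel_map_on (measurable_realfun.RGenOpens.measurableE R)) => // B [a [b ->]].
by apply: open_preimage_on => //; exact: interval_open.
Qed.

Lemma borel_real (R : realType) (f : T -> R) : continuous f ->
  measurable_fun [set: borel T] (f : borel T -> R).
Proof. by move=> cf; apply: borel_real_on => [|x _]; [exact: openT|exact: cf]. Qed.

End borel_sets.

Section row_cons.
Context {R : realType} (n : nat).

Definition row_cons (t : R) (y : 'rV[R]_n) : 'rV[R]_n.+1 := row_mx (const_mx t : 'rV_1) y.
Definition row_tail (z : 'rV[R]_n.+1) : 'rV[R]_n := rsubmx (z : 'rV_(1 + n)).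

Lemma row_cons0 t y : row_cons t y 0 0 = t.
Proof. by rewrite /row_cons mxE; case: splitP => j //= _; rewrite mxE. Qed.

Lemma row_cons_lift t y b : row_cons t y 0 (lift ord0 b) = y 0 b.
Proof.
rewrite /row_cons mxE; case: splitP => j /=; first by rewrite ord1.
by rewrite !add1n => -[bj]; congr (y _ _); exact: val_inj.
Qed.

Lemma row_tailE (z : 'rV[R]_n.+1) b : row_tail z 0 b = z 0 (lift ord0 b).
Proof. by rewrite mxE; congr (z _ _); exact: val_inj. Qed.

Lemma row_consK t y : row_tail (row_cons t y) = y.
Proof. by apply/rowP => b; rewrite row_tailE row_cons_lift. Qed.

Lemma row_tail_continuous : continuous row_tail.
Proof.
move=> z; apply: (@cvg_rV R _ (nbhs z) _ n row_tail (row_tail z)) => b.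
under eq_cvg do rewrite row_tailE.
by rewrite row_tailE; exact: coord_continuous.
Qed.

Lemma row_cons_continuous t : continuous (row_cons t).
Proof.
move=> y; apply: (@cvg_rV R _ (nbhs y) _ n.+1 (row_cons t) (row_cons t y)) => b.
case: (unliftP ord0 b) => [c|] ->.
  by under eq_cvg do rewrite row_cons_lift; rewrite row_cons_lift; exact: coord_continuous.
by under eq_cvg do rewrite row_cons0; rewrite row_cons0; exact: cvg_cst.
Qed.

(** Countably many measurable rectangles generating the topology of R x R^n: the
    product sigma-algebra contains the open sets because R x R^n is separable. *)
Definition rat_box (i : nat * (rat * 'rV[rat]_n)) : set (R * 'rV[R]_n) :=
  [set u : R * 'rV[R]_n | `|u.1 - ratr i.2.1| < i.1.+1%:R^-1] `&`
  [set u : R * 'rV[R]_n | forall b, `|u.2 0 b - ratr (i.2.2 0 b)| < i.1.+1%:R^-1].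

Lemma measurable_rat_box i : measurable (rat_box i : set (R * borel 'rV[R]_n)).
Proof.
pose A1 : set R := [set t | `|t - ratr i.2.1| < i.1.+1%:R^-1].
pose A2 : set (borel 'rV[R]_n) := [set y | forall b, `|y 0 b - ratr (i.2.2 0 b)| < i.1.+1%:R^-1].
have mA1 : measurable A1.
  rewrite (_ : A1 = ball (ratr i.2.1 : R) i.1.+1%:R^-1).
    apply: open_measurable; exact: ball_open.
  by apply/seteqP; split => t; rewrite /A1 -ball_normE /= distrC.
have mA2 : measurable A2.
  rewrite (_ : A2 = ball (\row_b (ratr (i.2.2 0 b) : R)) (i.1.+1%:R^-1 : R)).
    by apply: borel_open; exact: ball_open.
  apply/seteqP; split => y.
    move=> H; rewrite /ball /= /mx_ball; split; first by rewrite invr_gt0.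
    move=> k b; rewrite !mxE ord1 /= -ball_normE /= distrC; exact: H.
  rewrite /ball /= /mx_ball => -[_ H] b; have := H 0 b; rewrite !mxE -ball_normE /= distrC; exact.
rewrite (_ : rat_box i = A1 `*` A2) //.
exact: measurableX.
Qed.

Lemma rat_near (t e : R) : 0 < e -> exists q : rat, `|t - ratr q| < e.
Proof.
move=> e0; have te : t - e < t + e by lra.
have [q] := rat_in_itvoo te.
rewrite in_itv /= => /andP[h1 h2]; exists q.
by rewrite distrC ltr_norml; apply/andP; split; lra.
Qed.

(** The Borel sets of R^(n+1) are measurable for the product of the Borel
    sigma-algebras: an open set is the union of the rational boxes it contains. *)
Lemma measurable_row_cons :
  measurable_fun [set: R * borel 'rV[R]_n]
    (fun u => row_cons u.1 u.2 : borel 'rV[R]_n.+1).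
Proof.
apply: (@measurability _ _ (R * borel 'rV[R]_n)%type (borel 'rV[R]_n.+1) _ _ (@open 'rV[R]_n.+1)) => //.
move=> _ [B oB <-]; rewrite setTI.
pose P i := rat_box i `<=` (fun u => row_cons u.1 u.2) @^-1` B.
rewrite (_ : _ @^-1` B = \bigcup_i (if `[< P i >] then rat_box i else set0)).
  apply: countable_bigcupT_measurable; first exact: countableP.
  by move=> i; case: ifP => _; [exact: measurable_rat_box|exact: measurable0].
apply/seteqP; split => [[t y] /= Bty|u [i _]]; last first.
  by case: ifPn => // /asboolP Pi; exact: Pi.
have /nbhs_ballP[e /= e0 He] := open_nbhs_nbhs (conj oB Bty).
have [k ke] : exists k : nat, k.+1%:R^-1 < e / 2.
  have e20 : 0 < e / 2 by rewrite divr_gt0.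
  have [k _ /(_ k (leqnn k))] := near_infty_natSinv_lt (PosNum e20).
  by exists k.
have k0 : 0 < (k.+1%:R^-1 : R) by rewrite invr_gt0.
have [p pt] := rat_near t k0.
have [s sy] : exists s : 'rV[rat]_n, forall b, `|y 0 b - ratr (s 0 b)| < k.+1%:R^-1.
  have H b : {q : rat | `|y 0 b - ratr q| < k.+1%:R^-1} by apply/cid/rat_near.
  by exists (\row_b sval (H b)) => b; rewrite mxE; exact: (svalP (H b)).
exists (k, (p, s)) => //; case: ifPn => [_|/asboolP[]]; first by split.
move=> [t' y'] [/= pt' sy']; apply: He.
rewrite -ball_normE /=; apply: le_lt_trans (_ : 2 * k.+1%:R^-1 < e); last first.
  by rewrite mulrC -ltr_pdivlMr.
apply: rV_norm_le => [|b]; first by rewrite mulr_ge0 // ltW.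
rewrite mxE [X in _ + X]mxE; case: (unliftP ord0 b) => [c|] ->.
  rewrite !row_cons_lift -(subrKA (ratr (s 0 c))).
  rewrite (le_trans (ler_normD _ _)) // mulr_natl mulr2n lerD // ltW //.
  by rewrite distrC.
rewrite !row_cons0 -(subrKA (ratr p)).
rewrite (le_trans (ler_normD _ _)) // mulr_natl mulr2n lerD // ltW //.
by rewrite distrC.
Qed.

End row_cons.

Section lebesgue_rV.
Context {R : realType}.
Local Open Scope ereal_scope.
Let RR : measurableType _ := measurableTypeR R.

Lemma sigma_finite_product d d' (T : measurableType d) (U : measurableType d')
    (m1 : {sigma_finite_measure set T -> \bar R}) (m2 : {sigma_finite_measure set U -> \bar R}) :
  sigma_finite setT (m1 \x m2).
Proof.
have /sigma_finiteP[F [TF ndF Foo]] := sigma_finiteT m1.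
have /sigma_finiteP[G [TG ndG Goo]] := sigma_finiteT m2.
exists (fun k => F k `*` G k) => [|k].
  apply/seteqP; split => // -[x y] _.
  have [i _ Fix] : (\bigcup_i F i) x by rewrite -TF.
  have [j _ Gjy] : (\bigcup_i G i) y by rewrite -TG.
  exists (maxn i j) => //; split => /=.
    by have /subsetPset := ndF _ _ (leq_maxl i j); apply.
  by have /subsetPset := ndG _ _ (leq_maxr i j); apply.
have [mF fF] := Foo k; have [mG fG] := Goo k.
split; first exact: measurableX.
by rewrite product_measure1E // lte_mul_pinfty // ge0_fin_numE.
Qed.

(** A left inverse transports an exhaustion by sets of finite measure. *)
Lemma sigma_finite_pushforward d d' (T : measurableType d) (U : measurableType d')
    (m : {measure set T -> \bar R}) (f : T -> U) (g : U -> T) :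
  sigma_finite setT m ->
  measurable_fun setT f -> measurable_fun setT g -> cancel f g ->
  exists nu : {sigma_finite_measure set U -> \bar R}, nu = pushforward m f :> (set U -> \bar R).
Proof.
move=> [F FT Ffin] mf mg fg.
pose pm : {measure set U -> \bar R} :=
  measure_function_pushforward__canonical__measure_function_Measure m mf.
have sf : sigma_finite setT pm.
  exists (fun i => g @^-1` F i).
    by rewrite -preimage_bigcup -FT preimage_setT.
  move=> i; have [mF mFoo] := Ffin i; split.
    by rewrite -[X in measurable X]setTI; exact: mg.
  rewrite /= /pushforward (_ : f @^-1` (g @^-1` F i) = F i) //.
  by apply/seteqP; split => x; rewrite /= fg.
pose sm := Measure_isSigmaFinite.Build _ _ _ (pm : set U -> \bar R) sf.
pose nu : {sigma_finite_measure set U -> \bar R} := HB.pack (pm : set U -> \bar R) (Measure.class pm) sm.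
by exists nu.
Qed.

(** The iterated integral comes from a sigma-finite measure, built one coordinate at
    a time as the image of a product measure; it makes the general theory of the
    Lebesgue integral available for [integral_rV]. *)
Lemma integral_rV_measure n :
  exists nu : {sigma_finite_measure set (borel 'rV[R]_n) -> \bar R},
    forall f : borel 'rV[R]_n -> \bar R, measurable_fun setT f ->
      (forall y, 0 <= f y) -> integral_rV f = \int[nu]_y f y.
Proof.
elim: n => [|n [nu IH]].
  exists (\d_(0%R : borel 'rV[R]_0)) => f mf f0.
  by rewrite integral_dirac //= diracT mul1e.
pose L : {sigma_finite_measure set RR -> \bar R} := @lebesgue_measure R.
pose P : {measure set (RR * borel 'rV[R]_n)%type -> \bar R} :=
  lebesgue_integral_fubini_product_measure1__canonical__measure_function_Measure L nu.
pose c (u : R * borel 'rV[R]_n) : borel 'rV[R]_n.+1 := row_cons u.1 u.2.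
pose e (z : borel 'rV[R]_n.+1) : (RR * borel 'rV[R]_n)%type := ((z : 'rV[R]_n.+1) 0%R 0%R, row_tail z).
have mc : measurable_fun setT c by exact: measurable_row_cons.
have me : measurable_fun setT e.
  apply/measurable_fun_pairP; split => /=.
    by apply: borel_real; exact: coord_continuous.
  apply: (@borel_continuous_on _ _ setT); first exact: openT.
  by move=> x _; exact: row_tail_continuous.
have ce : cancel c e by move=> [t y]; rewrite /c /e /= row_cons0 row_consK.
have [nu' nu'E] := sigma_finite_pushforward (m := P) (sigma_finite_product L nu) mc me ce.
exists nu' => f mf f0; rewrite nu'E ge0_integral_pushforward //=.
rewrite preimage_setT.
have mfc : measurable_fun setT (f \o c) by exact: measurableT_comp.
have := fubini_tonelli1 (m1 := L) (m2 := nu) (f \o c) mfc (fun u => f0 _).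
move=> /= ->.
apply: eq_integral => t _; rewrite IH //.
have mt : measurable_fun setT (row_cons t : borel 'rV[R]_n -> borel 'rV[R]_n.+1).
  apply: (@borel_continuous_on _ _ setT); first exact: openT.
  by move=> x _; exact: row_cons_continuous.
exact: (measurableT_comp mf mt).
Qed.

End lebesgue_rV.

(** * The Poincare inequality on a cell *)

Section increment_bound.
Context {R : realType}.
Local Open Scope ereal_scope.
Local Notation leb := (@lebesgue_measure R).

(** Cauchy-Schwarz for the fundamental theorem of calculus.  With [m] the slope of
    the chord, integrating [2 * m * df - m ^+ 2 <= df ^+ 2] gives the inequality
    directly. *)
Lemma sqr_increment_le (f df : R -> R) (a h t0 t : R) :
  (forall x : R, is_derive x 1%R f (df x)) -> continuous df ->
  t0 \in `[a, (a + h)%R[ -> t \in `[a, (a + h)%R[ ->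
  ((f t - f t0) ^+ 2)%:E <= h%:E * \int[leb]_(s in `[a, (a + h)%R[) ((df s) ^+ 2)%:E.
Proof.
move=> Hf cdf.
wlog t0t : t0 t / (t0 <= t)%R.
  move=> H h0 h1; have [t0t|tt0] := leP t0 t; first exact: H.
  by rewrite -sqrrN opprB; apply: H => //; exact: ltW.
rewrite !in_itv /= => /andP[a0 b0] /andP[a1 b1].
have h0 : (0 <= h)%R by have := le_lt_trans a0 b0; rewrite ltrDl => /ltW.
have I0 : 0 <= \int[leb]_(s in `[a, (a + h)%R[) ((df s) ^+ 2)%:E.
  by apply: integral_ge0 => s _; rewrite lee_fin sqr_ge0.
move: t0t; rewrite le_eqVlt => /predU1P[->|t0t].
  by rewrite subrr expr0n /= mule_ge0.
pose m : R := ((f t - f t0) / (t - t0))%R.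
have tt0 : (t - t0 != 0)%R by rewrite subr_eq0 gt_eqF.
pose F (s : R) : R := (2 * m * f s - m ^+ 2 * s)%R.
pose g (s : R) : R := (2 * m * df s - m ^+ 2)%R.
have HF (x : R) : is_derive x (1%R : R) F (g x).
  have d1 : is_derive x (1%R : R) (fun s => (2 * m * f s)%R) ((2 * m) * df x)%R.
    exact: is_deriveZ.
  have d2 : is_derive x (1%R : R) (fun s : R => (m ^+ 2 * s)%R) (m ^+ 2 * 1)%R.
    exact: (@is_deriveZ R R R id (m ^+ 2)%R).
  have := is_deriveB d1 d2; rewrite mulr1; exact.
have cg : continuous g.
  move=> x; apply: cvgB; last exact: cvg_cst.
  by apply: cvgM; [exact: cvg_cst|exact: cdf].
have cF x : {for x, continuous F}.
  by apply: differentiable_continuous; apply/derivable1_diffP; have [] := HF x.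
have FTC : \int[leb]_(s in `[t0, t]) (g s)%:E = (F t)%:E - (F t0)%:E.
  apply: continuous_FTC2 => //.
  - by apply: continuous_subspaceT.
  - split; first by move=> x _; have [] := HF x.
    + by apply: cvg_at_right_filter; exact: cF.
    + by apply: cvg_at_left_filter; exact: cF.
  - by move=> x _; rewrite derive1E; have [_ ->] := HF x.
have FE : (F t - F t0 = (f t - f t0) ^+ 2 / (t - t0))%R.
  by rewrite /F /m; field.
have cdf2 : continuous (fun s => (df s ^+ 2)%R).
  move=> x; rewrite (_ : (fun s => (df s ^+ 2)%R) = (df \* df)%R); last first.
    by apply/funext => s; rewrite expr2.
  by apply: cvgM; exact: cdf.
have le1 : ((f t - f t0) ^+ 2 / (t - t0))%:E <=
    \int[leb]_(s in `[t0, t]) ((df s) ^+ 2)%:E.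
  rewrite -FE EFinB -FTC; apply: le_integral => //.
  - apply: continuous_compact_integrable; first exact: segment_compact.
    exact: continuous_subspaceT.
  - apply: (@continuous_compact_integrable R (fun s => (df s ^+ 2)%R)); first exact: segment_compact.
    exact: continuous_subspaceT.
  - move=> s _; rewrite lee_fin /g -subr_ge0.
    rewrite (_ : (_ - _ = (df s - m) ^+ 2)%R) ?sqr_ge0 //; ring.
have le2 : \int[leb]_(s in `[t0, t]) ((df s) ^+ 2)%:E <=
    \int[leb]_(s in `[a, (a + h)%R[) ((df s) ^+ 2)%:E.
  apply: ge0_subset_integral => //.
  - apply/measurable_EFinP; apply: measurable_funTS.
    by apply: continuous_measurable_fun.
  - by move=> x _; rewrite lee_fin sqr_ge0.
  - move=> x /=; rewrite !in_itv /= => /andP[x0 x1].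
    by rewrite (le_trans a0 x0) (le_lt_trans x1 b1).
apply: (@le_trans _ _ ((t - t0)%:E * \int[leb]_(s in `[a, (a + h)%R[) ((df s) ^+ 2)%:E)).
  have -> : ((f t - f t0) ^+ 2)%:E = (t - t0)%:E * ((f t - f t0) ^+ 2 / (t - t0))%:E.
    by rewrite -EFinM; congr EFin; field.
  apply: lee_wpmul2l; first by rewrite lee_fin subr_ge0 ltW.
  exact: le_trans le1 le2.
apply: lee_wpmul2r => //; rewrite lee_fin; lra.
Qed.

End increment_bound.

Section poincare.
Context {R : realType}.
Local Notation leb := (@lebesgue_measure R).
Let RR : measurableType _ := measurableTypeR R.

Definition cell n (a : 'rV[R]_n) (h : R) : set 'rV[R]_n :=
  [set y | forall b, a 0 b <= y 0 b < a 0 b + h].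

Definition is_lebesgue_rV n (nu : {measure set (borel 'rV[R]_n) -> \bar R}) : Prop :=
  forall f : borel 'rV[R]_n -> \bar R, measurable_fun setT f ->
    (forall y, 0 <= f y)%E -> integral_rV f = (\int[nu]_y f y)%E.

Lemma measurable_cell n (a : 'rV[R]_n) h : measurable (cell a h : set (borel 'rV[R]_n)).
Proof.
rewrite (_ : cell a h = \bigcap_(b in [set: 'I_n])
    ((fun y : borel 'rV[R]_n => (y : 'rV[R]_n) 0 b) @^-1` `[a 0 b, (a 0 b + h)[)).
  apply: fin_bigcap_measurable => // b _.
  rewrite -[X in measurable X]setTI.
  have mc : measurable_fun [set: borel 'rV[R]_n] (fun y : borel 'rV[R]_n => (y : 'rV[R]_n) 0 b).
    by apply: borel_real; exact: coord_continuous.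
  apply: mc => //; exact: measurable_itv.
apply/seteqP; split => y H b; first by move=> _; rewrite /= in_itv /=; exact: H.
by have := H b I; rewrite /= in_itv.
Qed.

Lemma cell_row_cons n (a : 'rV[R]_n.+1) h t y :
  cell a h (row_cons t y) <-> `[a 0 0, (a 0 0 + h)[%classic t /\ cell (row_tail a) h y.
Proof.
rewrite /= in_itv /=; split => [H|[H0 H] b].
  split; first by have := H 0; rewrite row_cons0.
  by move=> b; have := H (lift ord0 b); rewrite row_cons_lift row_tailE.
case: (unliftP ord0 b) => [c|] ->; last by rewrite row_cons0.
by have := H c; rewrite row_cons_lift row_tailE.
Qed.

Lemma partial_row_cons n (u : 'rV[R]_n.+1 -> R) t y (b : 'I_n) :
  partial b (u \o row_cons t) y = partial (lift ord0 b) u (row_cons t y) /\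
  (derivable u (row_cons t y) (delta_mx 0 (lift ord0 b)) ->
   derivable (u \o row_cons t) y (delta_mx 0 b)).
Proof.
have H (s : R) : row_cons t (s *: delta_mx 0 b + y) =
    s *: delta_mx 0 (lift ord0 b) + row_cons t y.
  apply/rowP => c; rewrite [RHS]mxE [X in _ = X + _]mxE [X in _ = _ * X + _]mxE eqxx /=.
  case: (unliftP ord0 c) => [d|] ->.
    by rewrite !row_cons_lift !mxE eqxx /= (inj_eq lift_inj).
  by rewrite !row_cons0 (negbTE (neq_lift _ _)) mulr0 add0r.
rewrite /partial /derive /derivable.
set u1 := fun _ => _; set u2 := fun _ => _.
have -> : u1 = u2 by apply/funext => s; rewrite /u1 /u2 /= H.
by [].
Qed.

Lemma partial_row_cons0 n (u : 'rV[R]_n.+1 -> R) (t : R) y :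
  derivable u (row_cons t y) (delta_mx 0 0) ->
  is_derive t 1 (fun s : R => u (row_cons s y)) (partial 0 u (row_cons t y)).
Proof.
have H (s : R) : row_cons (s + t) y = s *: delta_mx 0 0 + row_cons t y.
  apply/rowP => c; rewrite [RHS]mxE [X in _ = X + _]mxE [X in _ = _ * X + _]mxE eqxx /=.
  case: (unliftP ord0 c) => [d|] ->.
    by rewrite !row_cons_lift mulr0 add0r.
  by rewrite !row_cons0 mulr1.
move=> du; apply: DeriveDef.
  move: du; rewrite /derivable.
  set u1 := fun _ => _; set u2 := fun _ => _.
  have -> // : u1 = u2 by apply/funext => s; rewrite /u1 /u2 /= -H [s%:A]mulr1.
rewrite /partial /derive; set u1 := fun _ => _; set u2 := fun _ => _.
have -> // : u1 = u2 by apply/funext => s; rewrite /u1 /u2 /= -H [s%:A]mulr1.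
Qed.

Definition grad2 n (u : 'rV[R]_n -> R) (y : 'rV[R]_n) : R := \sum_b (partial b u y) ^+ 2.

Lemma grad2_ge0 n (u : 'rV[R]_n -> R) y : 0 <= grad2 u y.
Proof. by apply: sumr_ge0 => b _; exact: sqr_ge0. Qed.

End poincare.

Section poincare.
Context {R : realType}.
Local Open Scope ereal_scope.
Let RR : measurableType _ := measurableTypeR R.
Let L : {sigma_finite_measure set RR -> \bar R} := @lebesgue_measure R.

(** Some value of a function is at most its mean.  Thanks to the slack [e],
    monotonicity of the integral suffices for the contradiction. *)
Lemma pigeonhole_integral (a h e : R) (D : R -> \bar R) : (0 < h)%R -> (0 < e)%R ->
  measurable_fun (setT : set RR) D -> (forall t, 0 <= D t) ->
  \int[L]_(t in `[a, (a + h)%R[) D t < +oo ->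
  exists2 t0, t0 \in `[a, (a + h)%R[ &
    h%:E * D t0 <= \int[L]_(t in `[a, (a + h)%R[) D t + e%:E.
Proof.
move=> h0 e0 mD D0 foo; set S := \int[L]_(t in _) D t in foo *.
have S0 : 0 <= S by apply: integral_ge0 => t _; exact: D0.
have [s Ss] : exists s, S = s%:E.
  by move: S0 foo; case: S => [s| |] // _ _; exists s.
apply: contrapT => /forallPNP H.
have : (s + e)%:E * h%:E <= h%:E * S.
  have hE : L [set` `[a, (a + h)%R[] = h%:E.
    by rewrite /L /= lebesgue_measure_itv /= lte_fin ltrDl h0 -EFinB addrAC subrr add0r.
  rewrite -{1}hE -integral_cst //.
  rewrite -ge0_integralZl //.
  - apply: ge0_le_integral_set => t It.
      by rewrite lee_fin addr_ge0 ?(ltW e0) // -lee_fin -Ss.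
    have /negP := H t It; rewrite -ltNge Ss -EFinD => /ltW; exact.
  - exact: measurable_funTS.
  - by rewrite lee_fin ltW.
rewrite Ss -EFinM lee_fin mulrC ler_pM2l // gerDl leNgt e0 //.
Qed.

Section step.
Context (n : nat) (nu : {sigma_finite_measure set (borel 'rV[R]_n) -> \bar R}).
Hypothesis nuP : is_lebesgue_rV nu.
Variables (nu' : {measure set (borel 'rV[R]_n.+1) -> \bar R}).
Hypothesis nuP' : is_lebesgue_rV nu'.
Variables (a : 'rV[R]_n.+1) (h : R).
Hypothesis h_gt0 : (0 < h)%R.
Let q : set (borel 'rV[R]_n) := cell (row_tail a) h.
Let I : set RR := [set` `[a 0%R 0%R, (a 0%R 0%R + h)%R[].

Let mq : measurable q. Proof. exact: measurable_cell. Qed.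
Let mI : measurable I. Proof. exact: measurable_itv. Qed.

Lemma measurable_comp_row_cons d (U : measurableType d) (f : borel 'rV[R]_n.+1 -> U) :
  measurable_fun setT f ->
  measurable_fun setT (fun u : (RR * borel 'rV[R]_n)%type => f (row_cons u.1 u.2)).
Proof. by move=> mf; exact: (measurableT_comp mf (measurable_row_cons (n := n))). Qed.

Lemma measurable_inner_integral (G : (RR * borel 'rV[R]_n)%type -> \bar R) :
  measurable_fun setT G -> (forall u, 0 <= G u) ->
  measurable_fun setT (fun t : RR => \int[nu]_(y in q) G (t, y)).
Proof.
move=> mG G0.
have mGq : measurable_fun setT (G \_ (setT `*` q)).
  apply/(measurable_restrictT _ (measurableX measurableT mq)); exact: measurable_funTS.
have := measurable_fun_fubini_tonelli_F (m2 := nu) _ mGq _.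
rewrite (_ : fubini_F nu _ = (fun t : RR => \int[nu]_(y in q) G (t, y))).
  by apply => u; exact: erestrict_ge0.
apply/funext => t; rewrite /fubini_F [RHS]integral_mkcond; apply: eq_integral => y _.
rewrite /patch; congr (if _ then _ else _).
by apply/idP/idP; rewrite !inE /= => // -[].
Qed.

Lemma tonelli_cell (G : (RR * borel 'rV[R]_n)%type -> \bar R) :
  measurable_fun setT G -> (forall u, 0 <= G u) ->
  \int[L]_(t in I) \int[nu]_(y in q) G (t, y) = \int[nu]_(y in q) \int[L]_(t in I) G (t, y).
Proof.
move=> mG G0.
have mGq : measurable_fun setT (G \_ (I `*` q)).
  apply/(measurable_restrictT _ (measurableX mI mq)); exact: measurable_funTS.
have GE t y : (G \_ (I `*` q)) (t, y) = (if t \in I then if y \in q then G (t, y) else 0 else 0).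
  rewrite /patch (_ : ((t, y) \in I `*` q) = (t \in I) && (y \in q)).
    by case: (t \in I); case: (y \in q).
  by apply/idP/andP; rewrite !inE.
have := fubini_tonelli (m1 := L) (m2 := nu) _ mGq _.
move=> /(_ (erestrict_ge0 (fun u _ => G0 u))) T.
rewrite integral_mkcond [RHS]integral_mkcond.
transitivity (\int[L]_t \int[nu]_y (G \_ (I `*` q)) (t, y)).
  apply: eq_integral => t _; rewrite [LHS]/patch; case: ifPn => tI.
    by rewrite integral_mkcond; apply: eq_integral => y _; rewrite GE tI.
  by rewrite [RHS]integral0_eq // => y _; rewrite GE (negbTE tI).
rewrite T; apply: eq_integral => y _; rewrite [RHS]/patch; case: ifPn => yq.
  by rewrite [RHS]integral_mkcond; apply: eq_integral => t _; rewrite GE yq.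
by rewrite integral0_eq // => t _; rewrite GE (negbTE yq); case: ifP.
Qed.

Lemma cell_integralS (f : borel 'rV[R]_n.+1 -> \bar R) :
  measurable_fun setT f -> (forall z, 0 <= f z) ->
  \int[nu']_(z in cell a h) f z = \int[L]_(t in I) \int[nu]_(y in q) f (row_cons t y).
Proof.
move=> mf f0.
have mfc : measurable_fun setT (f \_ (cell a h : set (borel 'rV[R]_n.+1))).
  apply/(measurable_restrictT _ (measurable_cell a h)); exact: measurable_funTS.
rewrite integral_mkcond -nuP' //; last by move=> z; exact: erestrict_ge0.
rewrite [RHS]integral_mkcond /=; apply: eq_integral => t _.
rewrite nuP; last 2 first.
- exact: (measurable_fun_pair2 t (measurable_comp_row_cons mfc)).
- by move=> y; exact: erestrict_ge0.
rewrite /patch; case: ifPn => [tI|tI].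
  rewrite [RHS]integral_mkcond; apply: eq_integral => y _.
  rewrite /patch; congr (if _ then _ else _).
  apply/idP/idP; rewrite !inE.
    by move/(cell_row_cons a h t y) => [].
  by move=> yq; apply/(cell_row_cons a h t y); split => //; move: tI; rewrite inE.
rewrite integral0_eq // => y _; case: ifPn => //.
rewrite inE => /(cell_row_cons a h t y)[tI' _].
by move: tI; rewrite notin_setE.
Qed.

End step.
End poincare.

Section poincare.
Context {R : realType}.
Local Open Scope ereal_scope.
Let RR : measurableType _ := measurableTypeR R.
Let L : {sigma_finite_measure set RR -> \bar R} := @lebesgue_measure R.

Lemma ge0_lty_EFin (x : \bar R) : 0 <= x -> x < +oo -> exists r : R, x = r%:E.
Proof. by case: x => [r| |] // _ _; exists r. Qed.

Lemma class_C1_measurable n (u : 'rV[R]_n -> R) : class_C 1 setT u ->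
  measurable_fun [set: borel 'rV[R]_n] (u : borel 'rV[R]_n -> R) /\
  forall b, measurable_fun [set: borel 'rV[R]_n] (partial b u : borel 'rV[R]_n -> R).
Proof.
move=> Cu; split => [|b]; apply: borel_real => x.
  exact: class_C_continuous Cu I.
exact: (class_C_continuous (class_C_partial b Cu) I).
Qed.

Lemma measurable_grad2 n (u : 'rV[R]_n -> R) : class_C 1 setT u ->
  measurable_fun [set: borel 'rV[R]_n] (fun y : borel 'rV[R]_n => (grad2 u y)%:E).
Proof.
move=> /class_C1_measurable[_ mp]; apply/measurable_EFinP.
apply: measurable_sum => b; exact: measurable_funX.
Qed.

Lemma class_C1_row_cons n (u : 'rV[R]_n.+1 -> R) t : class_C 1 setT u ->
  class_C 1 setT (u \o row_cons t).
Proof.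
move=> Cu; split => [y _|b].
  apply: continuous_comp; first exact: row_cons_continuous.
  exact: class_C_continuous Cu I.
split => [y _|].
  by apply: (partial_row_cons u t y b).2; exact: class_C_derivable Cu I.
split => // y _.
rewrite (_ : partial b _ = partial (lift ord0 b) u \o row_cons t); last first.
  by apply/funext => z; rewrite (partial_row_cons u t z b).1.
apply: continuous_comp; first exact: row_cons_continuous.
exact: class_C_continuous (class_C_partial _ Cu) I.
Qed.

Lemma grad2_row_cons n (u : 'rV[R]_n.+1 -> R) t y :
  grad2 u (row_cons t y) = (partial ord0 u (row_cons t y) ^+ 2 + grad2 (u \o row_cons t) y)%R.
Proof.
rewrite /grad2 big_ord_recl; congr (_ + _)%R; apply: eq_bigr => b _.
by rewrite (partial_row_cons u t y b).1.
Qed.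

(** By induction on the dimension.  Choose a slice [t0] on which the tangential energy
    is at most its mean over all slices; the induction hypothesis gives a constant [c]
    on that slice, and the other slices differ from it by increments in the first
    coordinate, controlled by [sqr_increment_le].  The constant [c] is not identified
    with the mean value: any constant serves, by [sqr_integral_le]. *)
Lemma poincare_cell n (nu : {sigma_finite_measure set (borel 'rV[R]_n) -> \bar R})
    (u : 'rV[R]_n -> R) (a : 'rV[R]_n) (h e : R) :
  is_lebesgue_rV nu -> class_C 1 setT u -> (0 < h)%R -> (0 < e)%R ->
  exists c : R, \int[nu]_(y in cell a h) ((u y - c) ^+ 2)%:E <=
    (2 ^+ n * h ^+ 2)%:E * \int[nu]_(y in cell a h) (grad2 u y)%:E + e%:E.
Proof.
elim: n nu u a h e => [|n IH] nu' u a h e nuP' Cu h0 e0.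
  exists (u 0%R); rewrite integral0_eq.
    rewrite adde_ge0 ?lee_fin ?(ltW e0) // mule_ge0 ?lee_fin ?mulr_ge0 ?exprn_ge0 ?(ltW h0) //.
    by apply: integral_ge0 => y _; rewrite lee_fin grad2_ge0.
  by move=> y _; rewrite (_ : y = 0%R :> 'rV[R]_0) ?subrr ?expr0n //; apply/rowP => -[].
have [nu nuP] := @integral_rV_measure R n.
have [mu mp] := class_C1_measurable Cu.
pose q : set (borel 'rV[R]_n) := cell (row_tail a) h.
pose I : set RR := [set` `[a 0%R 0%R, (a 0%R 0%R + h)%R[].
pose p0 (w : RR * borel 'rV[R]_n) := ((partial ord0 u (row_cons w.1 w.2)) ^+ 2)%:E.
pose g0 (w : RR * borel 'rV[R]_n) := (grad2 (u \o row_cons w.1) w.2)%:E.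
have mq : measurable q by exact: measurable_cell.
have mI : measurable I by exact: measurable_itv.
have mp0 : measurable_fun setT p0.
  exact: (measurable_comp_row_cons (measurable_sqr_EFin (mp ord0))).
have mg0 : measurable_fun setT g0.
  rewrite (_ : g0 = fun w : (RR * borel 'rV[R]_n)%type => (\sum_b ((partial (lift ord0 b) u (row_cons w.1 w.2)) ^+ 2))%:E).
    apply/measurable_EFinP; apply: measurable_sum => b.
    apply: measurable_funX; exact: (measurable_comp_row_cons (mp (lift ord0 b))).
  apply/funext => w; rewrite /g0 /grad2; congr EFin; apply: eq_bigr => b _.
  by rewrite (partial_row_cons u _ _ b).1.
have p00 w : 0 <= p0 w by rewrite lee_fin sqr_ge0.
have g00 w : 0 <= g0 w by rewrite lee_fin grad2_ge0.
pose D t := \int[nu]_(y in q) g0 (t, y).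
pose D0 t := \int[nu]_(y in q) p0 (t, y).
have mD : measurable_fun setT D by exact: measurable_inner_integral.
have mD0 : measurable_fun setT D0 by exact: measurable_inner_integral.
have D_ge0 t : 0 <= D t by exact: integral_ge0.
have D0_ge0 t : 0 <= D0 t by exact: integral_ge0.
pose E (y : borel 'rV[R]_n) := \int[L]_(t in I) p0 (t, y).
have E0 y : 0 <= E y by apply: integral_ge0.
have GE : \int[nu']_(z in cell a h) (grad2 u z)%:E =
    \int[L]_(t in I) D0 t + \int[L]_(t in I) D t.
  rewrite (cell_integralS nuP nuP') //; last 2 first.
  - exact: measurable_grad2.
  - by move=> z; rewrite lee_fin grad2_ge0.
  rewrite -ge0_integralD //; [|exact: measurable_funTS..].
  apply: eq_integral => t _; rewrite -ge0_integralD //.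
  - by apply: eq_integral => y _; rewrite grad2_row_cons EFinD.
  - exact: measurable_funTS (measurable_fun_pair2 t mp0).
  - exact: measurable_funTS (measurable_fun_pair2 t mg0).
have S0E : \int[L]_(t in I) D0 t = \int[nu]_(y in q) E y by exact: tonelli_cell.
set S := \int[L]_(t in I) D t in GE; set S0 := \int[L]_(t in I) D0 t in GE S0E.
have S_ge0 : 0 <= S by exact: integral_ge0.
have S0_ge0 : 0 <= S0 by exact: integral_ge0.
pose K : R := (2 ^+ n.+1 * h ^+ 2)%R.
have K0 : (0 < K)%R by rewrite mulr_gt0 // exprn_gt0.
rewrite GE -/K.
(* Infinite energy makes the right-hand side infinite. *)
have [Soo|] := eqVneq (S0 + S) +oo.
  by exists 0%R; rewrite Soo gt0_muley ?lte_fin // addye // leey.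
rewrite -ltey => Sfin.
have [s Ss] : exists s, S = s%:E.
  by apply: ge0_lty_EFin => //; apply: le_lt_trans Sfin; rewrite leeDr.
have [s0 S0s] : exists s, S0 = s%:E.
  by apply: ge0_lty_EFin => //; apply: le_lt_trans Sfin; rewrite leeDl.
(* The errors of the pigeonhole and of the induction hypothesis get the weights [K]
   and [2 * h]. *)
pose e' : R := (e / (K + 2 * h))%R.
have Kh0 : (0 < K + 2 * h)%R by rewrite addr_gt0 // mulr_gt0.
have e'0 : (0 < e')%R by rewrite divr_gt0.
have [t0 t0I Dt0] : exists2 t0, t0 \in `[a 0%R 0%R, (a 0%R 0%R + h)%R[ & h%:E * D t0 <= S + e'%:E.
  by apply: pigeonhole_integral => //; rewrite -/L -/I -/S Ss ltry.
have [d Dd] : exists d, D t0 = d%:E.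
  apply: ge0_lty_EFin => //.
    rewrite ltNge leye_eq; apply/negP => /eqP Doo.
    by move: Dt0; rewrite Doo gt0_muley ?lte_fin // Ss -EFinD leye_eq.
have [c Hc] := IH nu (u \o row_cons t0) (row_tail a) h e' nuP (class_C1_row_cons t0 Cu) h0 e'0.
exists c.
have mc t : measurable_fun [set: borel 'rV[R]_n] (fun y : borel 'rV[R]_n => (u (row_cons t y) - c)%R).
  apply: measurable_funB; last exact: measurable_cst.
  exact: (class_C1_measurable (class_C1_row_cons t Cu)).1.
pose A := \int[nu]_(y in q) ((u (row_cons t0 y) - c) ^+ 2)%:E.
have {}Hc : A <= (2 ^+ n * h ^+ 2 * d + e')%:E.
  by rewrite EFinD EFinM -Dd; exact: Hc.
have A0 : 0 <= A by apply: integral_ge0 => y _; rewrite lee_fin sqr_ge0.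
have [al Aal] : exists x, A = x%:E.
  by apply: ge0_lty_EFin => //; apply: le_lt_trans Hc _; rewrite ltry.
have mE : measurable_fun q E.
  apply: measurable_funTS.
  have mGq : measurable_fun setT (p0 \_ (I `*` setT)).
    apply/(measurable_restrictT _ (measurableX mI measurableT)); exact: measurable_funTS.
  have := measurable_fun_fubini_tonelli_G (m1 := L) _ mGq _.
  rewrite (_ : fubini_G L _ = E); first by apply => w; exact: erestrict_ge0.
  apply/funext => y; rewrite /fubini_G /E [RHS]integral_mkcond; apply: eq_integral => t _.
  rewrite /patch; congr (if _ then _ else _).
  by apply/idP/idP; rewrite !inE /= => // -[].
have inner t : I t -> \int[nu]_(y in q) ((u (row_cons t y) - c) ^+ 2)%:E <=
    2%:E * A + (2 * h)%:E * S0.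
  move=> It.
  have mt0 := measurable_funTS (D := q) (measurable_sqr_EFin (mc t0)).
  have Z1 : \int[nu]_(y in q) (2%:E * ((u (row_cons t0 y) - c) ^+ 2)%:E) = 2%:E * A.
    by apply: ge0_integralZl => [//|//|y _|]; rewrite lee_fin ?sqr_ge0.
  have Z2 : \int[nu]_(y in q) ((2 * h)%:E * E y) = (2 * h)%:E * S0.
    by rewrite S0E; apply: ge0_integralZl => [//|//|y _|]; [exact: E0|rewrite lee_fin mulr_ge0 // ltW].
  rewrite -Z1 -Z2 -ge0_integralD //; last 4 first.
  - by move=> y _; rewrite mule_ge0 // lee_fin sqr_ge0.
  - exact: measurable_funeM.
  - by move=> y _; rewrite mule_ge0 // lee_fin mulr_ge0 // ltW.
  - exact: measurable_funeM.
  apply: ge0_le_integral_set => y _; first by rewrite lee_fin sqr_ge0.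
  have cp : continuous (fun s => partial ord0 u (row_cons s y)).
    move=> s1; apply: (@continuous_comp _ _ _ (fun s => row_cons s y) (partial ord0 u)).
      apply: (@cvg_rV R _ (nbhs s1) _ n.+1 (fun s => row_cons s y) (row_cons s1 y)) => b.
      case: (unliftP ord0 b) => [x|] ->.
        by under eq_cvg do rewrite row_cons_lift; rewrite row_cons_lift; exact: cvg_cst.
      by under eq_cvg do rewrite row_cons0; rewrite row_cons0; exact: cvg_id.
    exact: class_C_continuous (class_C_partial _ Cu) Logic.I.
  have It' : t \in `[a 0%R 0%R, (a 0%R 0%R + h)%R[ by exact: It.
  have := sqr_increment_le (f := fun s => u (row_cons s y)) _ cp t0I It'.
  have der (x : R) : derivable u (row_cons x y) (delta_mx 0 0)%R.
    exact: class_C_derivable Cu Logic.I.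
  move=> /(_ (fun x => partial_row_cons0 (der x))).
  rewrite -/(E y) => incr.
  apply: (@le_trans _ _ (2%:E * ((u (row_cons t0 y) - c) ^+ 2)%:E +
      2%:E * ((u (row_cons t y) - u (row_cons t0 y)) ^+ 2)%:E)).
    rewrite -!EFinM -EFinD lee_fin -subr_ge0.
    set x1 := u (row_cons t y); set x0 := u (row_cons t0 y).
    rewrite (_ : (_ - _ = (x1 - x0 - (x0 - c)) ^+ 2)%R) ?sqr_ge0 //; ring.
  by rewrite leeD2l // (EFinM 2 h) -muleA; apply: lee_wpmul2l.
rewrite (cell_integralS nuP nuP') //; last 2 first.
- apply: measurable_sqr_EFin; apply: measurable_funB => //; exact: measurable_cst.
- by move=> z; rewrite lee_fin sqr_ge0.
apply: (@le_trans _ _ (\int[L]_(t in I) (2%:E * A + (2 * h)%:E * S0))).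
  apply: ge0_le_integral_set => t It; last exact: inner.
  by apply: integral_ge0 => y _; rewrite lee_fin sqr_ge0.
have hE : L I = h%:E.
  by rewrite /L /I /= lebesgue_measure_itv /= lte_fin ltrDl h0 -EFinB addrAC subrr add0r.
rewrite integral_cst // -[X in _ * X]/(L I) hE Aal S0s Ss -!EFinM -!EFinD lee_fin.
move: Hc Dt0; rewrite Aal Dd Ss -EFinM -EFinD !lee_fin => Hc Dt0.
have eE : (e = e' * (K + 2 * h))%R by rewrite /e' divfK // gt_eqF.
have H1 : (2 * h * al <= 2 * h * (2 ^+ n * h ^+ 2 * d + e'))%R.
  by apply: ler_wpM2l => //; rewrite mulr_ge0 // ltW.
have H2 : (K * (h * d) <= K * (s + e'))%R by apply: ler_wpM2l => //; exact: ltW.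
have H3 : (2 * h ^+ 2 * s0 <= K * s0)%R.
  apply: ler_wpM2r; first by rewrite -lee_fin -S0s.
  rewrite /K; apply: ler_wpM2r; first exact: sqr_ge0.
  by rewrite exprS ler_peMr // exprn_ege1 // ler1n.
have KE : K = (2 * (2 ^+ n * h ^+ 2))%R by rewrite /K exprS mulrA.
rewrite eE; move: H1 H2 H3; rewrite KE; set k := (2 ^+ n * h ^+ 2)%R; lra.
Qed.

End poincare.

(** * Positive definite matrices *)

Section quadratic_forms.
Context {R : realType} (n : nat).
Implicit Types (G : 'M[R]_n) (p q : 'rV[R]_n).

Definition bilin G p q : R := (p *m G *m q^T) 0 0.

Lemma bilinE G p q : bilin G p q = \sum_a \sum_b p 0 a * G a b * q 0 b.
Proof.
rewrite /bilin mxE exchange_big /=; apply: eq_bigr => b _.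
by rewrite !mxE mulr_suml.
Qed.

Lemma bilinDl G p p' q : bilin G (p + p') q = bilin G p q + bilin G p' q.
Proof. by rewrite /bilin !mulmxDl mxE. Qed.

Lemma bilinDr G p q q' : bilin G p (q + q') = bilin G p q + bilin G p q'.
Proof. by rewrite /bilin linearD /= mulmxDr mxE. Qed.

Lemma bilinZl G k p q : bilin G (k *: p) q = k * bilin G p q.
Proof. by rewrite /bilin -!scalemxAl mxE. Qed.

Lemma bilinZr G k p q : bilin G p (k *: q) = k * bilin G p q.
Proof. by rewrite /bilin linearZ /= -scalemxAr mxE. Qed.

Lemma bilinC G p q : G^T = G -> bilin G p q = bilin G q p.
Proof.
move=> sG; rewrite /bilin; have -> : (p *m G *m q^T) 0 0 = ((p *m G *m q^T)^T) 0 0 by rewrite [RHS]mxE.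
by rewrite !trmx_mul trmxK sG mulmxA.
Qed.

Definition sqnorm p : R := \sum_a p 0 a ^+ 2.

Lemma sqnorm_ge0 p : 0 <= sqnorm p.
Proof. by apply: sumr_ge0 => a _; exact: sqr_ge0. Qed.

Lemma sqnorm_bilin p : bilin 1%:M p p = sqnorm p.
Proof.
rewrite /bilin mulmx1 mxE; apply: eq_bigr => a _; by rewrite mxE expr2.
Qed.

Lemma sqnorm_gt0 p : p != 0 -> 0 < sqnorm p.
Proof.
move=> p0; rewrite lt_neqAle sqnorm_ge0 andbT eq_sym; apply: contra p0 => /eqP H.
apply/eqP/rowP => a; rewrite mxE; apply/eqP; rewrite -sqrf_eq0.
have := H; rewrite /sqnorm => /eqP; rewrite psumr_eq0 => [/allP|b _]; last exact: sqr_ge0.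
by move=> /(_ a (mem_index_enum _)).
Qed.

Lemma bilin_le_entries G p (B : R) : (forall a b, `|G a b| <= B) ->
  bilin G p p <= n%:R * B * sqnorm p.
Proof.
move=> GB; rewrite bilinE.
apply: (@le_trans _ _ (\sum_a \sum_b B * ((p 0 a ^+ 2 + p 0 b ^+ 2) / 2))).
  apply: ler_sum => a _; apply: ler_sum => b _.
  apply: le_trans (ler_norm _) _; rewrite !normrM mulrAC mulrC.
  apply: ler_pM; [exact: normr_ge0|exact: mulr_ge0|exact: GB|].
  rewrite ler_pdivlMr // -subr_ge0 -(real_normK (num_real (p 0 a))) -(real_normK (num_real (p 0 b))).
  by rewrite (_ : _ - _ = (`|p 0 a| - `|p 0 b|) ^+ 2) ?sqr_ge0 //; ring.
rewrite le_eqVlt; apply/orP; left; apply/eqP.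
under eq_bigr do rewrite -mulr_sumr -mulr_suml big_split /= sumr_const card_ord.
rewrite -mulr_sumr -mulr_suml big_split /= sumr_const card_ord -sumrMnl.
by rewrite -/(sqnorm p) sumrMnl -/(sqnorm p) -mulr2n -mulr_natl -[_ *+ n]mulr_natl; field.
Qed.

Definition posdef G : Prop := forall v : 'rV[R]_n, v != 0 -> 0 < bilin G v v.

Lemma posdef_unit G : posdef G -> G \in unitmx.
Proof.
move=> pG; rewrite unitmxE unitfE; apply/negP => /det0P[v v0 vG].
by have := pG v v0; rewrite /bilin vG mul0mx mxE ltxx.
Qed.

Lemma bilin_inv_gt0 G : G^T = G -> posdef G -> posdef (invmx G).
Proof.
move=> sG pG p p0; have uG := posdef_unit pG.
have v0 : p *m invmx G != 0.
  by apply: contra p0 => /eqP H; rewrite -[p](mulmxKV uG) H mul0mx.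
have := pG _ v0; rewrite /bilin trmx_mul mulmxKV // trmx_inv sG mulmxA; exact.
Qed.

Lemma posdef_ge0 G p : posdef G -> 0 <= bilin G p p.
Proof.
move=> pG; have [->|/pG/ltW //] := eqVneq p 0.
by rewrite /bilin !mul0mx mxE.
Qed.

(** Expand the nonnegative value of the form at [p *m invmx G - C^-1 *: p]. *)
Lemma bilin_inv_ge G p (C : R) : G^T = G -> posdef G -> 0 < C ->
  (forall v, bilin G v v <= C * sqnorm v) -> C^-1 * sqnorm p <= bilin (invmx G) p p.
Proof.
move=> sG pG C0 GC; have uG := posdef_unit pG.
have := posdef_ge0 (p *m invmx G + (- C^-1) *: p) pG.
rewrite bilinDl !bilinDr bilinZl bilinZr bilinZr bilinZl (bilinC p _ sG).
have E1 : bilin G (p *m invmx G) p = sqnorm p.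
  by rewrite /bilin mulmxKV // -sqnorm_bilin /bilin mulmx1.
have E2 : bilin G (p *m invmx G) (p *m invmx G) = bilin (invmx G) p p.
  by rewrite /bilin trmx_mul mulmxKV // trmx_inv sG mulmxA.
rewrite E1 E2 => H.
have H1 := GC p.
have : C^-1 * (C^-1 * bilin G p p) <= C^-1 * sqnorm p.
  rewrite ler_pM2l ?invr_gt0 //; rewrite -ler_pdivlMl ?invr_gt0 // invrK; exact: H1.
move: H; rewrite !mulNr mulrN opprK; lra.
Qed.

End quadratic_forms.

Section matrix_continuity.
Context {R : realType} (T : Type) (F : set_system T) (FF : Filter F).

Lemma det_cvg n (B : T -> 'M[R]_n) (l : 'M[R]_n) :
  (forall a b, B t a b @[t --> F] --> l a b) -> \det (B t) @[t --> F] --> \det l.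
Proof.
move=> Bl; apply: cvg_big => [|s _]; first exact: add_continuous.
apply: cvgM; first exact: cvg_cst.
by apply: cvg_big => [|i _]; [exact: mul_continuous|exact: Bl].
Qed.

Lemma invmx_cvg n (B : T -> 'M[R]_n) (l : 'M[R]_n) : l \in unitmx ->
  (forall a b, B t a b @[t --> F] --> l a b) ->
  forall a b, invmx (B t) a b @[t --> F] --> invmx l a b.
Proof.
move=> ul Bl a b.
have dl : \det l != 0 by rewrite -unitfE -unitmxE.
have dB : \det (B t) @[t --> F] --> \det l by exact: det_cvg.
have nB : \forall t \near F, (\det (B t))^-1 * cofactor (B t) b a = invmx (B t) a b.
  have : \forall t \near F, \det (B t) != 0.
    exact: cvgr_neq0 dB dl.
  apply: filterS => t dt; rewrite /invmx unitmxE unitfE dt.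
  by rewrite !mxE.
have -> : invmx l a b = (\det l)^-1 * cofactor l b a by rewrite /invmx ul !mxE.
apply: cvg_trans (near_eq_cvg nB) _.
apply: cvgM; first exact: cvgV.
apply: cvgM; first exact: cvg_cst.
by apply: det_cvg => c d; under eq_cvg do rewrite !mxE; rewrite !mxE; exact: Bl.
Qed.

Lemma bilin_cvg n (B : T -> 'M[R]_n) (p q : T -> 'rV[R]_n)
    (l : 'M[R]_n) (p0 q0 : 'rV[R]_n) :
  (forall a b, B t a b @[t --> F] --> l a b) ->
  (forall a, p t 0 a @[t --> F] --> p0 0 a) -> (forall a, q t 0 a @[t --> F] --> q0 0 a) ->
  bilin (B t) (p t) (q t) @[t --> F] --> bilin l p0 q0.
Proof.
move=> Bl pl ql; rewrite bilinE; under eq_cvg do rewrite bilinE.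
apply: cvg_big => [|a _]; first exact: add_continuous.
apply: cvg_big => [|b _]; first exact: add_continuous.
by apply: cvgM => //; exact: cvgM.
Qed.

End matrix_continuity.

Section posdef_det.
Context {R : realType} (n : nat).

(** The segment from the identity to [G] consists of positive definite, hence
    invertible, matrices, so the determinant keeps the sign it has at the identity. *)
Lemma posdef_det_gt0 (G : 'M[R]_n) : posdef G -> 0 < \det G.
Proof.
move=> pG.
(* Were [\det G] nonpositive, the determinant would vanish somewhere on the segment. *)
pose B (t : R) := (1 - t) *: 1%:M + t *: G.
have pB t : 0 <= t <= 1 -> posdef (B t).
  move=> /andP[t0 t1] v v0; rewrite /bilin /B mulmxDr mulmxDl mxE.
  rewrite -!scalemxAr -!scalemxAl mxE [X in _ + X]mxE -!/(bilin _ _ _) sqnorm_bilin.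
  have H1 := sqnorm_gt0 v0; have H2 := pG v v0.
  have [->|tn0] := eqVneq t 0; first by rewrite subr0 mul1r mul0r addr0.
  apply: ltr_wpDl; first by apply: mulr_ge0; [rewrite subr_ge0|exact: ltW].
  by apply: mulr_gt0 => //; rewrite lt_neqAle eq_sym tn0.
rewrite ltNge; apply/negP => G0.
have [||c] := @IVT R (fun t => \det (B t)) 0 1 0 ler01.
- apply: continuous_subspaceT => t; apply: det_cvg => a b.
  rewrite /B mxE [X in X + _]mxE [X in _ + X]mxE; under eq_cvg do rewrite mxE [X in X + _]mxE [X in _ + X]mxE.
  apply: cvgD; (apply: cvgM; last exact: cvg_cst); last exact: cvg_id.
  by apply: cvgB; [exact: cvg_cst|exact: cvg_id].
- have -> : B 0 = 1%:M by rewrite /B subr0 scale1r scale0r addr0.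
  have -> : B 1 = G by rewrite /B subrr scale0r scale1r add0r.
  by rewrite det1 ge_min G0 orbT le_max ler01.
rewrite in_itv /= => c01 Bc.
by have := posdef_unit (pB c c01); rewrite unitmxE Bc unitr0.
Qed.

End posdef_det.

(** * Gradients of real functions in charts *)

Section charts.
Context {R : realType} {n : nat} {M : ptopologicalType} {A : smooth_atlas R n M}.
Implicit Types (i j : chart A) (f h : M -> R) (x : M).

Definition chart_cod i : set 'rV[R]_n := chart_map i @` chart_dom i.

Lemma open_cod i : open (chart_cod i). Proof. exact: open_chart_codom. Qed.
Arguments open_cod : clear implicits.

Lemma cod_map i x : chart_dom i x -> chart_cod i (chart_map i x).
Proof. by exists x. Qed.

Lemma dom_inv i y : chart_cod i y -> chart_dom i (chart_inv i y).
Proof. by move=> [x dx <-]; rewrite chart_mapK. Qed.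

Lemma chart_invK i y : chart_cod i y -> chart_map i (chart_inv i y) = y.
Proof. by move=> [x dx <-]; rewrite chart_mapK. Qed.

Lemma chart_image i (B : set M) :
  chart_map i @` (chart_dom i `&` B) = chart_cod i `&` chart_inv i @^-1` B.
Proof.
apply/seteqP; split => [_ [x [dx Bx] <-]|y [cy By]].
  by split; [exists x|rewrite /= chart_mapK].
by exists (chart_inv i y); [split => //; exact: dom_inv|exact: chart_invK].
Qed.

Lemma open_chart_image i (B : set M) : open B -> open (chart_map i @` (chart_dom i `&` B)).
Proof.
move=> oB; rewrite chart_image; apply: open_preimage_on => //; first exact: open_cod.
by move=> y cy; exact: chart_inv_continuous.
Qed.

Lemma class_C_transition k i j (b : 'I_n) :
  class_C k (chart_map i @` (chart_dom i `&` chart_dom j))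
    (fun y => chart_map j (chart_inv i y) 0 b).
Proof. exact: transition_smooth. Qed.

(** Graded by [k] because gradients only see order 1, whereas test functions must
    be of every order. *)
Definition csmooth (k : nat) f : Prop := forall i, class_C k (chart_cod i) (f \o chart_inv i).

Lemma csmoothM k f h : csmooth k f -> csmooth k h -> csmooth k (f \* h).
Proof. by move=> Cf Ch i; have := class_CM (open_cod i) (Cf i) (Ch i); exact. Qed.

Lemma csmoothD k f h : csmooth k f -> csmooth k h -> csmooth k (f \+ h).
Proof. by move=> Cf Ch i; have := class_CD (open_cod i) (Cf i) (Ch i); exact. Qed.

Lemma csmoothN k f : csmooth k f -> csmooth k (fun x => - f x).
Proof. by move=> Cf i; exact: (class_CN (open_cod i) (Cf i)). Qed.

Lemma near_chart i x : chart_dom i x ->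
  \near x, chart_dom i x.
Proof. by move=> dx; apply: open_nbhs_nbhs; split => //; exact: open_chart_dom. Qed.

Lemma csmooth_continuous k f : csmooth k f -> continuous f.
Proof.
move=> Cf x; set i := chart_at A x; have dx : chart_dom i x by exact: chart_atP.
have nE : \near x, f (chart_inv i (chart_map i x)) = f x.
  by apply: filterS (near_chart dx) => z dz; rewrite chart_mapK.
have cF : {for x, continuous ((f \o chart_inv i) \o chart_map i)}.
  apply: continuous_comp; first exact: chart_map_continuous.
  exact: class_C_continuous (Cf i) (cod_map dx).
have E : ((f \o chart_inv i) \o chart_map i) x = f x by rewrite /= chart_mapK.
have H : f @ x --> ((f \o chart_inv i) \o chart_map i) x := cvg_trans (near_eq_cvg nE) cF.
by rewrite E in H; exact: H.
Qed.

Definition dchart i f (y : 'rV[R]_n) : 'rV[R]_n := \row_a partial a (f \o chart_inv i) y.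

Lemma dchartM i f h y : csmooth 1 f -> csmooth 1 h -> chart_cod i y ->
  dchart i (f \* h) y = f (chart_inv i y) *: dchart i h y + h (chart_inv i y) *: dchart i f y.
Proof.
move=> Cf Ch cy; apply/rowP => a; rewrite !mxE.
rewrite (_ : (f \* h) \o chart_inv i = (f \o chart_inv i) \* (h \o chart_inv i)) //.
by rewrite partialM //; [exact: class_C_derivable (Cf i) cy|exact: class_C_derivable (Ch i) cy].
Qed.

Lemma dchart_near i f h x : chart_dom i x -> (\near x, f x = h x) ->
  dchart i f (chart_map i x) = dchart i h (chart_map i x).
Proof.
move=> dx nfh; apply/rowP => a; rewrite !mxE; apply: near_partial.
have cc := chart_inv_continuous (cod_map dx).
have := cc [set z | f z = h z]; rewrite /= chart_mapK //; exact.
Qed.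

(** Transition maps are smooth on the image of the overlap, which is open. *)
Lemma tau_differentiable i j x (b : 'I_n) : chart_dom i x -> chart_dom j x ->
  differentiable (fun y => chart_map j (chart_inv i y) 0 b) (chart_map i x).
Proof.
move=> dx ex; apply: (class_C1_differentiable _ (class_C_transition 1 i j b) _).1.
  by apply: open_chart_image; exact: open_chart_dom.
by exists x.
Qed.

(** The chain rule for the transition map: differentials transform as covectors. *)
Lemma dchart_transition i j f x : csmooth 1 f -> chart_dom i x -> chart_dom j x ->
  dchart i f (chart_map i x) =
  dchart j f (chart_map j x) *m ('J (chart_map j \o chart_inv i) (chart_map i x))^T.
Proof.
move=> Cf dx ex; set y := chart_map i x; set tau := chart_map j \o chart_inv i.
have tauy : tau y = chart_map j x by rewrite /tau /y /= chart_mapK.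
have dtau b : differentiable (fun y => tau y 0 b) y by exact: tau_differentiable.
apply/rowP => a; rewrite !mxE.
have nE : \near y, (f \o chart_inv j) (tau y) = (f \o chart_inv i) y.
  have oV : open (chart_map i @` (chart_dom i `&` chart_dom j)).
    by apply: open_chart_image; exact: open_chart_dom.
  have Vy : (chart_map i @` (chart_dom i `&` chart_dom j)) y by exists x.
  apply: filterS (open_nbhs_nbhs (conj oV Vy)) => z [x' [dx' ex'] <-].
  by rewrite /tau /= !chart_mapK.
rewrite -(near_partial a nE).
have cj := cod_map ex.
have [df dfE] := class_C1_differentiable (open_cod j) (Cf j) cj.
rewrite -tauy in df dfE *.
have := partial_comp (f := f \o chart_inv j) (g := tau) a df dfE dtau => -[_ ->].
apply: eq_bigr => b _; rewrite !mxE /=; congr (_ * _).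
by rewrite -derive_rV_coord //; exact: differentiable_rV.
Qed.

End charts.
Arguments open_cod {R n M A} i.

Section gradient_product.
Context {R : realType} {n : nat} {M : ptopologicalType} {A : smooth_atlas R n M}.
Variable g : riemannian_metric A.
Implicit Types (i j : chart A) (f h : M -> R) (x : M).

Lemma gram_posdef i y : chart_cod i y -> posdef (gram g i y).
Proof. by move=> cy v v0; exact: gram_pos. Qed.

Lemma gram_unit i y : chart_cod i y -> gram g i y \in unitmx.
Proof. by move=> cy; apply: posdef_unit; exact: gram_posdef. Qed.

Definition cotangent i y : 'rV[R]_n -> 'rV[R]_n -> R := bilin (invmx (gram g i y)).

Lemma cotangentC i y p q : chart_cod i y -> cotangent i y p q = cotangent i y q p.
Proof. by move=> cy; apply: bilinC; rewrite trmx_inv gram_sym. Qed.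

Lemma cotangent_ge0 i y p : chart_cod i y -> 0 <= cotangent i y p p.
Proof.
move=> cy; apply: posdef_ge0; apply: bilin_inv_gt0; first exact: gram_sym.
exact: gram_posdef.
Qed.

Definition gdot i f h (y : 'rV[R]_n) : R := cotangent i y (dchart i f y) (dchart i h y).

(** Pointwise product of gradients for real functions, the real counterpart of
    [grad_dot]; [Re_grad_dot] relates them. *)
Definition rgrad f h x : R := gdot (chart_at A x) f h (chart_map (chart_at A x) x).

(** The Jacobian that transforms covectors is the one that transforms the Gram
    matrix, and it cancels against the inverse. *)
Lemma gdot_chart i j f h x : csmooth (A := A) 1 f -> csmooth (A := A) 1 h ->
  chart_dom i x -> chart_dom j x ->
  gdot i f h (chart_map i x) = gdot j f h (chart_map j x).
Proof.
move=> Cf Ch dx ex; rewrite /gdot /cotangent /bilin.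
rewrite (dchart_transition Cf dx ex) (dchart_transition Ch dx ex).
set J := 'J _ _.
have Gij : gram g i (chart_map i x) = J *m gram g j (chart_map j x) *m J^T.
  have V : (chart_map i @` (chart_dom i `&` chart_dom j)) (chart_map i x) by exists x.
  by have := @gram_transition _ _ _ _ g i j _ V; rewrite /= chart_mapK.
have uj := gram_unit (cod_map ex).
have := gram_unit (cod_map dx); rewrite Gij !unitmx_mul unitmx_tr => /andP[/andP[uJ _] _].
set Gj := gram g j _ in Gij uj *.
have E : J^T *m invmx (J *m Gj *m J^T) *m J = invmx Gj.
  have H : J^T *m invmx (J *m Gj *m J^T) *m J *m Gj = 1%:M.
    have uJt : J^T \in unitmx by rewrite unitmx_tr.
    have uG := gram_unit (cod_map dx); rewrite Gij in uG.
    rewrite -[LHS](mulmxK uJt).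
    rewrite (_ : _ *m Gj *m J^T = J^T *m (invmx (J *m Gj *m J^T) *m (J *m Gj *m J^T))).
      by rewrite mulVmx // mulmx1 mulmxV.
    by rewrite !mulmxA.
  by rewrite -[LHS](mulmxK uj) H mul1mx.
by rewrite trmx_mul trmxK -E !mulmxA.
Qed.

Lemma rgradE i f h x : csmooth (A := A) 1 f -> csmooth (A := A) 1 h -> chart_dom i x ->
  rgrad f h x = gdot i f h (chart_map i x).
Proof. by move=> Cf Ch dx; apply: gdot_chart => //; exact: chart_atP. Qed.

Lemma rgradC f h x : rgrad f h x = rgrad h f x.
Proof. by apply: cotangentC; apply: cod_map; exact: chart_atP. Qed.

Lemma rgrad_ge0 f x : 0 <= rgrad f f x.
Proof. by apply: cotangent_ge0; apply: cod_map; exact: chart_atP. Qed.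

Lemma rgrad_continuous f h : csmooth (A := A) 1 f -> csmooth (A := A) 1 h ->
  continuous (rgrad f h).
Proof.
move=> Cf Ch x; set i := chart_at A x; have dx : chart_dom i x by exact: chart_atP.
have nE : \near x, (gdot i f h \o chart_map i) x = rgrad f h x.
  by apply: filterS (near_chart dx) => z dz; rewrite (rgradE Cf Ch dz).
have cy := cod_map dx.
have cF : {for x, continuous (gdot i f h \o chart_map i)}.
  apply: continuous_comp; first exact: chart_map_continuous.
  have cd f' a : csmooth (A := A) 1 f' -> dchart i f' y 0 a @[y --> chart_map i x] --> dchart i f' (chart_map i x) 0 a.
    move=> Cf'; rewrite mxE; under eq_cvg do rewrite mxE.
    exact: (class_C_continuous (class_C_partial a (Cf' i)) cy).
  apply: (@bilin_cvg R _ (nbhs (chart_map i x)) _ n (fun y => invmx (gram g i y))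
      (dchart i f) (dchart i h)) => [a b|a|a]; [|exact: cd|exact: cd].
  apply: (@invmx_cvg R _ (nbhs (chart_map i x)) _ n (gram g i)); first exact: gram_unit.
  move=> {a b} a b; exact: (class_C_continuous (@gram_smooth _ _ _ _ g i a b 0) cy).
have H : rgrad f h @ x --> (gdot i f h \o chart_map i) x := cvg_trans (near_eq_cvg nE) cF.
exact: H.
Qed.

Lemma rgrad_near0 f h x : (\near x, h x = 0) -> rgrad f h x = 0.
Proof.
move=> nh; have dx := chart_atP A x.
rewrite /rgrad /gdot (dchart_near (h := cst 0) dx nh).
rewrite (_ : dchart _ (cst 0) _ = 0) ?/cotangent /bilin ?trmx0 ?mulmx0 ?mxE //.
by apply/rowP => a; rewrite !mxE partial_cst.
Qed.

(** Pointwise Caccioppoli inequality.  Writing [p] and [r] for the differentials of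
    [f] and [X], the difference of the two sides is the square of the norm of
    [X *: p + (2 * f) *: r]. *)
Lemma rgrad_cutoff f X x : csmooth (A := A) 1 f -> csmooth (A := A) 1 X ->
  X x ^+ 2 * rgrad f f x <=
    2 * rgrad f (X \* X \* f) x + 4 * f x ^+ 2 * rgrad X X x.
Proof.
move=> Cf CX; have dx := chart_atP A x; have cy := cod_map dx.
rewrite /rgrad /gdot (dchartM (csmoothM CX CX) Cf cy) (dchartM CX CX cy) /= chart_mapK //.
set p := dchart _ f _; set r := dchart _ X _.
have := cotangent_ge0 (X x *: p + (2 * f x) *: r) cy.
rewrite /cotangent !(bilinDl, bilinDr, bilinZl, bilinZr).
rewrite -!/(cotangent _ _ _ _) (cotangentC r p cy).
lra.
Qed.

(** By the parallelogram law: the defect is the squared norm of [X *: p - f *: r],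
    with [p] and [r] the differentials of [f] and [X]. *)
Lemma rgradM_le f X x : csmooth (A := A) 1 f -> csmooth (A := A) 1 X ->
  rgrad (X \* f) (X \* f) x <= 2 * (X x ^+ 2 * rgrad f f x) + 2 * (f x ^+ 2 * rgrad X X x).
Proof.
move=> Cf CX; have dx := chart_atP A x; have cy := cod_map dx.
rewrite /rgrad /gdot (dchartM CX Cf cy) /= chart_mapK //.
set p := dchart _ f _; set r := dchart _ X _.
have := cotangent_ge0 (X x *: p + (- f x) *: r) cy.
rewrite /cotangent !(bilinDl, bilinDr, bilinZl, bilinZr).
rewrite -!/(cotangent _ _ _ _) (cotangentC r p cy).
lra.
Qed.

End gradient_product.

(** * The Riemannian measure in a coordinate box *)

Section transport.
Local Open Scope ereal_scope.

Lemma le_measure_ge0_integral_on d (T : measurableType d) (R : realType)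
    (m1 m2 : {measure set T -> \bar R}) (D : set T) (f : T -> \bar R) : measurable D ->
  (forall S, measurable S -> S `<=` D -> m1 S <= m2 S) -> (forall x, D x -> 0 <= f x) ->
  \int[m1]_(x in D) f x <= \int[m2]_(x in D) f x.
Proof.
move=> mD m12 f0.
have E (m : {measure set T -> \bar R}) :
    \int[m]_(x in D) f x = \int[mrestr m mD]_x (f \_ D) x.
  rewrite -integral_mkcond; apply: eq_measure_integral => S mS SD.
  by rewrite /= /mrestr setIidl.
rewrite !E; apply: le_measure_ge0_integral => [S mS|x]; last exact: erestrict_ge0.
by apply: m12; [exact: measurableI|exact: subIsetr].
Qed.

Lemma ge0_integral_mrestr d (T : measurableType d) (R : realType)
    (m : {measure set T -> \bar R}) (S Y : set T) (mS : measurable S) (f : T -> \bar R) :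
  measurable Y -> S `<=` Y -> measurable_fun Y f -> (forall x, Y x -> 0 <= f x) ->
  \int[mrestr m mS]_(x in Y) f x = \int[m]_(x in S) f x.
Proof.
move=> mY SY mf f0; rewrite -{1}(setDUK SY).
have mYS : measurable (Y `\` S) by exact: measurableD.
rewrite ge0_integral_setU //; last 3 first.
- by rewrite setDUK.
- by rewrite setDUK.
- by apply/disj_setPS => x [Sx []].
have -> : \int[mrestr m mS]_(x in Y `\` S) f x = 0.
  rewrite (eq_measure_integral mzero) ?integral_measure_zero // => E mE EY.
  rewrite /= /mrestr (_ : E `&` S = set0) ?measure0 //.
  by apply/seteqP; split => // x [/EY[_ nS] Sx].
rewrite adde0; apply: eq_measure_integral => E mE ES.
by rewrite /= /mrestr setIidl.
Qed.

Context d1 d2 (X : measurableType d1) (Y : measurableType d2) (R : realType).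
Variables (m1 : {measure set X -> \bar R}) (m2 : {measure set Y -> \bar R}).
Variables (psi : Y -> X) (D : set X) (S : set Y) (k : {nonneg R}).
Hypotheses (mpsi : measurable_fun setT psi) (mD : measurable D) (mS : measurable S).
Hypothesis SD : S `<=` psi @^-1` D.
Variable f : X -> \bar R.
Hypotheses (mf : measurable_fun setT f) (f0 : forall x, 0 <= f x).

Let pm : {measure set X -> \bar R} :=
  measure_function_pushforward__canonical__measure_function_Measure (mrestr m2 mS) mpsi.

Let transported : \int[mscale k pm]_(x in D) f x = k%:num%:E * \int[m2]_(y in S) f (psi y).
Proof.
have mfD := measurable_funTS (D := D) mf.
rewrite ge0_integral_mscale //.
congr (_ * _); rewrite ge0_integral_pushforward //.
rewrite ge0_integral_mrestr //.
- by rewrite -[X in measurable X]setTI; exact: mpsi.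
- apply: measurable_funTS; exact: measurableT_comp.
- by move=> y _; exact: f0.
Qed.

Lemma integral_transport_le :
  (forall B, measurable B -> B `<=` D -> m1 B <= k%:num%:E * m2 (psi @^-1` B `&` S)) ->
  \int[m1]_(x in D) f x <= k%:num%:E * \int[m2]_(y in S) f (psi y).
Proof.
move=> H; rewrite -transported; apply: le_measure_ge0_integral_on => //.
Qed.

Lemma integral_transport_ge :
  (forall B, measurable B -> B `<=` D -> k%:num%:E * m2 (psi @^-1` B `&` S) <= m1 B) ->
  k%:num%:E * \int[m2]_(y in S) f (psi y) <= \int[m1]_(x in D) f x.
Proof.
move=> H; rewrite -transported; apply: le_measure_ge0_integral_on => //.
Qed.

End transport.

Section lebesgue_rV_theory.
Context {R : realType}.
Local Open Scope ereal_scope.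

Lemma integral_rV_ge0 n (f : 'rV[R]_n -> \bar R) :
  (forall y, 0 <= f y) -> 0 <= integral_rV f.
Proof.
elim: n f => [|n IH] f f0 /=; first exact: f0.
by apply: integral_ge0 => t _; apply: IH => y; exact: f0.
Qed.

Lemma integral_rV_le n (f h : 'rV[R]_n -> \bar R) :
  (forall y, 0 <= f y) -> (forall y, f y <= h y) -> integral_rV f <= integral_rV h.
Proof.
elim: n f h => [|n IH] f h f0 fh /=; first exact: fh.
apply: ge0_le_integral_set => t _; first by apply: integral_rV_ge0 => y; exact: f0.
by apply: IH => y; [exact: f0|exact: fh].
Qed.

Lemma lebesgue_rV_cell n (nu : {measure set (borel 'rV[R]_n) -> \bar R}) a (h : R) :
  is_lebesgue_rV nu -> (0 < h)%R -> nu (cell a h) = (h ^+ n)%:E.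
Proof.
move=> + h0; elim: n nu a => [|n IH] nu a nuP.
  have := nuP (cst 1) _ _; rewrite /= integral_cst // mul1e => H.
  rewrite expr0 H //; congr (nu _).
  by apply/seteqP; split => y // _ [].
have [nu1 nu1P] := @integral_rV_measure R n.
have mc := @measurable_cell R n.+1 a h.
rewrite -[LHS]mul1e -integral_cst // (cell_integralS nu1P nuP) //.
rewrite (eq_integral (cst (h ^+ n)%:E)); last first.
  move=> t _; rewrite integral_cst; last exact: measurable_cell.
  by rewrite mul1e (IH nu1).
rewrite integral_cst // exprS mulrC EFinM; congr (_ * _).
by rewrite /= lebesgue_measure_itv /= lte_fin ltrDl h0 -EFinB addrAC subrr add0r.
Qed.

End lebesgue_rV_theory.

Section box.
Context {R : realType} {n : nat} {M : ptopologicalType}.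
Hypothesis hausdorffM : hausdorff_space M.
Context {A : smooth_atlas R n M} (g : riemannian_metric A).
Variable mu : {measure set (borel M) -> \bar R}.
Hypothesis mu_g : riemannian_measure g mu.
Variables (i : chart A) (y0 : 'rV[R]_n) (r : R).
Hypothesis r_gt0 : 0 < r.

(** Closed cubes rather than balls, since they are cut into equal cells. *)
Definition box : set 'rV[R]_n := [set y | forall b, `|y 0 b - y0 0 b| <= r].

Hypothesis box_cod : box `<=` chart_cod i.

Definition boxM : set M := chart_inv i @` box.

Lemma boxMP x : boxM x <-> chart_dom i x /\ box (chart_map i x).
Proof.
split => [[y By <-]|[dx Bx]].
  have cy := box_cod By; split; [exact: dom_inv|by rewrite chart_invK].
by exists (chart_map i x); rewrite ?chart_mapK.
Qed.

Lemma box_center : box y0.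
Proof. by move=> b; rewrite subrr normr0 ltW. Qed.

Lemma compact_box : compact box.
Proof.
rewrite (_ : box = [set v : 'rV[R]_n | forall b, `[y0 0 b - r, y0 0 b + r]%classic (v ord0 b)]).
  by apply: (@rV_compact R n (fun b => `[y0 0 b - r, y0 0 b + r]%classic)) => b; exact: segment_compact.
apply/seteqP; split => y H b; have := H b; rewrite /= in_itv /= ler_norml.
  by move=> /andP[h1 h2]; apply/andP; split; lra.
by move=> /andP[h1 h2]; apply/andP; split; lra.
Qed.

Lemma box_within (U : topologicalType) (f : 'rV[R]_n -> U) :
  (forall y, chart_cod i y -> {for y, continuous f}) -> {within box, continuous f}.
Proof.
by move=> cf; apply: continuous_in_subspaceT => y; rewrite inE => /box_cod; exact: cf.
Qed.

Lemma compact_boxM : compact boxM.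
Proof.
apply: continuous_compact; last exact: compact_box.
by apply: box_within => y cy; exact: chart_inv_continuous.
Qed.

Lemma closed_boxM : closed boxM.
Proof. exact: (compact_closed hausdorffM compact_boxM). Qed.

Lemma box_bounded (f : 'rV[R]_n -> R) :
  (forall y, chart_cod i y -> {for y, continuous f}) ->
  exists2 C : R, 0 < C & forall y, box y -> f y <= C.
Proof.
move=> cf; have [|||c _ H] := @compact_EVT_max _ R f box.
- by exists y0; exact: box_center.
- exact: compact_box.
- exact: box_within.
exists (Num.max 1 (f c)); first by rewrite lt_max ltr01.
by move=> y By; rewrite le_max H ?orbT // inE.
Qed.

Lemma entries_bounded (f : 'I_n -> 'I_n -> 'rV[R]_n -> R) :
  (forall a b y, chart_cod i y -> {for y, continuous (f a b)}) ->
  exists2 C : R, 0 < C & forall y, box y -> forall a b, `|f a b y| <= C.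
Proof.
move=> cf; have [|C C0 HC] := @box_bounded (fun y => \sum_a \sum_b `|f a b y|).
  suff Cs : class_C 0%N (chart_cod i) (fun y => \sum_a \sum_b `|f a b y|).
    by move=> y; exact: class_C_continuous Cs.
  apply: (class_C_sum (F := fun a y => \sum_b `|f a b y|) (open_cod i)) => a.
  apply: (class_C_sum (F := fun b y => `|f a b y|) (open_cod i)) => b.
  split => // y cy; apply: (@continuous_comp _ _ _ (f a b) Num.norm); first exact: cf.
  exact: norm_continuous.
exists C => // y By a b; apply: le_trans (HC y By).
rewrite (bigD1 a) //= (bigD1 b) //= -addrA lerDl addr_ge0 ?sumr_ge0 // => a' _.
by apply: sumr_ge0.
Qed.

Lemma gram_continuous a b y : chart_cod i y -> {for y, continuous (fun y => gram g i y a b)}.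
Proof.
by move=> cy; exact: (class_C_continuous (@gram_smooth _ _ _ _ g i a b 0) cy).
Qed.

Lemma gram_inv_continuous a b y : chart_cod i y ->
  {for y, continuous (fun y => invmx (gram g i y) a b)}.
Proof.
move=> cy; apply: (@invmx_cvg R _ (nbhs y) _ n (gram g i)); first exact: gram_unit.
by move=> c d; exact: gram_continuous.
Qed.

Definition vol (y : 'rV[R]_n) : R := Num.sqrt (\det (gram g i y)).

Lemma vol_gt0 y : chart_cod i y -> 0 < vol y.
Proof. by move=> cy; rewrite sqrtr_gt0; apply: posdef_det_gt0; exact: gram_posdef. Qed.

Lemma vol_continuous y : chart_cod i y -> {for y, continuous vol}.
Proof.
move=> cy; apply: (@continuous_comp _ _ _ (fun y => \det (gram g i y)) Num.sqrt).
  by apply: (@det_cvg R _ (nbhs y) _ n (gram g i)) => a b; exact: gram_continuous.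
exact: sqrt_continuous.
Qed.

Lemma vol_bounds : exists C : R, [/\ 0 < C, forall y, box y -> vol y <= C &
  forall y, box y -> C^-1 <= vol y].
Proof.
have [C C0 HC] := box_bounded vol_continuous.
have [y cy|D D0 HD] := @box_bounded (fun y => (vol y)^-1).
  have := cvgV (lt0r_neq0 (vol_gt0 cy)) (vol_continuous cy); exact.
exists (C + D); split; first exact: addr_gt0.
  by move=> y By; rewrite (le_trans (HC y By)) // lerDl ltW.
move=> y By; have vy := vol_gt0 (box_cod By).
rewrite -[leRHS]invrK lef_pV2 ?posrE ?invr_gt0 ?addr_gt0 //.
by rewrite (le_trans (HD y By)) // lerDr ltW.
Qed.

Lemma cotangent_bounds : exists C : R, [/\ 0 < C,
  forall y p, box y -> cotangent g i y p p <= C * sqnorm p &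
  forall y p, box y -> sqnorm p <= C * cotangent g i y p p].
Proof.
have [B B0 HB] := entries_bounded gram_continuous.
have [D D0 HD] := entries_bounded gram_inv_continuous.
pose C : R := (n%:R + 1) * (B + D).
have n1 : 0 < n%:R + 1 :> R by rewrite ltr_wpDl.
have C0 : 0 < C by apply: mulr_gt0 => //; exact: addr_gt0.
have nB : n%:R * B <= C.
  by apply: ler_pM; rewrite ?ler0n ?(ltW B0) ?lerDl ?ler01 ?(ltW D0).
have nD : n%:R * D <= C.
  by apply: ler_pM; rewrite ?ler0n ?(ltW D0) ?lerDl ?lerDr ?ler01 ?(ltW B0).
exists C; split => // y p By.
  apply: le_trans (bilin_le_entries _ (HD y By)) _.
  by rewrite ler_wpM2r ?sqnorm_ge0.
have cy := box_cod By.
have := @bilin_inv_ge R n (gram g i y) p C (@gram_sym _ _ _ _ g i y cy) (gram_posdef g cy) C0 _.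
rewrite ler_pdivrMl //; apply => v.
apply: le_trans (bilin_le_entries _ (HB y By)) _.
by rewrite ler_wpM2r ?sqnorm_ge0.
Qed.

End box.

Section chart_measure.
Context {R : realType} {n : nat} {M : ptopologicalType}.
Hypothesis hausdorffM : hausdorff_space M.
Context {A : smooth_atlas R n M} (g : riemannian_metric A).
Variable mu : {measure set (borel M) -> \bar R}.
Hypothesis mu_g : riemannian_measure g mu.
Variables (i : chart A) (y0 : 'rV[R]_n) (r : R).
Hypothesis r_gt0 : 0 < r.
Hypothesis box_cod : box y0 r `<=` chart_cod i.
Variable nu : {sigma_finite_measure set (borel 'rV[R]_n) -> \bar R}.
Hypothesis nuP : is_lebesgue_rV nu.

Lemma measurable_cod : measurable (chart_cod i : set (borel 'rV[R]_n)).
Proof. exact: borel_open (open_cod i). Qed.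

Lemma measurable_image_chart (B : set (borel M)) : measurable B -> B `<=` chart_dom i ->
  measurable (chart_map i @` B : set (borel 'rV[R]_n)).
Proof.
move=> mB Bd.
have -> : chart_map i @` B = chart_cod i `&` chart_inv i @^-1` B.
  by rewrite -chart_image setIidr.
have mi : measurable_fun (chart_cod i : set (borel 'rV[R]_n)) (chart_inv i : borel 'rV[R]_n -> borel M).
  by apply: borel_continuous_on (open_cod i) _ => y cy; exact: chart_inv_continuous.
by apply: mi => //; exact: measurable_cod.
Qed.

(** The inverse chart, made measurable on the whole space by a junk value outside
    the range of the chart. *)
Definition inv0 : borel 'rV[R]_n -> borel M := (chart_inv i : _ -> M) \_ (chart_cod i).

Lemma inv0E y : chart_cod i y -> inv0 y = chart_inv i y.
Proof. by move=> cy; rewrite /inv0 /patch mem_set. Qed.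

Lemma measurable_inv0 : measurable_fun setT inv0.
Proof.
apply/(measurable_restrictT _ measurable_cod).
by apply: borel_continuous_on (open_cod i) _ => y cy; exact: chart_inv_continuous.
Qed.

Lemma measurable_image_inv (S : set (borel 'rV[R]_n)) : measurable S -> S `<=` chart_cod i ->
  measurable (chart_inv i @` S : set (borel M)).
Proof.
move=> mS Sc.
have -> : chart_inv i @` S = chart_dom i `&` chart_map i @^-1` S.
  apply/seteqP; split => [_ [y Sy <-]|x [dx Sx]].
    have cy := Sc _ Sy; split; first exact: dom_inv.
    by rewrite /= chart_invK.
  by exists (chart_map i x) => //; rewrite chart_mapK.
have mm : measurable_fun (chart_dom i : set (borel M)) (chart_map i : borel M -> borel 'rV[R]_n).
  apply: borel_continuous_on; first exact: open_chart_dom.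
  by move=> x dx; exact: chart_map_continuous.
by apply: mm => //; apply: borel_open; exact: open_chart_dom.
Qed.

Lemma image_chart_inv0 (S : set 'rV[R]_n) (B : set M) : S `<=` chart_cod i ->
  B `<=` chart_inv i @` S -> chart_map i @` B = inv0 @^-1` B `&` S.
Proof.
move=> Sc BD; apply/seteqP; split => [_ [x Bx <-]|y [By Sy]].
  have [y Sy yx] := BD _ Bx; have cy := Sc _ Sy.
  by split; rewrite -yx chart_invK //= inv0E // yx.
move: By; rewrite /= inv0E; last exact: Sc.
by move=> By; exists (chart_inv i y) => //; rewrite chart_invK //; exact: Sc.
Qed.

(** On a compact box the density [vol] lies between two positive constants, so the
    Riemannian measure is comparable to Lebesgue measure. *)
Lemma riemannian_measure_bounds : exists C : R, 0 < C /\
  forall (S : set (borel 'rV[R]_n)) (B : set (borel M)), measurable S -> measurable B ->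
    S `<=` box y0 r -> B `<=` chart_inv i @` S ->
    (mu B <= C%:E * nu (inv0 @^-1` B `&` S))%E /\
    (C^-1%:E * nu (inv0 @^-1` B `&` S) <= mu B)%E.
Proof.
have [C [C0 HC1 HC2]] := vol_bounds g r_gt0 box_cod.
exists C; split => // S B mS mB Sb BD.
have Sc : S `<=` chart_cod i by move=> y /Sb /box_cod.
have Bd : B `<=` chart_dom i by move=> x /BD[y /Sc cy <-]; exact: dom_inv.
rewrite (mu_g mB Bd).
have phiE := image_chart_inv0 Sc BD.
have mphi := measurable_image_chart mB Bd.
rewrite -phiE.
have H (k : R) : 0 <= k ->
    integral_rV (fun y => (k * \1_(chart_map i @` B) y)%:E) = (k%:E * nu (chart_map i @` B))%E.
  move=> k0; rewrite nuP; last 2 first.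
  - by apply/measurable_EFinP; apply: measurable_funM; [exact: measurable_cst|exact: measurable_indic].
  - by move=> y; rewrite lee_fin mulr_ge0.
  under eq_integral => y _ do rewrite EFinM.
  have mI : measurable_fun setT (fun y : borel 'rV[R]_n => (\1_(chart_map i @` B) y : R)%:E).
    by apply/measurable_EFinP; exact: measurable_indic.
  by rewrite (ge0_integralZl _ _ mI) // integral_indic // setIT.
split; rewrite -H ?invr_ge0 ?(ltW C0) //; apply: integral_rV_le => y.
- by rewrite lee_fin mulr_ge0 // sqrtr_ge0.
- rewrite lee_fin indicE; case: (boolP (y \in _)) => [|_]; last by rewrite mulr0 mul0r.
  rewrite inE mulr1 mul1r phiE => -[_ /Sb]; exact: HC1.
- by rewrite lee_fin mulr_ge0 // invr_ge0 ltW.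
- rewrite lee_fin indicE; case: (boolP (y \in _)) => [|_]; last by rewrite mulr0 mul0r.
  rewrite inE mulr1 mul1r phiE => -[_ /Sb]; exact: HC2.
Qed.

Lemma chart_integral_bounds : exists C : R, 0 < C /\
  forall (S : set (borel 'rV[R]_n)) (f : borel M -> \bar R), measurable S ->
    S `<=` box y0 r -> measurable_fun setT f -> (forall x, 0 <= f x)%E ->
    (\int[mu]_(x in chart_inv i @` S) f x <= C%:E * \int[nu]_(y in S) f (chart_inv i y))%E /\
    (\int[nu]_(y in S) f (chart_inv i y) <= C%:E * \int[mu]_(x in chart_inv i @` S) f x)%E.
Proof.
have [C [C0 HC]] := riemannian_measure_bounds.
exists C; split => // S f mS Sb mf f0.
have Sc : S `<=` chart_cod i by move=> y /Sb /box_cod.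
have mD := measurable_image_inv mS Sc.
have SD : S `<=` inv0 @^-1` (chart_inv i @` S).
  by move=> y Sy; rewrite /= inv0E; [exists y|exact: Sc].
have E : (\int[nu]_(y in S) f (chart_inv i y) = \int[nu]_(y in S) f (inv0 y))%E.
  by apply: eq_integral => y; rewrite inE => /Sc cy; rewrite inv0E.
have C1 : 0 <= C^-1 by rewrite invr_ge0 ltW.
rewrite E; split.
  apply: (integral_transport_le (k := NngNum (ltW C0)) measurable_inv0) => // B mB BD.
  exact: (HC S B mS mB Sb BD).1.
have H := integral_transport_ge (m1 := mu) (m2 := nu) (k := NngNum C1) measurable_inv0 mD mS SD mf f0 _.
have {}H : (C^-1%:E * \int[nu]_(y in S) f (inv0 y) <= \int[mu]_(x in chart_inv i @` S) f x)%E.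
  by apply: H => B mB BD; exact: (HC S B mS mB Sb BD).2.
rewrite -[leLHS]mul1e -(@mulfV _ C) ?gt_eqF // EFinM -muleA.
by apply: lee_wpmul2l => //; rewrite lee_fin ltW.
Qed.

End chart_measure.

(** * Cells and variance *)

Section variance.
Context d (T : measurableType d) (R : realType) (mu : {measure set T -> \bar R}).

Lemma bounded_integrable (q : set T) (f : T -> R) (B : R) : measurable q ->
  (mu q < +oo)%E -> measurable_fun q f -> (forall x, q x -> `|f x| <= B) ->
  mu.-integrable q (EFin \o f).
Proof.
move=> mq qoo mf fB; apply: measurable_bounded_integrable => //.
exists B; split; first exact: num_real.
by move=> y By x qx; apply: le_trans (fB x qx) (ltW By).
Qed.

(** The mean value is the best constant: the defect in the inequality is the square of
    the difference between [c] and the mean, times the measure. *)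
Lemma sqr_integral_le (q : set T) (f : T -> R) (c B m : R) : measurable q ->
  mu q = m%:E -> 0 < m -> measurable_fun q f -> (forall x, q x -> `|f x| <= B) ->
  (\int[mu]_(x in q) ((f x) ^+ 2)%:E <=
   ((\int[mu]_(x in q) f x)%R ^+ 2 / m)%:E + \int[mu]_(x in q) ((f x - c) ^+ 2)%:E)%E.
Proof.
move=> mq qm m0 mf fB.
have qoo : (mu q < +oo)%E by rewrite qm ltry.
have If : mu.-integrable q (EFin \o f) by exact: bounded_integrable fB.
have If2 : mu.-integrable q (EFin \o (fun x => f x ^+ 2)).
  apply: (@bounded_integrable _ _ (B ^+ 2)) => //; first exact: measurable_funX.
  move=> x qx; rewrite normrX; apply: lerXn2r; rewrite ?nnegrE //; last exact: fB.
  exact: le_trans (fB x qx).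
have Ic (k : R) : mu.-integrable q (EFin \o (fun=> k)).
  by apply: (@bounded_integrable _ _ `|k|) => //; exact: measurable_cst.
have Icf : mu.-integrable q (EFin \o (fun x => 2 * c * f x)).
  apply: (@bounded_integrable _ _ (`|2 * c| * B)) => //.
    by apply: measurable_funM => //; exact: measurable_cst.
  by move=> x qx; rewrite normrM ler_wpM2l // fB.
have Id : mu.-integrable q (EFin \o (fun x => (f x - c) ^+ 2)).
  apply: (@bounded_integrable _ _ ((B + `|c|) ^+ 2)) => //.
    by apply: measurable_funX; apply: measurable_funB => //; exact: measurable_cst.
  move=> x qx; rewrite normrX.
  have H : `|f x - c| <= B + `|c| by rewrite (le_trans (ler_normB _ _)) // lerD2r fB.
  by apply: lerXn2r; rewrite ?nnegrE // (le_trans _ H).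
rewrite -(fineK (integrable_fin_num mq If2)) -(fineK (integrable_fin_num mq Id)).
rewrite -EFinD lee_fin -!/(Rintegral _ _ _).
have -> : \int[mu]_(x in q) (f x - c) ^+ 2 =
    \int[mu]_(x in q) (f x ^+ 2) - 2 * c * \int[mu]_(x in q) f x + c ^+ 2 * m.
  transitivity (\int[mu]_(x in q) (f x ^+ 2 - 2 * c * f x + c ^+ 2)).
    by apply: eq_Rintegral => x _; ring.
  rewrite RintegralD //; last first.
    exact: (integrableB mq If2 Icf).
  by rewrite RintegralB // RintegralZl // Rintegral_cst // qm.
set F1 := Rintegral mu q f; set F2 := Rintegral mu q _.
rewrite -subr_ge0 (_ : _ - _ = (F1 - c * m) ^+ 2 / m).
  by rewrite divr_ge0 ?sqr_ge0 // ltW.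
by field; rewrite gt_eqF.
Qed.

End variance.

Section cells.
Context {R : realType} {n : nat} (y0 : 'rV[R]_n) (r : R).
Hypothesis r_gt0 : 0 < r.
Variable kappa : nat.
Hypothesis kappa_gt0 : (0 < kappa)%N.

Definition side : R := 2 * r / kappa%:R.

Lemma side_gt0 : 0 < side.
Proof. by rewrite divr_gt0 ?mulr_gt0 // ltr0n. Qed.

Definition corner (m : {ffun 'I_n -> 'I_kappa}) : 'rV[R]_n :=
  \row_b (y0 0 b - r + side * (m b)%:R).

(** Half-open cells, so that they are disjoint and still cover the open box. *)
Definition grid (m : {ffun 'I_n -> 'I_kappa}) : set 'rV[R]_n := cell (corner m) side.

Lemma grid_box m : grid m `<=` box y0 r.
Proof.
move=> y H b; have := H b; rewrite mxE => /andP[h1 h2].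
have k0 : (0 : R) < kappa%:R by rewrite ltr0n.
have mb : (m b)%:R + 1 <= kappa%:R :> R by rewrite natr1 ler_nat.
have s0 : 0 <= side * (m b)%:R by rewrite mulr_ge0 // ltW // side_gt0.
have s1 : side * (m b)%:R + side <= 2 * r.
  have -> : 2 * r = side * kappa%:R by rewrite /side divfK // gt_eqF.
  by rewrite -[X in _ + X]mulr1 -mulrDr ler_wpM2l // ltW // side_gt0.
rewrite ler_norml; apply/andP; split; lra.
Qed.

Lemma grid_trivIset : trivIset setT grid.
Proof.
apply/trivIsetP => m m' _ _ mm'; apply/seteqP; split => // y [H H'].
case/eqP: mm'; apply/ffunP => b; apply: val_inj.
have := H b; have := H' b; rewrite !mxE => /andP[h1 h2] /andP[h3 h4].
have s0 := side_gt0.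
have E (p q : 'I_kappa) : side * p%:R < side * q%:R + side -> (p <= q)%N.
  by rewrite -[X in _ < _ + X]mulr1 -mulrDr ltr_pM2l // natr1 ltr_nat ltnS.
by apply/eqP; rewrite eqn_leq !E //; lra.
Qed.

Lemma grid_cover (y : 'rV[R]_n) : (forall b, `|y 0 b - y0 0 b| < r) -> exists m, grid m y.
Proof.
move=> H; have s0 := side_gt0.
pose t b := (y 0 b - y0 0 b + r) / side.
have t0 b : 0 <= t b.
  by rewrite divr_ge0 ?(ltW s0) //; have := H b; rewrite ltr_norml => /andP[]; lra.
have tk b : (Num.truncn (t b) < kappa)%N.
  have /andP[h1 h2] := truncn_itv (t0 b).
  rewrite -(ltr_nat R); apply: le_lt_trans h1 _.
  rewrite ltr_pdivrMr // mulrC /side divfK ?gt_eqF ?ltr0n //.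
  by have := H b; rewrite ltr_norml => /andP[]; lra.
exists [ffun b => Ordinal (tk b)] => b; rewrite !mxE ffunE /=.
have /andP[h1 h2] := truncn_itv (t0 b).
have tE : y 0 b - y0 0 b + r = side * t b by rewrite /t mulrC divfK ?gt_eqF.
have g1 : side * (Num.truncn (t b))%:R <= side * t b by rewrite ler_pM2l.
have g2 : side * t b < side * (Num.truncn (t b))%:R + side.
  by rewrite -[X in _ < _ + X]mulr1 -mulrDr ltr_pM2l // natr1.
apply/andP; split; lra.
Qed.

End cells.

(** * Local data around a point *)

(** Everything the spectral argument needs to know about the geometry near a point.
    The constant [C] does not depend on [j] or [kappa], and the cells [q] depend on
    [kappa] only.  The error [e] in the Poincare inequality is inherited from
    [poincare_cell]; all functions are real, complex ones being treated through their
    real and imaginary parts. *)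
Record localizer (R : realType) (n : nat) (M : ptopologicalType) (A : smooth_atlas R n M)
    (g : riemannian_metric A) (mu : {measure set (borel M) -> \bar R})
    (chi : nat -> M -> R) (K : set M) (C : R) : Prop := Localizer {
  loc_smooth : forall j k, csmooth (A := A) k (chi j);
  loc_ge0 : forall j x, 0 <= chi j x;
  loc_le1 : forall j x, chi j x <= 1;
  loc_mono : forall j x, chi j x <= chi j.+1 x;
  loc_supp : forall j x, chi j x != 0 -> K x;
  loc_compact : compact K;
  loc_closed : closed K;
  loc_finite : (mu K < +oo)%E;
  loc_const_gt0 : 0 < C;
  loc_grad : forall j x, rgrad g (chi j) (chi j) x <= C * 16 ^+ j * chi j.+1 x ^+ 2;
  loc_poincare : forall kappa : nat, (0 < kappa)%N ->
    exists q : {ffun 'I_n -> 'I_kappa} -> set (borel M),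
    [/\ forall m, measurable (q m), forall m, (0 < mu (q m) < +oo)%E &
      forall j a e, csmooth (A := A) 1 a -> 0 < e ->
      (\int[mu]_x ((chi j x * a x) ^+ 2)%:E <=
        \sum_m ((\int[mu]_(x in q m) (chi j x * a x))%R ^+ 2 / fine (mu (q m)))%:E
        + (C / kappa%:R ^+ 2)%:E *
          \int[mu]_x (rgrad g (chi j \* a) (chi j \* a) x)%:E + e%:E)%E]
}.

Section localizer_construction.
Context {R : realType} {n : nat} {M : ptopologicalType}.
Hypothesis hausdorffM : hausdorff_space M.
Context {A : smooth_atlas R n M} (g : riemannian_metric A).
Variable mu : {measure set (borel M) -> \bar R}.
Hypothesis mu_g : riemannian_measure g mu.
Variables (i : chart A) (y0 : 'rV[R]_n) (r : R).
Hypothesis r_gt0 : 0 < r.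
Hypothesis box_cod : box y0 r `<=` chart_cod i.

Let K : set M := boxM i y0 r.
Let KP := boxMP box_cod.

Definition chi (j : nat) : M -> R := (bump y0 r j \o chart_map i) \_ (chart_dom i).

Lemma chi_dom j x : chart_dom i x -> chi j x = bump y0 r j (chart_map i x).
Proof. by move=> dx; rewrite /chi /patch mem_set. Qed.

Lemma chi_ndom j x : ~ chart_dom i x -> chi j x = 0.
Proof. by move=> dx; rewrite /chi /patch memNset. Qed.

Lemma chi_ge0 j x : 0 <= chi j x.
Proof.
have [dx|dx] := pselect (chart_dom i x); last by rewrite chi_ndom.
by rewrite chi_dom // bump_ge0.
Qed.

Lemma chi_le1 j x : chi j x <= 1.
Proof.
have [dx|dx] := pselect (chart_dom i x); last by rewrite chi_ndom.
by rewrite chi_dom // bump_le1.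
Qed.

Lemma chi_mono j x : chi j x <= chi j.+1 x.
Proof.
have [dx|dx] := pselect (chart_dom i x); last by rewrite !chi_ndom.
by rewrite !chi_dom // bump_le.
Qed.

Lemma chi_neq0 j x : chi j x != 0 ->
  chart_dom i x /\ forall b, `|chart_map i x 0 b - y0 0 b| < r.
Proof.
have [dx|dx] := pselect (chart_dom i x); last by rewrite chi_ndom ?eqxx.
by rewrite chi_dom // => /(bump_supp r_gt0); split.
Qed.

Lemma chi_supp j x : chi j x != 0 -> K x.
Proof. by move=> /chi_neq0[dx H]; apply/KP; split => // b; exact: ltW. Qed.

Lemma chi_out j x : ~ K x -> chi j x = 0.
Proof. by move=> nK; apply/eqP; apply: contrapT => /negP /chi_supp. Qed.

Let closedK : closed K := closed_boxM hausdorffM box_cod.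

(** Every point lies in the domain of the chart [i], where [chi j] is a bump read in
    the chart, or in the complement of [K], where it is zero; that complement is open
    since a compact set is closed in a Hausdorff space. *)
Lemma csmooth_chi j k : csmooth (A := A) k (chi j).
Proof.
move=> i'; apply: class_C_local => y cy.
have [dx|ndx] := pselect (chart_dom i (chart_inv i' y)).
  pose V := chart_map i' @` (chart_dom i' `&` chart_dom i).
  have oV : open V by apply: open_chart_image; exact: open_chart_dom.
  exists V; first by rewrite /V chart_image; split.
  have Cb : class_C k V (bump y0 r j \o (fun z => chart_map i (chart_inv i' z))).
    apply: (class_C_comp oV openT) => // [b|]; first exact: class_C_transition.
    exact: class_C_bump.
  apply: (class_C_eq oV _ Cb) => z; rewrite /V chart_image => -[cz dz].
  by rewrite /= chi_dom.
pose V := chart_map i' @` (chart_dom i' `&` ~` K).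
have oV : open V by apply: open_chart_image; exact: closed_openC.
exists V.
  by rewrite /V chart_image; split => // /KP[].
apply: (class_C_eq oV _ (class_C_cst k V 0)) => z; rewrite /V chart_image => -[cz nz].
by rewrite /= chi_out.
Qed.

Lemma chi_grad : exists2 C, 0 < C & forall j x,
  rgrad g (chi j) (chi j) x <= C * 16 ^+ j * chi j.+1 x ^+ 2.
Proof.
have [C [C0 HC _]] := cotangent_bounds g r_gt0 box_cod.
exists (C * (n%:R * (64 * r) ^+ 2 + 1)).
  by rewrite mulr_gt0 // ltr_wpDl // mulr_ge0 // sqr_ge0.
move=> j x.
have RHS0 : 0 <= C * (n%:R * (64 * r) ^+ 2 + 1) * 16 ^+ j * chi j.+1 x ^+ 2.
  apply: mulr_ge0; last exact: sqr_ge0.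
  apply: mulr_ge0; last exact: exprn_ge0.
  by apply: mulr_ge0; [exact: ltW|rewrite addr_ge0 // mulr_ge0 // sqr_ge0].
have [/KP[dx Bx]|nK] := pselect (K x).
  rewrite (rgradE _ (csmooth_chi j 1) (csmooth_chi j 1) dx) /gdot.
  apply: le_trans (HC _ _ Bx) _.
  rewrite -!mulrA ler_pM2l //.
  have E a : dchart i (chi j) (chart_map i x) 0 a = partial a (bump y0 r j) (chart_map i x).
    rewrite mxE; apply: near_partial.
    apply: near_open_eq (open_cod i) _ (cod_map dx) => z cz /=.
    by rewrite chi_dom ?chart_invK //; exact: dom_inv.
  rewrite /sqnorm; under eq_bigr do rewrite E.
  apply: (@le_trans _ _ (\sum_(a < n) (64 * r) ^+ 2 * 16 ^+ j * bump y0 r j.+1 (chart_map i x) ^+ 2)).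
    by apply: ler_sum => a _; exact: partial_bump_le.
  rewrite sumr_const card_ord -[leLHS]mulr_natl chi_dom //.
  set X := (64 * r) ^+ 2; rewrite -(mulrA X); set Y := 16 ^+ j * _.
  have Y0 : 0 <= Y by apply: mulr_ge0; [exact: exprn_ge0|exact: sqr_ge0].
  by rewrite mulrA ler_wpM2r // lerDl.
rewrite rgrad_near0 //.
have := open_nbhs_nbhs (conj (closed_openC closedK) nK).
by apply: filterS => z nz; rewrite chi_out.
Qed.

Section poincare.
Variables (j : nat) (a : M -> R).
Hypothesis Ca : csmooth (A := A) 1 a.

(** The localized function read in the chart and extended by zero to the whole of
    R^n, where [poincare_cell] applies. *)
Definition chart_ext (y : 'rV[R]_n) : R := bump y0 r j y * a (chart_inv i y).

Lemma chart_extE y : chart_cod i y -> chart_ext y = (chi j \* a) (chart_inv i y).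
Proof.
by move=> cy; rewrite /chart_ext /= chi_dom ?chart_invK //; exact: dom_inv.
Qed.

Lemma class_C_chart_ext : class_C 1 setT chart_ext.
Proof.
apply: class_C_local => y _; have [cy|ncy] := pselect (chart_cod i y).
  exists (chart_cod i) => //.
  apply: (class_CM (open_cod i) _ (Ca i)).
  by apply: class_C_subset (class_C_bump _ _ _ _).
exists (~` box y0 r); first by move=> /box_cod.
have oB : open (~` box y0 r).
  apply: closed_openC.
  have := @compact_closed _ (box y0 r) (@norm_hausdorff R 'rV[R]_n).
  apply; exact: compact_box.
apply: (class_C_eq oB _ (class_C_cst 1 _ 0)) => z nz.
rewrite /chart_ext; have [->|H] := eqVneq (bump y0 r j z) 0; first by rewrite mul0r.
by case: nz => b; apply: ltW; exact: bump_supp H b.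
Qed.

Lemma csmooth_chiM : csmooth (A := A) 1 (chi j \* a).
Proof. exact: csmoothM (csmooth_chi j 1) Ca. Qed.

Lemma grad2_chart_ext C : (forall y p, box y0 r y -> sqnorm p <= C * cotangent g i y p p) ->
  forall y, box y0 r y ->
  grad2 chart_ext y <= C * rgrad g (chi j \* a) (chi j \* a) (chart_inv i y).
Proof.
move=> HC y By; have cy := box_cod By.
have dy := dom_inv cy.
rewrite (rgradE _ csmooth_chiM csmooth_chiM dy) chart_invK //.
apply: le_trans (HC _ _ By).
rewrite le_eqVlt; apply/orP; left; apply/eqP; apply: eq_bigr => b _.
congr (_ ^+ 2); rewrite mxE; apply: near_partial.
by apply: near_open_eq (open_cod i) _ cy => z cz; rewrite chart_extE.
Qed.


Lemma bounded_on_boxM (f : M -> R) : continuous f -> exists B, forall x, K x -> `|f x| <= B.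
Proof.
move=> cf; have cn : continuous (fun x => `|f x|).
  by move=> x; apply: (@continuous_comp _ _ _ f Num.norm); [exact: cf|exact: norm_continuous].
have [|||c _ H] := @compact_EVT_max _ R (fun x => `|f x|) K.
- by exists (chart_inv i y0); exists y0 => //; exact: box_center.
- exact: compact_boxM.
- exact: continuous_subspaceT.
by exists `|f c| => x Kx; apply: H; rewrite inE.
Qed.

End poincare.

(** [poincare_cell] on every cell of the grid, transferred to the manifold by
    [chart_integral_bounds], with the constant replaced by the mean value by
    [sqr_integral_le]. *)
Lemma chi_poincare : exists2 C : R, 0 < C & (mu K < +oo)%E /\ forall kappa : nat, (0 < kappa)%N ->
    exists q : {ffun 'I_n -> 'I_kappa} -> set (borel M),
    [/\ forall m, measurable (q m), forall m, (0 < mu (q m) < +oo)%E &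
      forall j a e, csmooth (A := A) 1 a -> 0 < e ->
      (\int[mu]_x ((chi j x * a x) ^+ 2)%:E <=
        \sum_m ((\int[mu]_(x in q m) (chi j x * a x))%R ^+ 2 / fine (mu (q m)))%:E
        + (C / kappa%:R ^+ 2)%:E *
          \int[mu]_x (rgrad g (chi j \* a) (chi j \* a) x)%:E + e%:E)%E].
Proof.
have [nu nuP] := @integral_rV_measure R n.
have [C1 [C10 HC1]] := chart_integral_bounds mu_g r_gt0 box_cod nuP.
have [C2 [C20 _ HC2]] := cotangent_bounds g r_gt0 box_cod.
have mbox : measurable (box y0 r : set (borel 'rV[R]_n)).
  apply: borel_closed; have := @compact_closed _ (box y0 r) (@norm_hausdorff R 'rV[R]_n).
  by apply; exact: compact_box.
have boxfin : (nu (box y0 r) < +oo)%E.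
  (* A half-open cell containing the closed box must have a side larger than [2 * r]. *)
  have r3 : 0 < 3 * r by rewrite mulr_gt0.
  have c3 := lebesgue_rV_cell (\row_b (y0 0 b - r)) nuP r3.
  apply: (@le_lt_trans _ _ (nu (cell (\row_b (y0 0 b - r)) (3 * r)))); last by rewrite c3 ltry.
  apply: le_measure; rewrite ?inE //; first exact: measurable_cell.
  move=> y By b; rewrite mxE; have := By b; rewrite ler_norml => /andP[h1 h2].
  apply/andP; split; move: r_gt0; lra.
have muS (S : set (borel 'rV[R]_n)) : measurable S -> S `<=` box y0 r ->
    (mu (chart_inv i @` S) <= C1%:E * nu S /\ nu S <= C1%:E * mu (chart_inv i @` S))%E.
  move=> mS Sb.
  have := HC1 S (cst 1%E) mS Sb (measurable_cst _) (fun=> lee01).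
  have mD : measurable (chart_inv i @` S : set (borel M)).
    by apply: measurable_image_inv => // y /Sb; exact: box_cod.
  by rewrite !integral_cst // !mul1e.
(* [C1] for passing to Lebesgue measure and back, [C2] for the norm of covectors, the
   rest from [poincare_cell] on cells of side [2 * r / kappa]. *)
pose C := C1 * C1 * C2 * 2 ^+ n * (2 * r) ^+ 2.
have C0 : 0 < C by rewrite !mulr_gt0 // exprn_gt0 // mulr_gt0.
exists C => //; split.
  apply: le_lt_trans (muS _ mbox (fun _ => id)).1 _.
  by rewrite lte_mul_pinfty // lee_fin ltW.
move=> kappa kappa0; have h0 := side_gt0 r_gt0 kappa0; set h := side r kappa in h0.
pose S (m : {ffun 'I_n -> 'I_kappa}) : set (borel 'rV[R]_n) := grid y0 r m.
have mS m : measurable (S m) by exact: measurable_cell.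
have Sb m : S m `<=` box y0 r by exact: grid_box.
pose q (m : {ffun 'I_n -> 'I_kappa}) : set (borel M) := chart_inv i @` S m.
have mq m : measurable (q m).
  by apply: measurable_image_inv => // y /Sb; exact: box_cod.
have nuS m : nu (S m) = (h ^+ n)%:E by exact: lebesgue_rV_cell.
have hn0 : 0 < h ^+ n by rewrite exprn_gt0.
have muq m : (0 < mu (q m) < +oo)%E.
  have [h1 h2] := muS _ (mS m) (Sb m); apply/andP; split.
    rewrite lt0e measure_ge0 andbT; apply/negP => /eqP H.
    by move: h2; rewrite nuS -/(q m) H mule0 leNgt lte_fin hn0.
  by apply: le_lt_trans h1 _; rewrite nuS -EFinM ltry.
exists q; split => // j a e Ca e0.
pose f : M -> R := chi j \* a.
have Cf : csmooth (A := A) 1 f by exact: csmooth_chiM.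
have cf : continuous f by exact: csmooth_continuous Cf.
have mf : measurable_fun [set: borel M] (f : borel M -> R) by exact: borel_real.
have [B HB] := bounded_on_boxM cf.
have qK m : q m `<=` K by move=> _ [y Sy <-]; exists y => //; exact: Sb Sy.
pose G x := (rgrad g f f x)%:E.
have mG : measurable_fun [set: borel M] G.
  by apply/measurable_EFinP; apply: borel_real; exact: rgrad_continuous.
have G0 x : (0 <= G x)%E by rewrite lee_fin rgrad_ge0.
pose e' := e / (C1 * (#|{ffun 'I_n -> 'I_kappa}|%:R + 1)).
have N0 : 0 < #|{ffun 'I_n -> 'I_kappa}|%:R + 1 :> R by rewrite ltr_wpDl.
have e'0 : 0 < e' by rewrite divr_gt0 // mulr_gt0.
have percell m : (\int[mu]_(x in q m) ((f x) ^+ 2)%:E <=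
    ((\int[mu]_(x in q m) f x)%R ^+ 2 / fine (mu (q m)))%:E +
    ((C / kappa%:R ^+ 2)%:E * \int[mu]_(x in q m) G x + (C1 * e')%:E))%E.
  have [c Hc] := poincare_cell (corner y0 r m) nuP (class_C_chart_ext j Ca) h0 e'0.
  have /andP[mq0 mqoo] := muq m.
  have mqE : mu (q m) = (fine (mu (q m)))%:E by rewrite fineK // ge0_fin_numE.
  have fq0 : 0 < fine (mu (q m)) by rewrite -lte_fin -mqE.
  have V := @sqr_integral_le _ _ R mu (q m) f c B (fine (mu (q m))) (mq m) mqE fq0 _ _.
  apply: le_trans (V _ _) _; first exact: measurable_funTS.
    by move=> x /qK; exact: HB.
  rewrite leeD2l //.
  have mfc : measurable_fun [set: borel M] (fun x : borel M => ((f x - c) ^+ 2)%:E).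
    apply/measurable_EFinP; apply: measurable_funX.
    by apply: measurable_funB; [exact: mf|exact: measurable_cst].
  have fc0 x : (0 <= ((f x - c) ^+ 2)%:E)%E by rewrite lee_fin sqr_ge0.
  apply: le_trans (HC1 (S m) _ (mS m) (Sb m) mfc fc0).1 _.
  have -> : (\int[nu]_(y in S m) ((f (chart_inv i y) - c) ^+ 2)%:E =
      \int[nu]_(y in cell (corner y0 r m) h) ((chart_ext j a y - c) ^+ 2)%:E)%E.
    apply: eq_integral => y; rewrite inE => /Sb/box_cod cy.
    by rewrite chart_extE.
  rewrite (EFinM C1 e').
  apply: (@le_trans _ _ (C1%:E * ((2 ^+ n * h ^+ 2)%:E *
      \int[nu]_(y in cell (corner y0 r m) h) (grad2 (chart_ext j a) y)%:E + e'%:E))%E).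
    by apply: lee_wpmul2l => //; rewrite lee_fin ltW.
  rewrite ge0_muleDr; last 2 first.
  - apply: mule_ge0; first by rewrite lee_fin mulr_ge0 ?exprn_ge0 // ltW.
    by apply: integral_ge0 => y _; rewrite lee_fin grad2_ge0.
  - by rewrite lee_fin ltW.
  rewrite leeD2r //.
  apply: (@le_trans _ _ (C1%:E * ((2 ^+ n * h ^+ 2)%:E * (C2%:E *
      \int[nu]_(y in S m) G (chart_inv i y))))%E).
    apply: lee_wpmul2l; first by rewrite lee_fin ltW.
    apply: lee_wpmul2l; first by rewrite lee_fin mulr_ge0 ?exprn_ge0 // ltW.
    have mGi : measurable_fun (S m) (fun y : borel 'rV[R]_n => G (chart_inv i y)).
      apply: (@measurable_funS _ _ _ _ (chart_cod i : set (borel 'rV[R]_n))).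
      - exact: measurable_cod.
      - by move=> y /Sb/box_cod.
      apply/measurable_EFinP; apply: borel_real_on (open_cod i) _ => y cy.
      apply: (@continuous_comp _ _ _ (chart_inv i) (rgrad g f f)); first exact: chart_inv_continuous.
      exact: rgrad_continuous.
    rewrite -(ge0_integralZl _ _ mGi) //; last by rewrite lee_fin ltW.
    apply: ge0_le_integral_set => y Sy; first by rewrite lee_fin grad2_ge0.
    by rewrite -EFinM lee_fin; apply: grad2_chart_ext => //; exact: Sb Sy.
  apply: (@le_trans _ _ (C1%:E * ((2 ^+ n * h ^+ 2)%:E * (C2%:E *
      (C1%:E * \int[mu]_(x in q m) G x))))%E).
    do 3 (apply: lee_wpmul2l; first by rewrite lee_fin ?mulr_ge0 ?exprn_ge0 // ltW).
    exact: (HC1 (S m) _ (mS m) (Sb m) mG G0).2.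
  rewrite !muleA -!EFinM le_eqVlt; apply/orP; left; apply/eqP; congr (_%:E * _)%E.
  rewrite /C /h /side; field; by rewrite pnatr_eq0 -lt0n.
pose U := \big[setU/set0]_(m : {ffun 'I_n -> 'I_kappa}) q m.
have UP x : U x <-> exists m, q m x.
  rewrite /U -bigcup_seq; split => [[m _ qx]|[m qx]]; first by exists m.
  by exists m => //; rewrite /= mem_index_enum.
have disj : trivIset setT q.
  apply/trivIsetP => m m' _ _ mm'; apply/seteqP; split => // x [[y Sy <-] [y' Sy' yy']].
  have /trivIsetP /(_ m m' I I mm') := grid_trivIset (y0 := y0) r_gt0 kappa0.
  suff E : y = y' by move/seteqP => [H _]; case: (H y); split => //; rewrite E.
  have cy := box_cod (Sb _ _ Sy); have cy' := box_cod (Sb _ _ Sy').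
  by rewrite -(chart_invK cy) -yy' chart_invK.
have bigE (F : M -> \bar R) : measurable_fun [set: borel M] (F : borel M -> \bar R) ->
    (forall x, 0 <= F x)%E ->
    (\int[mu]_(x in U) F x = \sum_m \int[mu]_(x in q m) F x)%E.
  move=> mF F0; rewrite /U ge0_integral_bigsetU //.
  - exact: index_enum_uniq.
  - by apply: sub_trivIset disj.
  - exact: measurable_funTS.
have mU : measurable (U : set (borel M)) by apply: bigsetU_measurable.
have mf2 : measurable_fun [set: borel M] (fun x : borel M => ((f x) ^+ 2)%:E).
  by apply/measurable_EFinP; exact: measurable_funX.
have f20 x : (0 <= ((f x) ^+ 2)%:E)%E by rewrite lee_fin sqr_ge0.
have -> : (\int[mu]_x ((f x) ^+ 2)%:E = \int[mu]_(x in U) ((f x) ^+ 2)%:E)%E.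
  rewrite [RHS]integral_mkcond; apply: eq_integral => x _; rewrite /patch.
  case: (boolP (x \in U)) => // /negP; rewrite inE => /UP nU.
  have [H|/chi_neq0[dx /(grid_cover r_gt0 kappa0)[m Hm]]] := eqVneq (chi j x) 0.
    by rewrite /f /= H mul0r expr0n.
  by case: nU; exists m => //; exists (chart_map i x) => //; rewrite chart_mapK.
rewrite bigE //.
apply: (@le_trans _ _ (\sum_m (((\int[mu]_(x in q m) f x)%R ^+ 2 / fine (mu (q m)))%:E +
    ((C / kappa%:R ^+ 2)%:E * \int[mu]_(x in q m) G x + (C1 * e')%:E)))%E).
  by apply: lee_sum => m _; exact: percell.
rewrite big_split /= -addeA leeD2l // big_split /=; apply: leeD.
  rewrite -ge0_sume_distrr; last by move=> m _; exact: integral_ge0.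
  apply: lee_wpmul2l; first by rewrite lee_fin divr_ge0 ?sqr_ge0 // ltW.
  by rewrite -bigE //; apply: ge0_subset_integral.
rewrite sumEFin lee_fin sumr_const -[leLHS]mulr_natl /e'.
rewrite (_ : C1 * _ = e / (#|{ffun 'I_n -> 'I_kappa}|%:R + 1)); last first.
  by field; rewrite !gt_eqF.
by rewrite mulrA ler_pdivrMr // mulrC ler_pM2l // lerDl.
Qed.

End localizer_construction.

Lemma exists_localizer (R : realType) (n : nat) (M : ptopologicalType)
    (hausdorffM : hausdorff_space M) (A : smooth_atlas R n M) (g : riemannian_metric A)
    (mu : {measure set (borel M) -> \bar R}) (mu_g : riemannian_measure g mu) (x0 : M) :
  exists (chi : nat -> M -> R) (K : set M) (C : R),
    localizer g mu chi K C /\ 0 < chi 0%N x0.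
Proof.
pose i := chart_at A x0; have dx : chart_dom i x0 := chart_atP A x0.
pose y0 := chart_map i x0.
have /nbhs_ballP[e /= e0 He] := open_nbhs_nbhs (conj (open_cod i) (cod_map dx)).
pose r := e / 2; have r0 : 0 < r by rewrite divr_gt0.
have bc : box y0 r `<=` chart_cod i.
  move=> y By; apply: He; rewrite -ball_normE /=.
  apply: (@le_lt_trans _ _ r); last by rewrite ltr_pdivrMr // ltr_pMr // ltr1n.
  by apply: rV_norm_le => [|b]; [exact: ltW|rewrite !mxE distrC; exact: By].
have [C1 C10 H1] := chi_grad hausdorffM g r0 bc.
have [C2 C20 [H2 H3]] := chi_poincare hausdorffM mu_g r0 bc.
exists (chi i y0 r), (boxM i y0 r), (C1 + C2); split; last first.
  by rewrite chi_dom // bump_center.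
split.
- by move=> j k; exact: (csmooth_chi hausdorffM r0 bc).
- exact: chi_ge0.
- exact: chi_le1.
- exact: chi_mono.
- exact: (chi_supp r0 bc).
- exact: compact_boxM bc.
- exact: (closed_boxM hausdorffM bc).
- exact: H2.
- exact: addr_gt0.
- move=> j x; apply: le_trans (H1 j x) _.
  rewrite -!mulrA ler_wpM2r ?lerDl ?(ltW C20) //.
  by apply: mulr_ge0; [exact: exprn_ge0|exact: sqr_ge0].
- move=> kappa k0; have [q [q1 q2 q3]] := H3 kappa k0.
  exists q; split => // j a e' Ca e'0; apply: le_trans (q3 j a e' Ca e'0) _.
  rewrite leeD2r // leeD2l //; apply: lee_wpmul2r.
    by apply: integral_ge0 => x _; rewrite lee_fin rgrad_ge0.
  rewrite lee_fin; apply: ler_wpM2r; first by rewrite invr_ge0 sqr_ge0.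
  by rewrite lerDr ltW.
Qed.

(** * Square-integrable functions and Bessel's inequality *)

Section complex_parts.
Context {R : realType}.
Local Notation C := R[i].
Implicit Types z w : C.

Lemma Re_mul z w : complex.Re (z * w) = complex.Re z * complex.Re w - complex.Im z * complex.Im w.
Proof. by case: z w => [a b] [c d]. Qed.
Lemma Im_mul z w : complex.Im (z * w) = complex.Re z * complex.Im w + complex.Im z * complex.Re w.
Proof. by case: z w => [a b] [c d]. Qed.
Lemma Re_add z w : complex.Re (z + w) = complex.Re z + complex.Re w.
Proof. by case: z w => [a b] [c d]. Qed.
Lemma Im_add z w : complex.Im (z + w) = complex.Im z + complex.Im w.
Proof. by case: z w => [a b] [c d]. Qed.
Lemma Re_opp z : complex.Re (- z) = - complex.Re z. Proof. by case: z. Qed.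
Lemma Im_opp z : complex.Im (- z) = - complex.Im z. Proof. by case: z. Qed.
Lemma Re_conj z : complex.Re (conjc z) = complex.Re z. Proof. by case: z. Qed.
Lemma Im_conj z : complex.Im (conjc z) = - complex.Im z. Proof. by case: z. Qed.
Lemma complex_ext z w : complex.Re z = complex.Re w -> complex.Im z = complex.Im w -> z = w.
Proof. by case: z w => [a b] [c d] /= -> ->. Qed.

Definition complexE := (Re_mul, Im_mul, Re_add, Im_add, Re_opp, Im_opp, Re_conj, Im_conj).

Lemma csq_ge0 z : 0 <= csq z. Proof. by rewrite /csq addr_ge0 ?sqr_ge0. Qed.
Lemma csq_conj z : csq (conjc z) = csq z.
Proof. by rewrite /csq !complexE sqrrN. Qed.
Lemma csqE z : complex.Re (z * conjc z) = csq z.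
Proof. by rewrite /csq !complexE; ring. Qed.
Lemma csq_eq0 z : csq z = 0 -> z = 0.
Proof.
move=> /eqP; rewrite paddr_eq0 ?sqr_ge0 // !sqrf_eq0 => /andP[/eqP a /eqP b].
exact: complex_ext.
Qed.

End complex_parts.

Section real_L2.
Context d (T : measurableType d) (R : realType) (mu : {measure set T -> \bar R}).
Implicit Types a b c : T -> R.

Definition rL2 a : Prop := measurable_fun setT a /\ (\int[mu]_x ((a x) ^+ 2)%:E < +oo)%E.

Lemma sqr_EFin_ge0 a x : (0 <= ((a x) ^+ 2)%:E)%E.
Proof. by rewrite lee_fin sqr_ge0. Qed.

Lemma rL2_le a b (k : R) : measurable_fun setT a -> rL2 b -> 0 <= k ->
  (forall x, a x ^+ 2 <= k * b x ^+ 2) -> rL2 a.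
Proof.
move=> ma [mb bfin] k0 ab; split => //.
apply: (@le_lt_trans _ _ (\int[mu]_x (k%:E * ((b x) ^+ 2)%:E))%E).
  by apply: ge0_le_integral_set => x _; rewrite ?sqr_EFin_ge0 // -EFinM lee_fin.
rewrite ge0_integralZl //; [|exact: measurable_sqr_EFin|by move=> x _; exact: sqr_EFin_ge0].
by rewrite lte_mul_pinfty.
Qed.

Lemma rL2Z (k : R) a : rL2 a -> rL2 (fun x => k * a x).
Proof.
move=> aL; apply: (rL2_le (k := k ^+ 2) _ aL); rewrite ?sqr_ge0 //.
  by apply: measurable_funM; [exact: measurable_cst|exact: aL.1].
by move=> x; rewrite exprMn.
Qed.

Lemma rL2D a b : rL2 a -> rL2 b -> rL2 (fun x => a x + b x).
Proof.
move=> [ma fa] [mb fb]; split; first exact: measurable_funD.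
apply: (@le_lt_trans _ _ (\int[mu]_x (2%:E * ((a x) ^+ 2)%:E + 2%:E * ((b x) ^+ 2)%:E))%E).
  apply: ge0_le_integral_set => x _; first exact: (sqr_EFin_ge0 (fun x => a x + b x)).
  rewrite -!EFinM -EFinD lee_fin -subr_ge0 (_ : _ - _ = (a x - b x) ^+ 2) ?sqr_ge0 //; ring.
have m2 c : measurable_fun setT c -> measurable_fun setT (fun x => 2%:E * ((c x) ^+ 2)%:E)%E.
  by move=> mc; apply: measurable_funeM; exact: measurable_sqr_EFin.
have f2 c : measurable_fun setT c -> (\int[mu]_x ((c x) ^+ 2)%:E < +oo)%E ->
    (\int[mu]_x (2%:E * ((c x) ^+ 2)%:E) < +oo)%E.
  move=> mc fc; rewrite ge0_integralZl //; [|exact: measurable_sqr_EFin|by move=> x _; exact: sqr_EFin_ge0].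
  by rewrite lte_mul_pinfty.
rewrite ge0_integralD //; [|by move=> x _; rewrite mule_ge0 // sqr_EFin_ge0|exact: m2
  |by move=> x _; rewrite mule_ge0 // sqr_EFin_ge0|exact: m2].
by rewrite lte_add_pinfty ?f2.
Qed.

(** By the inequality [`|a * b| <= a ^+ 2 + b ^+ 2]. *)
Lemma rL2_mul_integrable a b : rL2 a -> rL2 b -> mu.-integrable setT (EFin \o (fun x => a x * b x)).
Proof.
move=> [ma fa] [mb fb].
have mab : measurable_fun setT (EFin \o (fun x => a x * b x)).
  by apply/measurable_EFinP; exact: measurable_funM.
apply: (@le_integrable _ _ _ mu setT measurableT _
  (fun x => ((a x) ^+ 2)%:E + ((b x) ^+ 2)%:E)%E mab).
  move=> x _; rewrite /= lee_fin.
  rewrite [leRHS]ger0_norm ?addr_ge0 ?sqr_ge0 // normrM.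
  rewrite -(real_normK (num_real (a x))) -(real_normK (num_real (b x))).
  have := sqr_ge0 (`|a x| - `|b x|); have := mulr_ge0 (normr_ge0 (a x)) (normr_ge0 (b x)).
  rewrite sqrrB; lra.
have I c : measurable_fun setT c -> (\int[mu]_x ((c x) ^+ 2)%:E < +oo)%E ->
    mu.-integrable setT (fun x => ((c x) ^+ 2)%:E).
  move=> mc fc; apply/integrableP; split; first exact: measurable_sqr_EFin.
  rewrite (eq_integral (fun x => ((c x) ^+ 2)%:E)) // => x _.
  by rewrite gee0_abs // sqr_EFin_ge0.
by apply: integrableD => //; exact: I.
Qed.

Definition rip a b : R := (\int[mu]_x (a x * b x))%R.

Lemma ripC a b : rip a b = rip b a.
Proof. by apply: eq_Rintegral => x _; rewrite mulrC. Qed.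

Lemma ripDl a b c : rL2 a -> rL2 b -> rL2 c -> rip (fun x => a x + b x) c = rip a c + rip b c.
Proof.
move=> aL bL cL; rewrite /rip -RintegralD //; last 2 first.
- exact: rL2_mul_integrable.
- exact: rL2_mul_integrable.
by apply: eq_Rintegral => x _; rewrite mulrDl.
Qed.

Lemma ripZl k a c : rL2 a -> rL2 c -> rip (fun x => k * a x) c = k * rip a c.
Proof.
move=> aL cL; rewrite /rip -RintegralZl //; last exact: rL2_mul_integrable.
by apply: eq_Rintegral => x _; rewrite mulrA.
Qed.

Lemma rip_sqr a : rL2 a -> (rip a a)%:E = (\int[mu]_x ((a x) ^+ 2)%:E)%E.
Proof.
move=> [ma fa]; rewrite /rip /Rintegral.
have -> : (\int[mu]_x (a x * a x)%:E = \int[mu]_x ((a x) ^+ 2)%:E)%E.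
  by apply: eq_integral => x _; rewrite expr2.
by rewrite fineK // ge0_fin_numE // integral_ge0 // => x _; exact: sqr_EFin_ge0.
Qed.

(** The discriminant of the nonnegative quadratic polynomial [key]; when the leading
    coefficient vanishes, so does the linear one, as an affine function bounded below
    is constant. *)
Lemma sqr_rip_le a b : rL2 a -> rL2 b -> rip a b ^+ 2 <= rip a a * rip b b.
Proof.
move=> aL bL.
have pos c : rL2 c -> 0 <= rip c c.
  by move=> cL; rewrite -lee_fin rip_sqr // integral_ge0 // => x _; exact: sqr_EFin_ge0.
have key (t : R) : 0 <= rip a a + 2 * t * rip a b + t ^+ 2 * rip b b.
  have L : rL2 (fun x => a x + t * b x) by apply: rL2D => //; exact: rL2Z.
  have := pos _ L.
  rewrite ripDl //; last exact: rL2Z.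
  rewrite ripZl // (ripC a) (ripC b) !ripDl ?ripZl //; try exact: rL2Z.
  by rewrite (ripC b a) -subr_ge0 => H; rewrite -subr_ge0; move: H; congr (0 <= _); ring.
have [b0|bn0] := eqVneq (rip b b) 0.
  rewrite b0 mulr0; have [->|ab0] := eqVneq (rip a b) 0; first by rewrite expr0n.
  have := key (- (rip a a + 1) / (2 * rip a b)); rewrite b0 mulr0 addr0.
  rewrite (_ : _ + _ = -1); last by field.
  by rewrite ler0N1.
have := key (- rip a b / rip b b).
rewrite (_ : _ + _ = (rip a a * rip b b - rip a b ^+ 2) / rip b b); last by field.
have bp : 0 < rip b b by rewrite lt_neqAle eq_sym bn0 pos.
by rewrite ler_pdivlMr // mul0r subr_ge0.
Qed.

Lemma rip_ge0 a : 0 <= rip a a.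
Proof. by apply: Rintegral_ge0 => x _; rewrite -expr2 sqr_ge0. Qed.

End real_L2.

Section complex_L2.
Context d (T : measurableType d) (R : realType) (mu : {measure set T -> \bar R}).
Implicit Types f h : T -> R[i].

Definition re f : T -> R := fun x => complex.Re (f x).
Definition im f : T -> R := fun x => complex.Im (f x).

Lemma csq_EFin_ge0 f x : (0 <= (csq (f x))%:E)%E.
Proof. by rewrite lee_fin csq_ge0. Qed.

Lemma l2_normsq_split f : measurable_fun setT (re f) -> measurable_fun setT (im f) ->
  l2_normsq mu f = (\int[mu]_x ((re f x) ^+ 2)%:E + \int[mu]_x ((im f x) ^+ 2)%:E)%E.
Proof.
move=> mr mi; rewrite /l2_normsq -ge0_integralD //.
- by move=> x _; exact: sqr_EFin_ge0.
- exact: measurable_sqr_EFin.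
- by move=> x _; exact: sqr_EFin_ge0.
- exact: measurable_sqr_EFin.
Qed.

Lemma in_L2P f : in_L2 mu f <-> rL2 mu (re f) /\ rL2 mu (im f).
Proof.
have I0 (a : T -> R) : (0 <= \int[mu]_x ((a x) ^+ 2)%:E)%E.
  by apply: integral_ge0 => x _; exact: sqr_EFin_ge0.
split => [[mr mi]|[[mr fr] [mi fi]]].
  rewrite l2_normsq_split // => H; split; split => //.
    by apply: le_lt_trans H; rewrite leeDl.
  by apply: le_lt_trans H; rewrite leeDr.
by split => //; rewrite l2_normsq_split // lte_add_pinfty.
Qed.

Lemma in_L2D f h : in_L2 mu f -> in_L2 mu h -> in_L2 mu (fun x => f x + h x).
Proof.
move=> /in_L2P[fr fi] /in_L2P[hr hi]; apply/in_L2P; split.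
  by rewrite (_ : re _ = fun x => re f x + re h x); [exact: rL2D|apply/funext => x; rewrite /re complexE].
by rewrite (_ : im _ = fun x => im f x + im h x); [exact: rL2D|apply/funext => x; rewrite /im complexE].
Qed.

Lemma in_L2Z (c : R[i]) f : in_L2 mu f -> in_L2 mu (fun x => c * f x).
Proof.
move=> /in_L2P[fr fi]; apply/in_L2P; split.
  rewrite (_ : re _ = fun x => complex.Re c * re f x + (- complex.Im c) * im f x).
    by apply: rL2D; exact: rL2Z.
  by apply/funext => x; rewrite /re /im complexE mulNr.
rewrite (_ : im _ = fun x => complex.Re c * im f x + complex.Im c * re f x).
  by apply: rL2D; exact: rL2Z.
by apply/funext => x; rewrite /re /im complexE.
Qed.

Lemma in_L2N f : in_L2 mu f -> in_L2 mu (fun x => - f x).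
Proof.
by move=> /(in_L2Z (-1)); congr in_L2; apply/funext => x; rewrite mulN1r.
Qed.

Lemma in_L2B f h : in_L2 mu f -> in_L2 mu h -> in_L2 mu (fun x => f x - h x).
Proof. by move=> fL hL; apply: in_L2D => //; exact: in_L2N. Qed.

Lemma rL2_0 : rL2 mu (fun=> 0).
Proof.
split; first exact: measurable_cst.
by rewrite integral0_eq // => x _; rewrite expr0n.
Qed.

Lemma in_L2_0 : in_L2 mu (fun=> 0).
Proof. by apply/in_L2P; split; exact: rL2_0. Qed.

Lemma in_L2_sum n (F : 'I_n -> T -> R[i]) : (forall k, in_L2 mu (F k)) ->
  in_L2 mu (fun x => \sum_k F k x).
Proof.
elim: n F => [|n IH] F FL.
  by rewrite (_ : (fun x => _) = fun=> 0); [exact: in_L2_0|apply/funext => x; rewrite big_ord0].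
rewrite (_ : (fun x => _) = fun x => F ord0 x + \sum_k F (lift ord0 k) x).
  by apply: in_L2D => //; apply: IH.
by apply/funext => x; rewrite big_ord_recl.
Qed.

Lemma Re_inner f h : in_L2 mu f -> in_L2 mu h ->
  complex.Re (inner mu f h) = rip mu (re f) (re h) + rip mu (im f) (im h).
Proof.
move=> /in_L2P[fr fi] /in_L2P[hr hi]; rewrite /rip -RintegralD //; last 2 first.
- exact: rL2_mul_integrable.
- exact: rL2_mul_integrable.
by apply: eq_Rintegral => x _; rewrite !complexE /re /im; ring.
Qed.

Lemma Im_inner f h : in_L2 mu f -> in_L2 mu h ->
  complex.Im (inner mu f h) = rip mu (im f) (re h) - rip mu (re f) (im h).
Proof.
move=> /in_L2P[fr fi] /in_L2P[hr hi]; rewrite /rip -RintegralB //; last 2 first.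
- exact: rL2_mul_integrable.
- exact: rL2_mul_integrable.
by apply: eq_Rintegral => x _; rewrite !complexE /re /im; ring.
Qed.

Lemma inner_conj f h : in_L2 mu f -> in_L2 mu h -> inner mu h f = conjc (inner mu f h).
Proof.
move=> fL hL; apply: complex_ext; rewrite !complexE ?Re_inner ?Im_inner //.
  by rewrite (ripC _ (re h)) (ripC _ (im h)).
by rewrite (ripC _ (im h)) (ripC _ (re h)) opprB.
Qed.

Lemma innerDl f f' h : in_L2 mu f -> in_L2 mu f' -> in_L2 mu h ->
  inner mu (fun x => f x + f' x) h = inner mu f h + inner mu f' h.
Proof.
move=> fL fL' hL; have fL2 := in_L2D fL fL'.
have [fr fi] := (in_L2P f).1 fL; have [fr' fi'] := (in_L2P f').1 fL'.
have [hr hi] := (in_L2P h).1 hL.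
have rE : re (fun x => f x + f' x) = fun x => re f x + re f' x.
  by apply/funext => x; rewrite /re complexE.
have iE : im (fun x => f x + f' x) = fun x => im f x + im f' x.
  by apply/funext => x; rewrite /im complexE.
apply: complex_ext; rewrite !complexE ?Re_inner ?Im_inner // rE iE !ripDl //; ring.
Qed.

Lemma innerZl c f h : in_L2 mu f -> in_L2 mu h ->
  inner mu (fun x => c * f x) h = c * inner mu f h.
Proof.
move=> fL hL; have fL2 := in_L2Z c fL.
have [fr fi] := (in_L2P f).1 fL; have [hr hi] := (in_L2P h).1 hL.
have rE : re (fun x => c * f x) = fun x => complex.Re c * re f x + (- complex.Im c) * im f x.
  by apply/funext => x; rewrite /re /im complexE mulNr.
have iE : im (fun x => c * f x) = fun x => complex.Re c * im f x + complex.Im c * re f x.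
  by apply/funext => x; rewrite /re /im complexE.
have Z (k : R) a : rL2 mu a -> rL2 mu (fun x => k * a x) by exact: rL2Z.
apply: complex_ext; rewrite !complexE ?Re_inner ?Im_inner // rE iE !ripDl ?ripZl //;
  try exact: Z; ring.
Qed.

Lemma inner_suml n (c : 'I_n -> R[i]) (F : 'I_n -> T -> R[i]) h :
  (forall k, in_L2 mu (F k)) -> in_L2 mu h ->
  inner mu (fun x => \sum_k c k * F k x) h = \sum_k c k * inner mu (F k) h.
Proof.
move=> FL hL; elim: n c F FL => [|n IH] c F FL.
  rewrite big_ord0 (_ : (fun x => _) = fun x => 0 * 0).
    by rewrite innerZl ?mul0r //; exact: in_L2_0.
  by apply/funext => x; rewrite big_ord0 mul0r.
rewrite big_ord_recl -(IH (fun k => c (lift ord0 k)) (fun k => F (lift ord0 k))) // -innerZl //.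
rewrite -innerDl //; last by apply: in_L2_sum => k; exact: in_L2Z.
  by congr (inner mu _ h); apply/funext => x; rewrite big_ord_recl.
exact: in_L2Z.
Qed.

Lemma l2_normsqE f : in_L2 mu f -> l2_normsq mu f = (complex.Re (inner mu f f))%:E.
Proof.
move=> fL; have [fr fi] := (in_L2P f).1 fL; have [mr mi _] := fL.
by rewrite l2_normsq_split // Re_inner // EFinD !rip_sqr.
Qed.

Lemma l2_normsq_ge0 f : (0 <= l2_normsq mu f)%E.
Proof. by apply: integral_ge0 => x _; exact: csq_EFin_ge0. Qed.

Lemma innerBl f f' h : in_L2 mu f -> in_L2 mu f' -> in_L2 mu h ->
  inner mu (fun x => f x - f' x) h = inner mu f h - inner mu f' h.
Proof.
move=> fL fL' hL; rewrite (_ : (fun x => _) = fun x => f x + (-1) * f' x); last first.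
  by apply/funext => x; rewrite mulN1r.
by rewrite innerDl // ?innerZl ?mulN1r //; exact: in_L2Z.
Qed.

(** The squared norm of the difference between [f] and its projection [S] is
    nonnegative, and it equals the difference of the two sides. *)
Lemma bessel n (F : 'I_n -> T -> R[i]) f :
  (forall k, in_L2 mu (F k)) -> (forall k l, inner mu (F k) (F l) = (k == l)%:R) ->
  in_L2 mu f -> ((\sum_k csq (inner mu f (F k)))%:E <= l2_normsq mu f)%E.
Proof.
move=> FL FO fL; rewrite l2_normsqE // lee_fin.
pose c k := inner mu f (F k).
pose S x := \sum_k c k * F k x.
have SL : in_L2 mu S by apply: in_L2_sum => k; exact: in_L2Z.
have gL : in_L2 mu (fun x => f x - S x) by exact: in_L2B.
have gF k : inner mu (fun x => f x - S x) (F k) = 0.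
  rewrite innerBl // inner_suml // (bigD1 k) //= FO eqxx mulr1 big1 ?addr0 ?subrr //.
  by move=> l lk; rewrite FO (negbTE lk) mulr0.
have gS : inner mu S (fun x => f x - S x) = 0.
  rewrite inner_suml // big1 // => k _.
  by rewrite (inner_conj gL (FL k)) gF conjc0 mulr0.
have gg : complex.Re (inner mu (fun x => f x - S x) (fun x => f x - S x)) =
    complex.Re (inner mu f f) - \sum_k csq (c k).
  rewrite innerBl // gS subr0 (inner_conj gL fL) Re_conj innerBl // complexE Re_opp.
  rewrite inner_suml //; congr (_ - _).
  rewrite (big_morph (@complex.Re R) (@Re_add R) (erefl : complex.Re (0 : R[i]) = 0)).
  apply: eq_bigr => k _; rewrite (inner_conj fL (FL k)); exact: csqE.
have := l2_normsq_ge0 (fun x => f x - S x).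
by rewrite l2_normsqE // gg lee_fin subr_ge0.
Qed.

Lemma l2_normsq0_ae f : in_L2 mu f -> l2_normsq mu f = 0%E -> {ae mu, forall x, f x = 0}.
Proof.
move=> [mr mi _] f0.
have mc : measurable_fun setT (fun x => (csq (f x))%:E).
  apply/measurable_EFinP; apply: measurable_funD; exact: measurable_funX.
have := ae_eq_integral_abs mu measurableT mc.
move=> [+ _]; have -> : (\int[mu]_x `|(csq (f x))%:E| = 0)%E.
  by rewrite -f0; apply: eq_integral => x _; rewrite gee0_abs // csq_EFin_ge0.
move=> /(_ erefl); apply: filterS => x /= /(_ Logic.I) [] H.
exact: csq_eq0.
Qed.

End complex_L2.

(** * Eigenfunctions and the counting function *)

Section grad_dot_parts.
Context {R : realType} {n : nat} {M : ptopologicalType}.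
Context {A : smooth_atlas R n M} (g : riemannian_metric A).
Implicit Types u v : borel M -> R[i].

Lemma Re_sum (I : finType) (F : I -> R[i]) : complex.Re (\sum_k F k) = \sum_k complex.Re (F k).
Proof. exact: (big_morph (@complex.Re R) (@Re_add R) (erefl : complex.Re (0 : R[i]) = 0)). Qed.

Lemma Im_sum (I : finType) (F : I -> R[i]) : complex.Im (\sum_k F k) = \sum_k complex.Im (F k).
Proof. exact: (big_morph (@complex.Im R) (@Im_add R) (erefl : complex.Im (0 : R[i]) = 0)). Qed.

Lemma grad_dotE u v x : let i := chart_at A x in let y := chart_map i x in
  grad_dot g u v x = \sum_a \sum_b differential i u y 0 a * (invmx (gram g i y) a b)%:C
    * conjc (differential i v y 0 b).
Proof.
move=> i y; rewrite /grad_dot mxE exchange_big /=; apply: eq_bigr => b _.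
rewrite !mxE mulr_suml; apply: eq_bigr => a _; by rewrite !mxE.
Qed.

Lemma Re_grad_dot u v x :
  complex.Re (grad_dot g u v x) = rgrad g (re u) (re v) x + rgrad g (im u) (im v) x.
Proof.
rewrite grad_dotE /rgrad /gdot /cotangent !bilinE -big_split /= Re_sum; apply: eq_bigr => a _.
rewrite -big_split /= Re_sum; apply: eq_bigr => b _.
rewrite !mxE !complexE /=; ring.
Qed.

Lemma Im_grad_dot u v x :
  complex.Im (grad_dot g u v x) = rgrad g (im u) (re v) x - rgrad g (re u) (im v) x.
Proof.
rewrite grad_dotE /rgrad /gdot /cotangent !bilinE -sumrB /= Im_sum; apply: eq_bigr => a _.
rewrite -sumrB /= Im_sum; apply: eq_bigr => b _.
rewrite !mxE !complexE /=; ring.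
Qed.

(** For arbitrary [f]: exchanging the positive and negative parts changes the sign of
    a finite integral, and an infinite one becomes 0. *)
Lemma RintegralN_any d (T : measurableType d) (mu : {measure set T -> \bar R}) (f : T -> R) :
  (\int[mu]_x (- f x))%R = - (\int[mu]_x f x)%R.
Proof.
rewrite /Rintegral integralE [in RHS]integralE.
have -> : ((fun x => (- f x)%:E)^\+ = (fun x => (f x)%:E)^\-)%E.
  exact: (funeposN (fun x => (f x)%:E)).
have -> : ((fun x => (- f x)%:E)^\- = (fun x => (f x)%:E)^\+)%E.
  exact: (funenegN (fun x => (f x)%:E)).
have p0 : (0 <= \int[mu]_x ((fun x => (f x)%:E)^\+ x))%E.
  by apply: integral_ge0 => x _; exact: funepos_ge0.
have n0 : (0 <= \int[mu]_x ((fun x => (f x)%:E)^\- x))%E.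
  by apply: integral_ge0 => x _; exact: funeneg_ge0.
move: p0 n0; case: (\int[mu]_x _)%E => [p| |] //; case: (\int[mu]_x _)%E => [q| |] //= _ _;
  rewrite ?oppr0 ?opprB //.
Qed.

Variable mu : {measure set (borel M) -> \bar R}.

Lemma dirichlet_conj u v : dirichlet_form g mu v u = conjc (dirichlet_form g mu u v).
Proof.
apply: complex_ext; rewrite !complexE /=.
  by apply: eq_Rintegral => x _; rewrite !Re_grad_dot (rgradC _ (re v)) (rgradC _ (im v)).
rewrite -RintegralN_any; apply: eq_Rintegral => x _.
by rewrite !Im_grad_dot opprB (rgradC _ (im v)) (rgradC _ (re v)).
Qed.

Local Notation eigen := (eigenfunction (neg_laplace_beltrami g mu)).

Lemma eigen_in_L2 z u : eigen z u -> in_L2 mu u.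
Proof. by move=> [[]]. Qed.

Lemma eigen_weak (s : R) u v : eigen s%:C u -> form_domain g mu v ->
  closed_form g mu u v (s%:C * inner mu u v).
Proof.
move=> eu dv; have uL := eigen_in_L2 eu; have vL := dv.1.
have [_ _ /(_ v dv)] := eu.
rewrite (_ : (fun x => - (s%:C * u x)) = fun x => (- s%:C) * u x); last first.
  by apply/funext => x; rewrite mulNr.
by rewrite innerZl // mulNr opprK.
Qed.

(** The closed form is Hermitian, so its value at [(u, v)] is both [s] times and [t]
    times the inner product. *)
Lemma eigen_orthogonal (s t : R) u v : eigen s%:C u -> eigen t%:C v -> s != t ->
  inner mu u v = 0.
Proof.
move=> eu ev st; have uL := eigen_in_L2 eu; have vL := eigen_in_L2 ev.
have [du _ _] := eu; have [dv _ _] := ev.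
have [_ [u_ ua]] := du; have [_ [v_ va]] := dv.
have [r1 i1] := eigen_weak eu dv ua va.
have [r2 i2] := eigen_weak ev du va ua.
(* The same pair of approximating sequences computes both values of the form. *)
have E : s%:C * inner mu u v = conjc (t%:C * inner mu v u).
  apply: complex_ext; rewrite ?Re_conj ?Im_conj.
    apply: (cvg_unique (@norm_hausdorff _ R^o) r1).
    rewrite (_ : (fun k => complex.Re (dirichlet_form g mu (u_ k) (v_ k))) =
      fun k => complex.Re (dirichlet_form g mu (v_ k) (u_ k))); first exact: r2.
    by apply/funext => k; rewrite dirichlet_conj Re_conj.
  apply: (cvg_unique (@norm_hausdorff _ R^o) i1).
  rewrite (_ : (fun k => complex.Im (dirichlet_form g mu (u_ k) (v_ k))) =
    fun k => - complex.Im (dirichlet_form g mu (v_ k) (u_ k))); first exact: cvgN i2.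
  by apply/funext => k; rewrite dirichlet_conj Im_conj.
have E2 : (s - t)%:C * inner mu u v = 0.
  have -> : (s - t)%:C = s%:C - t%:C by rewrite rmorphB.
  rewrite mulrBl E (inner_conj uL vL); apply/eqP; rewrite subr_eq0; apply/eqP.
  apply: complex_ext; rewrite !complexE /=; ring.
move/eqP: E2; rewrite mulf_eq0 => /orP[|/eqP //].
move=> /eqP/(congr1 (@complex.Re R)) /= /eqP; by rewrite subr_eq0 (negbTE st).
Qed.

Section counting.
Variables (phi : nat -> borel M -> R[i]) (lambda : nat -> R).
Hypothesis phi_basis : orthonormal_basis mu phi.
Hypothesis phi_eigen : forall i, eigen (lambda i)%:C (phi i).

(** Only the finitely many [phi i] whose eigenvalue is [s] contribute to the expansion
    of [u], so the expansion is eventually constant. *)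
Lemma finite_expansion (s : R) (l : nat) u : eigen s%:C u ->
  (forall i, (l <= i)%N -> lambda i != s) ->
  {ae mu, forall x, u x = \sum_(i < l) inner mu u (phi i) * phi i x}.
Proof.
move=> eu ls; have uL := eigen_in_L2 eu.
have [phiL phiO phiC] := phi_basis.
pose S x := \sum_(i < l) inner mu u (phi i) * phi i x.
have SL : in_L2 mu S by apply: in_L2_sum => k; exact: in_L2Z.
have tail k x : (l <= k)%N -> \sum_(i < k) inner mu u (phi i) * phi i x = S x.
  move=> lk; rewrite /S.
  rewrite -!(big_mkord xpredT (fun i => inner mu u (phi i) * phi i x)) (big_cat_nat (leq0n l) lk) //=.
  rewrite [X in _ + X = _](_ : _ = 0) ?addr0 // big_nat big1 // => i /andP[li _].
  by rewrite (eigen_orthogonal eu (phi_eigen i)) ?mul0r // eq_sym ls.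
have /= cv := phiC u uL.
have : l2_normsq mu (fun x => S x - u x) = 0%E.
  apply: (cvg_unique _ _ cv).
    exact: ereal_hausdorff.
  apply: cvg_near_cst; near=> k.
  rewrite /l2_normsq; apply: eq_integral => x _.
  by rewrite /= tail //; near: k; exists l.
move=> /(l2_normsq0_ae (in_L2B SL uL)); apply: filterS => x /= H.
by apply/esym/eqP; rewrite -subr_eq0; apply/eqP.
Unshelve. all: by end_near. Qed.

(** If there were more independent eigenfunctions than indices [i] with eigenvalue
    [s], some nontrivial combination of them would have all coefficients zero in the
    basis, hence vanish almost everywhere. *)
Lemma multiplicity_le (s : R) (l : nat) : (forall i, (l <= i)%N -> lambda i != s) ->
  (multiplicity mu (neg_laplace_beltrami g mu) s%:C <=
   (\sum_(i < l) (lambda i == s)%:R)%:E)%E.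
Proof.
move=> ls; apply: ge_ereal_sup => _ [m [f [ef lf]] <-]; rewrite lee_fin.
pose B := [pred i : 'I_l | lambda i == s].
have -> : \sum_(i < l) (lambda i == s)%:R = #|B|%:R :> R.
  by rewrite -sum1_card natr_sum [RHS]big_mkcond /=; apply: eq_bigr => i _; rewrite inE; case: ifP.
rewrite ler_nat leqNgt; apply/negP => Bm.
pose C : 'M[R[i]]_(m, #|B|) := \matrix_(j, k) inner mu (f j) (phi (@enum_val _ B k : 'I_l)).
have kC : kermx C != 0.
  rewrite -mxrank_eq0 mxrank_ker -lt0n subn_gt0; exact: leq_ltn_trans (rank_leq_col C) Bm.
have [v vC v0] : exists2 v : 'rV_m, (v <= kermx C)%MS & v != 0 by apply/rowV0Pn.
have {}vC : v *m C = 0 by apply/sub_kermxP.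
have H : {ae mu, forall x, \sum_j v 0 j * f j x = 0}.
  have all_ae : {ae mu, forall x, forall j, f j x = \sum_(i < l) inner mu (f j) (phi i) * phi i x}.
    apply: filter_forall => j; exact: finite_expansion (ef j) ls.
  move: all_ae; apply: filterS => x Hx.
  under eq_bigr do rewrite Hx mulr_sumr.
  rewrite exchange_big /= big1 // => i _.
  under eq_bigr do rewrite mulrA.
  rewrite -mulr_suml; have [iB|iB] := boolP (i \in B).
    have := congr1 (fun X : 'rV_ _ => X 0 (enum_rank_in iB i)) vC.
    rewrite !mxE => E0; rewrite [X in X * _](_ : _ = 0) ?mul0r // -[RHS]E0.
    by apply: eq_bigr => j _; rewrite mxE enum_rankK_in.
  rewrite big1 ?mul0r // => j _.
  rewrite (eigen_orthogonal (ef j) (phi_eigen i)) ?mulr0 //.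
  by move: iB; rewrite inE eq_sym.
case/eqP: v0; apply/rowP => j; rewrite mxE; exact: lf H j.
Qed.

(** Each of the first [l] eigenvalues is counted once in the sum of the
    multiplicities, since it equals only one of the values [s]. *)
Lemma counting_function_le (l : nat) (t : R) : (forall i, (l <= i)%N -> t < lambda i) ->
  (counting_function mu (neg_laplace_beltrami g mu) t <= l%:R%:E)%E.
Proof.
move=> lt; apply: ge_ereal_sup => _ [X [finX XS] <-].
rewrite fsbig_finite //=.
apply: (@le_trans _ _ (\sum_(s <- finmap.enum_fset (fset_set X)) (\sum_(i < l) (lambda i == s)%:R)%:E)%E).
  rewrite big_seq [leRHS]big_seq; apply: lee_sum => s; rewrite in_fset_set // inE => /XS /andP[_ st].
  by apply: multiplicity_le => i /lt H; rewrite gt_eqF //; exact: le_lt_trans H.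
rewrite sumEFin lee_fin exchange_big /= -[X in _ <= X%:R](card_ord l) -sumr_const.
rewrite ler_sum // => i _.
rewrite -natr_sum lern1 (_ : (\sum_(s <- _) _)%N = count_mem (lambda i) (finmap.enum_fset (fset_set X))).
  by rewrite count_uniq_mem ?leq_b1 // finmap.fset_uniq.
by rewrite -sum1_count [RHS]big_mkcond /=; apply: eq_bigr => s _; rewrite eq_sym; case: eqP.
Qed.

End counting.
End grad_dot_parts.

(** * Sequences with vanishing Cesaro means *)

Section koopman_von_neumann.
Context {R : realType}.

Lemma nonincreasing_majorant (s : nat -> R) : s @ \oo --> 0 -> (forall l, 0 <= s l) ->
  exists e : nat -> R, [/\ forall l, s l <= e l, forall k l, (k <= l)%N -> e l <= e k
    & e @ \oo --> 0].
Proof.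
move=> s0 sge0; pose S k := [set s l | l in [set l | (k <= l)%N]].
have [M [_ Mub]] : bounded_fun s by apply: cvg_seq_bounded; apply/cvg_ex; exists 0.
have ubS k : ubound (S k) (M + 1).
  move=> _ [l _ <-]; apply: le_trans (ler_norm _) _; apply: Mub => //; by rewrite ltrDl.
have hS k : has_sup (S k) by split; [exists (s k), k => //=|exists (M + 1); exact: ubS].
have le_S k l : (k <= l)%N -> s l <= sup (S k).
  by move=> kl; apply: ub_le_sup; [exact: (hS k).2|exists l].
exists (fun k => sup (S k)); split.
- by move=> l; exact: le_S.
- move=> k l kl; apply: ge_sup; first exact: (hS l).1.
  by move=> _ [j lj <-]; apply: le_S; exact: leq_trans kl lj.
- apply/cvgrPdist_le => eps eps0.
  have /cvgrPdist_le /(_ _ eps0) [N _ HN] := s0.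
  exists N => // k /= Nk; rewrite sub0r normrN ger0_norm.
    apply: ge_sup; first exact: (hS k).1.
    move=> _ [l kl <-]; have := HN l (leq_trans Nk kl); rewrite sub0r normrN; exact/le_trans/ler_norm.
  exact: le_trans (sge0 k) (le_S _ _ (leqnn k)).
Qed.

(** Markov's inequality for the uniform measure on the first [l] indices. *)
Lemma exceptional_count_le (b : nat -> R) (t : R) (l : nat) : (forall k, 0 <= b k) -> 0 <= t ->
  l%:R^-1 * \sum_(k < l) b k <= t ^+ 2 ->
  l%:R^-1 * \sum_(k < l) (t < b k)%R%:R <= t.
Proof.
move=> b0 t0 bt; case: l bt => [|l] bt; first by rewrite big_ord0 mulr0.
have l0 : 0 < l.+1%:R :> R by rewrite ltr0n.
move: bt; rewrite ![_^-1 * _]mulrC !ler_pdivrMr // => bt.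
move: t0; rewrite le_eqVlt => /orP[/eqP t0|tp].
  move: bt; rewrite -t0 expr0n !mul0r /= => bt.
  have Z : \sum_(k < l.+1) b k = 0 by apply/eqP; rewrite eq_le bt sumr_ge0.
  rewrite big1 // => k _; have /(_ k isT) := psumr_eq0P (fun (k : 'I_l.+1) _ => b0 k) Z.
  by move=> ->; rewrite ltxx.
rewrite -(ler_pM2l tp); apply: le_trans (le_trans bt _); last by rewrite expr2 mulrA.
rewrite mulr_sumr; apply: ler_sum => k _.
by case: ltP => [/ltW|]; rewrite ?mulr1 ?mulr0.
Qed.

(** Put [i] in [Sigma] when [b i <= t i], where [t i] is the square root of a
    nonincreasing majorant [e] of the Cesaro means taken at [i.+1].  Then [b] is
    small on [Sigma], and since [t] is nonincreasing, Markov's inequality at level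
    [t l] bounds the proportion of exceptions among the first [l.+1] indices. *)
Lemma density_one_of_cesaro (b : nat -> R) : (forall i, 0 <= b i) ->
  (fun l : nat => l%:R^-1 * \sum_(k < l) b k) @ \oo --> 0 ->
  exists2 Sigma : set nat, has_density Sigma (1 : R) & b @ within Sigma \oo --> 0.
Proof.
move=> b0 s0.
have [|e [se e_mono e0]] := nonincreasing_majorant s0.
  by move=> l; rewrite mulr_ge0 ?invr_ge0 // sumr_ge0.
have ege0 l : 0 <= e l.
  by apply: le_trans (se l); rewrite mulr_ge0 ?invr_ge0 // sumr_ge0.
pose t (k : nat) : R := Num.sqrt (e k.+1).
have t0 : t @ \oo --> 0.
  rewrite /t -(sqrtr0 R); have e1 : (fun k => e k.+1) @ \oo --> 0 by rewrite (cvg_shiftS e).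
  by apply: (@continuous_cvg _ R R); [exact: sqrt_continuous|exact: e1].
pose Sigma := [set k | b k <= t k].
exists Sigma; last first.
  apply/cvgrPdist_le => eps eps0; have /cvgrPdist_le /(_ _ eps0) := t0.
  rewrite /within; apply: filterS => k /= H bk; apply: le_trans H.
  by rewrite !sub0r !normrN !ger0_norm ?sqrtr_ge0.
rewrite /has_density; apply/cvgrPdist_le => eps eps0.
have /cvgrPdist_le /(_ _ eps0) := t0 => -[N _ HN].
exists N.+1 => // -[//|l] /= Nl.
have tl := HN l Nl; rewrite sub0r normrN ger0_norm ?sqrtr_ge0 // in tl.
have E : 1 - l.+1%:R^-1 * \sum_(k < l.+1) \1_Sigma (k : nat) =
    l.+1%:R^-1 * \sum_(k < l.+1) (t k < b k)%R%:R :> R.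
  rewrite -{1}(@mulVf R l.+1%:R) ?pnatr_eq0 // -mulrBr; congr (_ * _).
  rewrite -{1}(card_ord l.+1) -sumr_const -sumrB; apply: eq_bigr => k _.
  rewrite indicE; case: (leP (b k) (t k)) => H.
    by rewrite mem_set // subrr.
  by rewrite memNset ?subr0 //= /Sigma /=; apply/negP; rewrite -ltNge.
rewrite E ger0_norm; last by rewrite mulr_ge0 ?invr_ge0 // sumr_ge0.
apply: le_trans tl; apply: le_trans (exceptional_count_le (t := t l) (l := l.+1) b0 _ _).
- rewrite ler_pM2l ?invr_gt0 ?ltr0n //; apply: ler_sum => k _; rewrite ler_nat.
  case: (ltP (t k) (b k)) => // H; rewrite (_ : t l < b k) //; apply: le_lt_trans H.
  by apply: ler_wsqrtr; apply: e_mono; exact: ltn_ord.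
- exact: sqrtr_ge0.
- by rewrite sqr_sqrtr.
Qed.

End koopman_von_neumann.

(** * Cut-off functions *)

Section cut.
Context d (T : measurableType d) (R : realType) (mu : {measure set T -> \bar R}).
Implicit Types (X : T -> R) (u v w : T -> R[i]) (q : set T).

Definition nrm u : R := complex.Re (inner mu u u).

Lemma nrmE u : in_L2 mu u -> (nrm u)%:E = l2_normsq mu u.
Proof. by move=> uL; rewrite l2_normsqE. Qed.

Lemma nrm_ge0 u : in_L2 mu u -> 0 <= nrm u.
Proof. by move=> uL; rewrite -lee_fin nrmE // l2_normsq_ge0. Qed.

Lemma nrm_rip u : in_L2 mu u -> nrm u = rip mu (re u) (re u) + rip mu (im u) (im u).
Proof. by move=> uL; rewrite /nrm Re_inner. Qed.

Lemma measurable_csq u : measurable_fun setT (re u) -> measurable_fun setT (im u) ->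
  measurable_fun setT (fun x => (csq (u x))%:E).
Proof.
by move=> mr mi; apply/measurable_EFinP; apply: measurable_funD; exact: measurable_funX.
Qed.

Lemma nrm_le u v : in_L2 mu u -> in_L2 mu v -> (forall x, csq (u x) <= csq (v x)) ->
  nrm u <= nrm v.
Proof.
move=> uL vL uv; rewrite -lee_fin !nrmE //; apply: ge0_le_integral_set => x _.
  exact: csq_EFin_ge0.
by rewrite lee_fin.
Qed.

Lemma csqD (z w : R[i]) : csq (z + w) <= 2 * csq z + 2 * csq w.
Proof.
rewrite /csq !complexE -subr_ge0.
rewrite (_ : _ - _ = (complex.Re z - complex.Re w) ^+ 2 + (complex.Im z - complex.Im w) ^+ 2).
  by rewrite addr_ge0 ?sqr_ge0.
ring.
Qed.

Lemma l2_normsq_double u v w :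
  measurable_fun setT (re v) -> measurable_fun setT (im v) ->
  measurable_fun setT (re w) -> measurable_fun setT (im w) ->
  (forall x, csq (u x) <= 2 * csq (v x) + 2 * csq (w x)) ->
  (l2_normsq mu u <= 2%:E * l2_normsq mu v + 2%:E * l2_normsq mu w)%E.
Proof.
move=> rv iv rw iw uvw; have mv := measurable_csq rv iv; have mw := measurable_csq rw iw.
have two0 : (0 <= 2%:E :> \bar R)%E by [].
rewrite /l2_normsq -(ge0_integralZl mu measurableT mv (fun x _ => csq_EFin_ge0 v x) two0).
rewrite -(ge0_integralZl mu measurableT mw (fun x _ => csq_EFin_ge0 w x) two0).
rewrite -(ge0_integralD mu measurableT (fun x _ => mule_ge0 two0 (csq_EFin_ge0 v x))
  (measurable_funeM _ mv) (fun x _ => mule_ge0 two0 (csq_EFin_ge0 w x)) (measurable_funeM _ mw)).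
apply: ge0_le_integral_set => x _; first exact: csq_EFin_ge0.
by rewrite -!EFinM -EFinD lee_fin.
Qed.

Lemma nrm_double u v w : in_L2 mu u -> in_L2 mu v -> in_L2 mu w ->
  (forall x, csq (u x) <= 2 * csq (v x) + 2 * csq (w x)) -> nrm u <= 2 * nrm v + 2 * nrm w.
Proof.
move=> uL vL wL uvw; have [rv iv _] := vL; have [rw iw _] := wL.
by rewrite -lee_fin EFinD !EFinM !nrmE //; exact: l2_normsq_double.
Qed.

Definition cut X u : T -> R[i] :=
  fun x => (X x * complex.Re (u x)) +i* (X x * complex.Im (u x)).

Lemma csq_cut X u x : csq (cut X u x) = X x ^+ 2 * csq (u x).
Proof. by rewrite /csq /cut /= !exprMn mulrDr. Qed.

Lemma cutB X u v : cut X u \- cut X v = cut X (u \- v).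
Proof. by apply/funext => x; apply: complex_ext; rewrite /= !complexE /=; ring. Qed.

Section unit_cut.
Variable X : T -> R.
Hypotheses (mX : measurable_fun setT X) (X0 : forall x, 0 <= X x) (X1 : forall x, X x <= 1).

Lemma csq_cut_le u x : csq (cut X u x) <= csq (u x).
Proof. by rewrite csq_cut ler_piMl ?csq_ge0 // exprn_ile1. Qed.

Lemma in_L2_cut u : in_L2 mu u -> in_L2 mu (cut X u).
Proof.
move=> [mr mi uoo]; split.
- exact: measurable_funM.
- exact: measurable_funM.
- apply: le_lt_trans uoo; apply: ge0_le_integral_set => x _; first exact: csq_EFin_ge0.
  by rewrite lee_fin csq_cut_le.
Qed.

Lemma nrm_cut_le u : in_L2 mu u -> nrm (cut X u) <= nrm u.
Proof. by move=> uL; apply: nrm_le => // [|x]; [exact: in_L2_cut|exact: csq_cut_le]. Qed.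

Lemma nrm_cut_double u v : in_L2 mu u -> in_L2 mu v ->
  nrm (cut X u) <= 2 * nrm (cut X v) + 2 * nrm (u \- v).
Proof.
move=> uL vL; have uvL : in_L2 mu (u \- v) by exact: in_L2B.
have cu := in_L2_cut uL; have cv := in_L2_cut vL.
apply: nrm_double => // x.
apply: le_trans (_ : 2 * csq (cut X v x) + 2 * csq (cut X (u \- v) x) <= _).
  rewrite -cutB /= -{1}[cut X u x](subrK (cut X v x)) addrC; exact: csqD.
by rewrite lerD2l ler_pM2l // csq_cut_le.
Qed.

Variable q : set T.
Hypotheses (mq : measurable q) (qoo : (mu q < +oo)%E).

(** Testing against this function computes the integral of [X] times a function over
    the cell [q], see [csq_inner_cell]. *)
Definition cell_fun : T -> R[i] := fun x => (X x * \1_q x)%:C.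

Lemma csq_cell_fun_le x : csq (cell_fun x) <= \1_q x.
Proof.
rewrite /csq /= expr0n addr0 exprMn.
apply: (@le_trans _ _ (\1_q x ^+ 2)); first by rewrite ler_piMl ?sqr_ge0 // exprn_ile1.
by rewrite indicE; case: (x \in q); rewrite ?expr1n ?expr0n.
Qed.

Lemma cell_fun_normsq : (l2_normsq mu cell_fun <= mu q)%E.
Proof.
rewrite -[X in (_ <= mu X)%E](setIT q) -integral_indic //; apply: ge0_le_integral_set => x _.
  exact: csq_EFin_ge0.
by rewrite lee_fin csq_cell_fun_le.
Qed.

Lemma in_L2_cell_fun : in_L2 mu cell_fun.
Proof.
split; last exact: le_lt_trans cell_fun_normsq qoo.
  by apply: measurable_funM => //; exact: measurable_indic.
exact: measurable_cst.
Qed.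

Lemma rip_cell (a : T -> R) : (\int[mu]_(x in q) (X x * a x))%R = rip mu a (re cell_fun).
Proof.
rewrite /rip Rintegral_mkcond; apply: eq_Rintegral => x _.
rewrite /re /= patchE indicE; case: ifP => _; rewrite ?mulr1 ?mulr0 //; ring.
Qed.

Lemma csq_inner_cell u : in_L2 mu u -> csq (inner mu u cell_fun) =
  (\int[mu]_(x in q) (X x * re u x))%R ^+ 2 + (\int[mu]_(x in q) (X x * im u x))%R ^+ 2.
Proof.
move=> uL; have cL := in_L2_cell_fun; rewrite /csq Re_inner // Im_inner // !rip_cell.
have Z (a : T -> R) : rip mu a (im cell_fun) = 0.
  by rewrite /rip /Rintegral integral0_eq // => x _; rewrite /im /= mulr0.
by rewrite !Z addr0 subr0.
Qed.

Lemma csq_inner_cell_le u : in_L2 mu u -> csq (inner mu u cell_fun) <= nrm u * fine (mu q).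
Proof.
move=> uL; have cL := in_L2_cell_fun; have [ur ui] := (in_L2P mu u).1 uL.
have [cr ci] := (in_L2P mu cell_fun).1 cL.
rewrite csq_inner_cell // !rip_cell nrm_rip // mulrDl.
have cq : rip mu (re cell_fun) (re cell_fun) <= fine (mu q).
  rewrite -lee_fin rip_sqr // fineK ?ge0_fin_numE //; apply: le_trans cell_fun_normsq.
  by apply: ge0_le_integral_set => x _; rewrite lee_fin ?sqr_ge0 // /csq lerDl sqr_ge0.
by apply: lerD; apply: le_trans (sqr_rip_le _ _) _ => //; apply: ler_wpM2l; rewrite ?rip_ge0.
Qed.

End unit_cut.
End cut.

(** * The Caccioppoli inequality for approximating test functions *)

Section compact_support.
Context {R : realType} {n : nat} {M : ptopologicalType} {A : smooth_atlas R n M}.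
Variables (g : riemannian_metric A) (mu : {measure set (borel M) -> \bar R}).

Lemma rgrad_off (f h : M -> R) (K : set M) x : closed K -> (forall y, h y != 0 -> K y) ->
  ~ K x -> rgrad g f h x = 0.
Proof.
move=> cK hK Kx; apply: rgrad_near0.
have oK : open (~` K) by rewrite openC.
apply: filterS (open_nbhs_nbhs (conj oK Kx)) => y Ky.
by apply/eqP/negP => hy; apply: Ky; apply: hK; apply/negP.
Qed.

Lemma integrable_of_compact_support (f : M -> R) (K : set M) :
  continuous f -> compact K -> closed K -> (mu K < +oo)%E -> (forall x, ~ K x -> f x = 0) ->
  mu.-integrable [set: borel M] (EFin \o f).
Proof.
move=> cf kK cK Koo f0; have mK := borel_closed cK.
have mf : measurable_fun [set: borel M] (f : borel M -> R) := borel_real cf.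
have [B [_ HB]] : bounded_set (f @` K).
  apply: compact_bounded; apply: continuous_compact => //.
  exact: continuous_subspaceT.
have -> : EFin \o f = (EFin \o f) \_ (K : set (borel M)).
  apply/funext => x; rewrite patchE; case: ifPn => // /negP xK.
  by rewrite /= f0 // => Kx; apply: xK; rewrite inE.
have := (@integrable_mkcond _ (borel M) R mu K (EFin \o f) mK).1; apply.
apply: (@bounded_integrable _ _ _ mu K (f : borel M -> R) (B + 1) mK Koo).
  exact: measurable_funTS.
by move=> x Kx; apply: HB; [rewrite ltrDl|exists x].
Qed.

Lemma test_csmooth (u : borel M -> R[i]) k : test_function (A := A) u ->
  csmooth (A := A) k (re u) /\ csmooth (A := A) k (im u).
Proof. by move=> [H _]; split => i; have [] := H i; move=> /(_ k) ? /(_ k) ?. Qed.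

End compact_support.

Section cutoff_eigenfunction.
Context {R : realType} {n : nat} {M : ptopologicalType} {A : smooth_atlas R n M}.
Variables (g : riemannian_metric A) (mu : {measure set (borel M) -> \bar R}).
Variables (chi : nat -> M -> R) (K : set M) (C : R).
Hypothesis L : localizer g mu chi K C.
Variable j : nat.
Local Notation X := (chi j).
Local Notation X2 := (chi j \* chi j).
Local Notation Y := (chi j.+1).
Local Notation cutM X u := (cut (X : borel M -> R) u).

Let CX k : csmooth (A := A) k X. Proof. exact: loc_smooth L j k. Qed.
Let CX2 k : csmooth (A := A) k X2. Proof. exact: csmoothM. Qed.

Lemma measurable_chi i : measurable_fun [set: borel M] (chi i : borel M -> R).
Proof. apply: borel_real; exact: csmooth_continuous (loc_smooth L i 1). Qed.

Let mX : measurable_fun [set: borel M] (X : borel M -> R). Proof. exact: measurable_chi. Qed.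
Let mY : measurable_fun [set: borel M] (Y : borel M -> R). Proof. exact: measurable_chi. Qed.
Let X0 := loc_ge0 L j.
Let X1 := loc_le1 L j.
Let Y0 := loc_ge0 L j.+1.
Let Y1 := loc_le1 L j.+1.
Let mX2 : measurable_fun [set: borel M] (X2 : borel M -> R). Proof. exact: measurable_funM. Qed.
Let X20 x : 0 <= X2 x. Proof. exact: mulr_ge0. Qed.
Let X21 x : X2 x <= 1. Proof. by rewrite /= mulr_ile1. Qed.

Lemma test_function_cut (u : borel M -> R[i]) : test_function (A := A) u -> test_function (A := A) (cutM X2 u).
Proof.
move=> tu; split.
  move=> i; split => k; have [cr ci] := test_csmooth k tu.
    exact: (csmoothM (CX2 k) cr i).
  exact: (csmoothM (CX2 k) ci i).
apply: (subclosed_compact (@closed_closure _ _) (loc_compact L)).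
rewrite ((closure_id K).1 (loc_closed L)); apply: closure_subset => x /= ux; apply: (loc_supp L (j := j)); apply/eqP => x0.
by case/eqP: ux; apply: complex_ext; rewrite /cut /= x0 !mul0r.
Qed.

Let C0 : 0 <= C * 16 ^+ j.
Proof. by rewrite mulr_ge0 ?exprn_ge0 // ltW // (loc_const_gt0 L). Qed.

Lemma grad_chi2_le x : rgrad g X2 X2 x <= 4 * (C * 16 ^+ j).
Proof.
apply: le_trans (rgradM_le g x (CX 1) (CX 1)) _.
have gX : rgrad g X X x <= C * 16 ^+ j.
  by apply: le_trans (loc_grad L j x) _; rewrite ler_piMr // exprn_ile1 //.
have X2le : X x ^+ 2 <= 1 by rewrite exprn_ile1.
have P : X x ^+ 2 * rgrad g X X x <= C * 16 ^+ j.
  by apply: le_trans gX; rewrite ler_piMl // rgrad_ge0.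
lra.
Qed.


(** The product rule, with the gradient of the cutoff bounded by a constant; applied to
    differences of test functions it shows that cutting off preserves convergence in
    the form norm. *)
Lemma energy_cut_le (w : borel M -> R[i]) :
  csmooth (A := A) 1 (re w) -> csmooth (A := A) 1 (im w) ->
  (dirichlet_energy g mu (cutM X2 w) <=
   2%:E * dirichlet_energy g mu w + (8 * (C * 16 ^+ j))%:E * l2_normsq mu w)%E.
Proof.
move=> cr ci; have mr := borel_real (csmooth_continuous cr).
have mi := borel_real (csmooth_continuous ci).
have mE : measurable_fun [set: borel M] (fun x => (complex.Re (grad_dot g w w x))%:E).
  apply/measurable_EFinP; apply: (@borel_real M R (fun x => complex.Re (grad_dot g w w x))).
  rewrite (_ : (fun x => _) = fun x => rgrad g (re w) (re w) x + rgrad g (im w) (im w) x).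
    by move=> x; apply: continuousD; apply: rgrad_continuous.
  by apply/funext => x; rewrite Re_grad_dot.
have E0 x : (0 <= (complex.Re (grad_dot g w w x))%:E)%E.
  by rewrite lee_fin Re_grad_dot addr_ge0 ?rgrad_ge0.
have mc := measurable_csq mr mi.
have B0 : 0 <= 8 * (C * 16 ^+ j) by apply: mulr_ge0.
have k2 : (0 <= 2%:E :> \bar R)%E by [].
have k8 : (0 <= (8 * (C * 16 ^+ j))%:E)%E by rewrite lee_fin.
rewrite /dirichlet_energy /l2_normsq.
rewrite -(ge0_integralZl mu measurableT mE (fun x _ => E0 x) k2).
rewrite -(ge0_integralZl mu measurableT mc (fun x _ => csq_EFin_ge0 w x) k8).
rewrite -(ge0_integralD mu measurableT (fun x _ => mule_ge0 k2 (E0 x)) (measurable_funeM _ mE)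
  (fun x _ => mule_ge0 k8 (csq_EFin_ge0 w x)) (measurable_funeM _ mc)).
apply: ge0_le_integral_set => x _.
  by rewrite lee_fin Re_grad_dot addr_ge0 ?rgrad_ge0.
rewrite -!EFinM -EFinD lee_fin !Re_grad_dot.
have H (a : M -> R) : csmooth (A := A) 1 a ->
    rgrad g (X2 \* a) (X2 \* a) x <= 2 * rgrad g a a x + 8 * (C * 16 ^+ j) * a x ^+ 2.
  move=> ca; apply: le_trans (rgradM_le g x ca (CX2 1)) _.
  have g2 := grad_chi2_le x.
  have p1 : X2 x ^+ 2 * rgrad g a a x <= rgrad g a a x.
    by rewrite ler_piMl ?rgrad_ge0 // exprn_ile1.
  have p2 : a x ^+ 2 * rgrad g X2 X2 x <= a x ^+ 2 * (4 * (C * 16 ^+ j)).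
    by rewrite ler_wpM2l ?sqr_ge0.
  lra.
have := H _ cr; have := H _ ci; rewrite /csq /re /im; lra.
Qed.

Lemma csmooth_sub (u v : borel M -> R[i]) : test_function (A := A) u -> test_function (A := A) v ->
  csmooth (A := A) 1 (re (u \- v)) /\ csmooth (A := A) 1 (im (u \- v)).
Proof.
move=> /(test_csmooth 1)[ur ui] /(test_csmooth 1)[vr vi]; split.
  rewrite (_ : re _ = re u \+ (fun x => - re v x)).
    by apply: csmoothD => //; exact: csmoothN.
  by apply/funext => x; rewrite /re /= !complexE.
rewrite (_ : im _ = im u \+ (fun x => - im v x)).
  by apply: csmoothD => //; exact: csmoothN.
by apply/funext => x; rewrite /im /= !complexE.
Qed.

(** The cutoff must remain in the form domain, since the weak equation will be tested
    against [chi j ^+ 2] times the eigenfunction. *)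
Lemma form_approx_cut (u_ : nat -> borel M -> R[i]) u : in_L2 mu u ->
  form_approx g mu u_ u -> form_approx g mu (fun k => cutM X2 (u_ k)) (cutM X2 u).
Proof.
move=> uL [tu cu eu]; have [mur mui _] := uL; split.
- by move=> k; exact: test_function_cut.
- rewrite /L2_cvg; apply: (@squeeze_cvge _ _ _ _ (cst 0%E) _ (fun k => l2_normsq mu (u_ k \- u))).
  + near=> k; rewrite l2_normsq_ge0 /= cutB; apply: ge0_le_integral_set => x _.
      exact: csq_EFin_ge0.
    by rewrite lee_fin csq_cut_le.
  + exact: cvg_cst.
  + exact: cu.
- move=> e e0.
  pose B := 8 * (C * 16 ^+ j); have B0 : 0 <= B by exact: mulr_ge0.
  have /fine_cvgP [fin0 cv] := cu.
  have d0 : 0 < e / (16 * (B + 1)) by rewrite divr_gt0 // mulr_gt0 // ltr_wpDl.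
  have e4 : 0 < e / 4 by rewrite divr_gt0.
  have [N1 HN1] := eu _ e4.
  have [N2 _ HN2] : \forall k \near \oo, (l2_normsq mu (u_ k \- u)%R <= (e / (16 * (B + 1)))%:E)%E.
    have /cvgrPdist_le /(_ _ d0) := cv; apply: filterS2 fin0 => k fk /=.
    rewrite sub0r normrN ger0_norm ?fine_ge0 ?l2_normsq_ge0 // => H.
    by rewrite -(fineK fk) lee_fin.
  exists (maxn N1 N2) => k l; rewrite !geq_max => /andP[k1 k2] /andP[l1 l2].
  have [cr ci] := csmooth_sub (tu k) (tu l).
  rewrite cutB; apply: le_lt_trans (energy_cut_le cr ci) _.
  have m_ h : test_function (A := A) h -> measurable_fun setT (re h) /\ measurable_fun setT (im h).
    by move=> /(test_csmooth 1)[hr hi]; split; apply: borel_real; exact: csmooth_continuous.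
  have ms h : test_function (A := A) h -> measurable_fun setT (re (h \- u)) /\ measurable_fun setT (im (h \- u)).
    move=> /m_[hr hi]; split.
      rewrite (_ : re _ = fun x => re h x - re u x); first exact: measurable_funB.
      by apply/funext => x; rewrite /re /= !complexE.
    rewrite (_ : im _ = fun x => im h x - im u x); first exact: measurable_funB.
    by apply/funext => x; rewrite /im /= !complexE.
  have [kr ki] := ms _ (tu k); have [lr li] := ms _ (tu l).
  have D : (l2_normsq mu (u_ k \- u_ l)%R <= (4 * (e / (16 * (B + 1))))%:E)%E.
    apply: le_trans (l2_normsq_double (v := u_ k \- u) (w := u_ l \- u) mu kr ki lr li _) _.
      move=> x; rewrite /= (_ : _ - _ = (u_ k x - u x) + (- (u_ l x - u x))); last by ring.
      apply: le_trans (csqD _ _) _; rewrite lerD2l ler_pM2l //.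
      by rewrite /csq !complexE !sqrrN.
    have H k' : (N2 <= k')%N -> (2%:E * l2_normsq mu (u_ k' \- u)%R <= (2 * (e / (16 * (B + 1))))%:E)%E.
      by move=> /HN2 H; rewrite EFinM; apply: lee_wpmul2l.
    apply: le_trans (leeD (H k k2) (H l l2)) _.
    by rewrite -EFinD lee_fin; lra.
  apply: (@le_lt_trans _ _ ((e / 2)%:E + (e / 4)%:E)%E); last first.
    by rewrite -EFinD lte_fin; lra.
  apply: leeD.
    rewrite (_ : e / 2 = 2 * (e / 4)); last by field.
    rewrite EFinM; apply: lee_wpmul2l => //; apply/ltW; exact: HN1.
  apply: le_trans (lee_wpmul2l _ D) _; first by rewrite lee_fin.
  rewrite -EFinM lee_fin -/B.
  (* [B + 1] in the denominator because [B] may be small; only [B / (B + 1) <= 1] matters. *)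
  have B1 : B + 1 != 0 by rewrite gt_eqF // ltr_wpDl.
  rewrite (_ : B * _ = (e / 4) * (B / (B + 1))); last by clearbody B; field.
  rewrite ler_piMr ?(ltW e4) // ler_pdivrMr ?ltr_wpDl // mul1r lerDl //.
Unshelve. all: by end_near. Qed.

Lemma form_domain_cut u : form_domain g mu u -> form_domain g mu (cutM X2 u).
Proof.
move=> [uL [u_ ua]]; split; first exact: in_L2_cut.
by exists (fun k => cutM X2 (u_ k)); exact: form_approx_cut.
Qed.

Lemma inner_cut2 u : in_L2 mu u -> complex.Re (inner mu u (cutM X2 u)) = nrm mu (cutM X u).
Proof.
move=> uL; rewrite Re_inner //; last exact: in_L2_cut.
rewrite nrm_rip; last exact: in_L2_cut.
congr (_ + _); apply: eq_Rintegral => x _; rewrite /re /im /cut /=; ring.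
Qed.

Let P (u : borel M -> R[i]) x := complex.Re (grad_dot g u (cutM X2 u) x).

Lemma integrable_grad_dot_cut u : test_function (A := A) u ->
  mu.-integrable setT (EFin \o P u).
Proof.
move=> tu; have [ur ui] := test_csmooth 1 tu.
have E x : P u x = rgrad g (re u) (X2 \* re u) x + rgrad g (im u) (X2 \* im u) x.
  by rewrite /P Re_grad_dot.
have I := @integrable_of_compact_support R M mu (P u) K; apply: I.
- rewrite (_ : P u = fun x => rgrad g (re u) (X2 \* re u) x + rgrad g (im u) (X2 \* im u) x).
    by move=> x; apply: continuousD; apply: rgrad_continuous => //; exact: csmoothM.
  by apply/funext => x; rewrite E.
- exact: loc_compact L.
- exact: loc_closed L.
- exact: loc_finite L.
- have K0 (a : M -> R) y : (X2 \* a) y != 0 -> K y.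
    by rewrite /= !mulf_eq0 !negb_or => /andP[/andP[H _] _]; exact: (loc_supp L H).
  move=> x Kx; rewrite E (rgrad_off _ _ (loc_closed L) (K0 _) Kx).
  by rewrite (rgrad_off _ _ (loc_closed L) (K0 _) Kx) addr0.
Qed.

(** The integrated form of [rgrad_cutoff].  Both sides concern the localized function,
    yet the gradient of [u] occurs on the right only through the Dirichlet form of [u]
    and [X2 * u], which the weak equation evaluates when [u] approximates an
    eigenfunction. *)
Lemma caccioppoli u : test_function (A := A) u -> in_L2 mu u ->
  (\int[mu]_x (rgrad g (X \* re u) (X \* re u) x)%:E +
   \int[mu]_x (rgrad g (X \* im u) (X \* im u) x)%:E <=
   (4 * complex.Re (dirichlet_form g mu u (cutM X2 u))
    + 10 * (C * 16 ^+ j) * nrm mu (cutM Y u))%:E)%E.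
Proof.
move=> tu uL; have [ur ui] := test_csmooth 1 tu.
have YL : in_L2 mu (cutM Y u) by exact: in_L2_cut.
have iP := integrable_grad_dot_cut tu.
have iY : mu.-integrable setT (fun x => (csq (cutM Y u x))%:E).
  have [mr mi fY] := YL; apply/integrableP; split; first exact: measurable_csq.
  by under eq_integral do rewrite gee0_abs ?csq_EFin_ge0 //.
have mG (a : M -> R) : csmooth (A := A) 1 a ->
    measurable_fun [set: borel M] (fun x => (rgrad g (X \* a) (X \* a) x)%:E).
  move=> ca; apply/measurable_EFinP; apply: (@borel_real M R (rgrad g (X \* a) (X \* a))).
  by apply: rgrad_continuous; exact: csmoothM.
have G0 (a : M -> R) x : (0 <= (rgrad g (X \* a) (X \* a) x)%:E)%E.
  by rewrite lee_fin rgrad_ge0.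
rewrite -(ge0_integralD mu measurableT (fun x _ => G0 (re u) x) (mG _ ur)
  (fun x _ => G0 (im u) x) (mG _ ui)).
pose B := 10 * (C * 16 ^+ j).
apply: (@le_trans _ _ (\int[mu]_x (4%:E * (P u x)%:E + B%:E * (csq (cutM Y u x))%:E))%E).
  apply: ge0_le_integral_set => x _; first by rewrite adde_ge0.
  rewrite -!EFinM -!EFinD lee_fin csq_cut /csq.
  have H (a : M -> R) : csmooth (A := A) 1 a -> rgrad g (X \* a) (X \* a) x <=
      4 * rgrad g a (X2 \* a) x + B * (Y x ^+ 2 * a x ^+ 2).
    move=> ca; have h1 := rgradM_le g x ca (CX 1); have h2 := rgrad_cutoff g x ca (CX 1).
    have h3 : a x ^+ 2 * rgrad g X X x <= a x ^+ 2 * (C * 16 ^+ j * Y x ^+ 2).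
      by rewrite ler_wpM2l ?sqr_ge0 //; exact: loc_grad L j x.
    rewrite /B; lra.
  have := H _ ur; have := H _ ui; rewrite /P Re_grad_dot /re /im; lra.
rewrite integralD //; last 2 first.
- exact: integrableZl.
- exact: integrableZl.
rewrite !integralZl // -/(l2_normsq mu (cutM Y u)) -(nrmE YL).
have -> : (\int[mu]_x (P u x)%:E = (complex.Re (dirichlet_form g mu u (cutM X2 u)))%:E)%E.
  by rewrite /= /Rintegral fineK //; exact: (integrable_fin_num _ iP).
by rewrite -!EFinM -EFinD lee_fin.
Qed.

End cutoff_eigenfunction.

(** * The local estimate for one eigenfunction *)

Section eigenfunction_poincare.
Context {R : realType} {n : nat} {M : ptopologicalType} {A : smooth_atlas R n M}.
Variables (g : riemannian_metric A) (mu : {measure set (borel M) -> \bar R}).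
Variables (chi : nat -> M -> R) (K : set M) (C : R).
Hypothesis L : localizer g mu chi K C.
Variable j : nat.
Local Notation X := (chi j).
Local Notation X2 := (chi j \* chi j).
Local Notation Y := (chi j.+1).
Local Notation cutM X u := (cut (X : borel M -> R) u).

Let mX : measurable_fun [set: borel M] (X : borel M -> R). Proof. exact: measurable_chi L j. Qed.
Let mY : measurable_fun [set: borel M] (Y : borel M -> R). Proof. exact: measurable_chi L j.+1. Qed.
Let X0 := loc_ge0 L j.
Let X1 := loc_le1 L j.
Let Y0 := loc_ge0 L j.+1.
Let Y1 := loc_le1 L j.+1.
Let C0 : 0 <= C * 16 ^+ j.
Proof. by rewrite mulr_ge0 ?exprn_ge0 // ltW // (loc_const_gt0 L). Qed.

Variables (kappa : nat) (q : {ffun 'I_n -> 'I_kappa} -> set (borel M)).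
Hypotheses (mq : forall m, measurable (q m)) (q_gt0 : forall m, (0 < mu (q m) < +oo)%E).
Hypothesis q_poincare : forall a e, csmooth (A := A) 1 a -> 0 < e ->
  (\int[mu]_x ((X x * a x) ^+ 2)%:E <=
    \sum_m ((\int[mu]_(x in q m) (X x * a x))%R ^+ 2 / fine (mu (q m)))%:E
    + (C / kappa%:R ^+ 2)%:E * \int[mu]_x (rgrad g (X \* a) (X \* a) x)%:E + e%:E)%E.

Let cf m : borel M -> R[i] := cell_fun (X : borel M -> R) (q m).
Let cm (u : borel M -> R[i]) m := csq (inner mu u (cf m)) / fine (mu (q m)).
Let c := C / kappa%:R ^+ 2.

Let c0 : 0 <= c.
Proof. by rewrite divr_ge0 ?sqr_ge0 // ltW // (loc_const_gt0 L). Qed.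

Let mq_gt0 m : 0 < fine (mu (q m)).
Proof. by apply: fine_gt0; exact: q_gt0. Qed.

Let mqoo m : (mu (q m) < +oo)%E.
Proof. by case/andP: (q_gt0 m). Qed.

(** The Poincare inequality for the real and imaginary parts, with the energy term
    bounded by [caccioppoli]. *)
Lemma poincare_test u (e : R) : test_function (A := A) u -> in_L2 mu u -> 0 < e ->
  nrm mu (cutM X u) <= \sum_m cm u m
    + c * (4 * complex.Re (dirichlet_form g mu u (cutM X2 u))
           + 10 * (C * 16 ^+ j) * nrm mu (cutM Y u)) + 2 * e.
Proof.
move=> tu uL e0; have [ur ui] := test_csmooth 1 tu.
have cL : in_L2 mu (cutM X u) by exact: in_L2_cut.
have [rL iL] := (in_L2P mu (cutM X u)).1 cL.
have G0 (a : M -> R) : (0 <= \int[mu]_x (rgrad g (X \* a) (X \* a) x)%:E)%E.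
  by apply: integral_ge0 => x _; rewrite lee_fin rgrad_ge0.
have pr := q_poincare ur e0; have pi := q_poincare ui e0.
have := caccioppoli L j tu uL.
move: pr pi (G0 (re u)) (G0 (im u)).
have -> : (\int[mu]_x ((X x * re u x) ^+ 2)%:E = (rip mu (re (cutM X u)) (re (cutM X u)))%:E)%E.
  by rewrite rip_sqr.
have -> : (\int[mu]_x ((X x * im u x) ^+ 2)%:E = (rip mu (im (cutM X u)) (im (cutM X u)))%:E)%E.
  by rewrite rip_sqr.
set Gr := (\int[mu]_x (rgrad g (X \* re u) (X \* re u) x)%:E)%E.
set Gi := (\int[mu]_x (rgrad g (X \* im u) (X \* im u) x)%:E)%E.
set W := 4 * _ + _; rewrite !sumEFin nrm_rip //.
have -> : \sum_m cm u m = \sum_m ((\int[mu]_(x in q m) (X x * re u x))%R ^+ 2 / fine (mu (q m)))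
    + \sum_m ((\int[mu]_(x in q m) (X x * im u x))%R ^+ 2 / fine (mu (q m))).
  rewrite -big_split /=; apply: eq_bigr => m _; rewrite -mulrDl; congr (_ / _).
  exact: csq_inner_cell.
case: Gr => [gr| |] //; case: Gi => [gi| |] //=.
rewrite -!EFinM -!EFinD !lee_fin => pr pi r0 i0 W0.
have : c * (gr + gi) <= c * W by rewrite ler_wpM2l.
rewrite -/c in pr pi; lra.
Qed.

Lemma cm_double u v m : in_L2 mu u -> in_L2 mu v -> cm u m <= 2 * cm v m + 2 * nrm mu (u \- v).
Proof.
move=> uL vL; have cL : in_L2 mu (cf m) by exact: in_L2_cell_fun.
have uvL : in_L2 mu (u \- v) by exact: in_L2B.
rewrite /cm ler_pdivrMr // mulrDl -mulrA divfK ?gt_eqF // -mulrA.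
apply: le_trans (_ : 2 * csq (inner mu v (cf m)) + 2 * csq (inner mu (u \- v) (cf m)) <= _).
  rewrite (_ : inner mu u (cf m) = inner mu v (cf m) + inner mu (u \- v) (cf m)); first exact: csqD.
  by rewrite [inner mu (u \- v) _](innerBl uL vL cL) addrC subrK.
by rewrite lerD2l ler_pM2l //; exact: csq_inner_cell_le.
Qed.

Local Notation eigen := (eigenfunction (neg_laplace_beltrami g mu)).

(** Apply [poincare_test] to test functions approximating [u]; the weak equation turns
    the limit of their Dirichlet forms into the eigenvalue times the squared norm.
    The other terms are compared with those of [u] at the price of factors 2, which is
    simpler than passing to the limit in each of them. *)
Lemma eigen_poincare (s : R) u : eigen s%:C u ->
  nrm mu (cutM X u) <= 4 * \sum_m cm u m
    + c * (8 * s * nrm mu (cutM X u) + 40 * (C * 16 ^+ j) * nrm mu (cutM Y u)).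
Proof.
move=> eu; have uL := eigen_in_L2 eu; have [du _ _] := eu; have [_ [u_ ua]] := du.
have dv := form_domain_cut L j du; have va := form_approx_cut L j uL ua.
have [cD _] := eigen_weak eu dv ua va.
have Elim : complex.Re (s%:C * inner mu u (cutM X2 u)) = s * nrm mu (cutM X u).
  by rewrite Re_mul (inner_cut2 L j uL) (_ : complex.Im s%:C = 0) ?mul0r ?subr0.
rewrite Elim in cD.
have [tu cu _] := ua; have /fine_cvgP [fin0 cv] := cu.
pose d k := fine (l2_normsq mu (u_ k \- u)).
pose D k := complex.Re (dirichlet_form g mu (u_ k) (cutM X2 (u_ k))).
pose N : R := #|{: {ffun 'I_n -> 'I_kappa}}|%:R.
apply/ler_addgt0Pr => e e0.
pose B := C * 16 ^+ j.
pose rhs k : R := 2 * (\sum_m 2 * cm u m + N * (2 * d k) + c * (4 * D k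
     + 10 * B * (2 * nrm mu (cutM Y u) + 2 * d k)) + 2 * (e / 4)) + 2 * d k.
have cr : rhs @ \oo --> 2 * (\sum_m 2 * cm u m + N * (2 * 0) + c * (4 * (s * nrm mu (cutM X u))
     + 10 * B * (2 * nrm mu (cutM Y u) + 2 * 0)) + 2 * (e / 4)) + 2 * 0.
  have cd : d @ \oo --> (0 : R) by exact: cv.
  have cd2 : (fun k => 2 * d k) @ \oo --> (2 * 0 : R) by apply: cvgM cd; exact: cvg_cst.
  apply: cvgD; last exact: cd2.
  apply: cvgM; first exact: cvg_cst.
  apply: cvgD; last exact: cvg_cst.
  apply: cvgD.
    apply: cvgD; first exact: cvg_cst.
    by apply: cvgM; [exact: cvg_cst|exact: cd2].
  apply: cvgM; first exact: cvg_cst.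
  apply: cvgD; first by apply: cvgM; [exact: cvg_cst|exact: cD].
  apply: cvgM; first exact: cvg_cst.
  by apply: cvgD; [exact: cvg_cst|exact: cd2].
suff H : nrm mu (cutM X u) <= 2 * (\sum_m 2 * cm u m + N * (2 * 0) + c * (4 * (s * nrm mu (cutM X u))
     + 10 * B * (2 * nrm mu (cutM Y u) + 2 * 0)) + 2 * (e / 4)) + 2 * 0.
  apply: le_trans H _; rewrite -mulr_sumr -/B; lra.
apply: (cvgr_to_ge cr); apply: filterS fin0 => k fk.
have wL : in_L2 mu (u_ k \- u).
  have [mr mi] := test_csmooth 1 (tu k).
  have [ur ui _] := uL.
  split; last by rewrite ltey_eq fk.
    rewrite (_ : (fun x => _) = fun x => re (u_ k) x - re u x).
      by apply: measurable_funB => //; apply: borel_real; exact: csmooth_continuous mr.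
    by apply/funext => x; rewrite /re /= !complexE.
  rewrite (_ : (fun x => _) = fun x => im (u_ k) x - im u x).
    by apply: measurable_funB => //; apply: borel_real; exact: csmooth_continuous mi.
  by apply/funext => x; rewrite /im /= !complexE.
have kL : in_L2 mu (u_ k).
  rewrite (_ : u_ k = fun x => (u_ k \- u) x + u x); first exact: in_L2D.
  by apply/funext => x /=; rewrite subrK.
have dk : nrm mu (u_ k \- u) = d k by rewrite /d -nrmE.
have e4 : 0 < e / 4 by rewrite divr_gt0.
have h1 : nrm mu (cutM X u) <= 2 * nrm mu (cutM X (u_ k)) + 2 * nrm mu (u \- u_ k).
  exact: nrm_cut_double.
have dk' : nrm mu (u \- u_ k) = d k.
  rewrite -dk /nrm; congr (complex.Re _); congr (cintegral mu _); apply/funext => x /=.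
  by rewrite -(opprB (u_ k x)) rmorphN mulrNN.
have h2 := poincare_test (tu k) kL e4.
have h3 : nrm mu (cutM Y (u_ k)) <= 2 * nrm mu (cutM Y u) + 2 * nrm mu (u_ k \- u).
  exact: nrm_cut_double.
have h4 : \sum_m cm (u_ k) m <= \sum_m 2 * cm u m + N * (2 * d k).
  rewrite /N mulr_natl -sumr_const -big_split /=; apply: ler_sum => m _.
  by rewrite -dk; exact: cm_double.
rewrite dk' in h1; rewrite dk in h3.
have h5 : c * (4 * D k + 10 * B * nrm mu (cutM Y (u_ k))) <=
    c * (4 * D k + 10 * B * (2 * nrm mu (cutM Y u) + 2 * d k)).
  by rewrite ler_wpM2l // lerD2l ler_wpM2l // mulr_ge0.
rewrite -/(D k) -/B in h2; rewrite /rhs; lra.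
Qed.

End eigenfunction_poincare.

(** * The local Weyl bound *)

Section iteration.
Context {R : realType}.

(** Unfolding the recursion [J] times leaves a geometric series in [eps * theta],
    bounded by 2, and a remainder at most [b / 2 ^+ J]. *)
Lemma geometric_recursion (F : nat -> R) (a theta eps b : R) :
  0 <= a -> 0 <= theta -> 0 <= eps -> eps <= 1/2 -> eps * theta <= 1/2 -> 0 <= b ->
  (forall j, F j <= b) -> (forall j, F j <= a * theta ^+ j + eps * F j.+1) -> F 0%N <= 2 * a.
Proof.
move=> a0 t0 e0 e1 et b0 Fb rec.
have H J j : F j <= 2 * (a * theta ^+ j) + b / 2 ^+ J.
  elim: J j => [|J IH] j.
    by rewrite expr0 divr1; apply: le_trans (Fb j) _; rewrite lerDr !mulr_ge0 ?exprn_ge0.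
  apply: le_trans (rec j) _.
  have h1 : eps * F j.+1 <= eps * (2 * (a * theta ^+ j.+1) + b / 2 ^+ J) by rewrite ler_wpM2l.
  have h2 : eps * theta * (2 * (a * theta ^+ j)) <= 1/2 * (2 * (a * theta ^+ j)).
    by rewrite ler_wpM2r // !mulr_ge0 ?exprn_ge0.
  have h3 : eps * (b / 2 ^+ J) <= 1/2 * (b / 2 ^+ J).
    by rewrite ler_wpM2r // divr_ge0 ?exprn_ge0.
  have h4 : b / 2 ^+ J.+1 = 1/2 * (b / 2 ^+ J).
    by rewrite exprS; field; rewrite expf_neq0.
  rewrite h4; rewrite exprS in h1; lra.
apply/ler_addgt0Pr => e ep; set J := (Num.truncn (b / e)).+1.
apply: le_trans (H J 0%N) _; rewrite expr0 mulr1 lerD2l.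
rewrite ler_pdivrMr ?exprn_gt0 // -ler_pdivrMl // mulrC.
apply: le_trans (ltW (truncnS_gt _)) _; rewrite -natrX ler_nat; apply: ltnW; exact: ltn_expl.
Qed.

End iteration.

Section local_weyl.
Context {R : realType} {n : nat} {M : ptopologicalType} {A : smooth_atlas R n M}.
Variables (g : riemannian_metric A) (mu : {measure set (borel M) -> \bar R}).
Variables (chi : nat -> M -> R) (K : set M) (C : R).
Hypothesis L : localizer g mu chi K C.
Variables (phi : nat -> borel M -> R[i]) (lambda : nat -> R).
Hypothesis phi_basis : orthonormal_basis mu phi.
Hypothesis phi_eigen : forall i,
  eigenfunction (neg_laplace_beltrami g mu) (lambda i)%:C (phi i).
Local Notation cutM X u := (cut (X : borel M -> R) u).

Let phiL i : in_L2 mu (phi i). Proof. by case: phi_basis. Qed.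
Let phiO i k : inner mu (phi i) (phi k) = (i == k)%:R. Proof. by case: phi_basis. Qed.

Definition local_mass l j : R := \sum_(i < l) nrm mu (cutM (chi j) (phi i)).

Lemma local_mass_le l j : local_mass l j <= l%:R.
Proof.
rewrite /local_mass -[X in _ <= X%:R](card_ord l) -sumr_const; apply: ler_sum => i _.
apply: le_trans (nrm_cut_le (measurable_chi L j) (loc_ge0 L j) (loc_le1 L j) (phiL i)) _.
by rewrite /nrm phiO eqxx.
Qed.

(** Bessel's inequality for the function [cell_fun], whose squared norm is at most the
    measure of the cell. *)
Lemma bessel_cell l (q : set (borel M)) j : measurable q -> (0 < mu q < +oo)%E ->
  \sum_(i < l) csq (inner mu (phi i) (cell_fun (chi j : borel M -> R) q)) / fine (mu q) <= 1.
Proof.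
move=> mq /andP[q0 qoo]; set f := cell_fun _ q.
have mX := measurable_chi L j; have X0 := loc_ge0 L j; have X1 := loc_le1 L j.
have fL : in_L2 mu f by exact: in_L2_cell_fun.
rewrite -mulr_suml ler_pdivrMr ?mul1r; last by rewrite fine_gt0 ?q0.
rewrite -lee_fin fineK ?ge0_fin_numE //; apply: (le_trans _ (cell_fun_normsq mu X0 X1 mq)).
have O (i k : 'I_l) : inner mu (phi i) (phi k) = (i == k)%:R by rewrite phiO.
apply: (le_trans _ (bessel (fun i : 'I_l => phiL i) O fL)).
rewrite lee_fin; apply: ler_sum => i _.
by rewrite (inner_conj fL (phiL i)) csq_conj.
Qed.

(** Sum [eigen_poincare] over the first [l] eigenfunctions, on a grid with
    [4 ^ j * kappa] cells per side: the refinement makes up for the factor [16 ^+ j] in the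
    gradients of the cutoffs, so the coefficient of the next mass does not depend on
    [j]. *)
Lemma local_mass_recursion l (kappa : nat) (Lam : R) j : (0 < kappa)%N -> 1 <= Lam ->
  (forall i, (i < l)%N -> lambda i <= Lam) ->
  local_mass l j <= 4 * kappa%:R ^+ n * (4 ^+ n) ^+ j
    + C * (8 + 40 * C) * Lam / kappa%:R ^+ 2 * local_mass l j.+1.
Proof.
move=> k0 Lam1 lamL; have Cp := loc_const_gt0 L.
have k1 : (0 < 4 ^ j * kappa)%N by rewrite muln_gt0 expn_gt0.
have [q [mq qp qpoin]] := loc_poincare L k1.
have mX i := measurable_chi L i; have X0 i := loc_ge0 L i; have X1 i := loc_le1 L i.
have cL i m : in_L2 mu (cutM (chi m) (phi i)) by exact: in_L2_cut.
pose c := C / (4 ^ j * kappa)%:R ^+ 2.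
have kp : 0 < kappa%:R :> R by rewrite ltr0n.
have cE : c * 16 ^+ j = C / kappa%:R ^+ 2.
  rewrite /c natrM natrX exprMn -exprM mulnC exprM (_ : 4 ^+ 2 = 16 :> R); last by rewrite -natrX.
  by field; rewrite gt_eqF // expf_neq0.
have cp : 0 <= c by rewrite divr_ge0 ?sqr_ge0 // ltW.
have one (i : 'I_l) : nrm mu (cutM (chi j) (phi i)) <=
    4 * \sum_m csq (inner mu (phi i) (cell_fun (chi j : borel M -> R) (q m))) / fine (mu (q m))
    + C * (8 + 40 * C) * Lam / kappa%:R ^+ 2 * nrm mu (cutM (chi j.+1) (phi i)).
  have H := eigen_poincare L mq qp (qpoin j) (phi_eigen i).
  apply: le_trans H _; rewrite lerD2l -/c.
  set N := nrm mu _; set N' := nrm mu (cutM (chi j.+1) _).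
  have N0 : 0 <= N by exact: nrm_ge0.
  have NN' : N <= N'.
    apply: nrm_le => // x; rewrite !csq_cut ler_wpM2r ?csq_ge0 // lerXn2r ?nnegrE //.
    exact: loc_mono L j x.
  have N'0 : 0 <= N' by exact: le_trans NN'.
  have J1 : 1 <= 16 ^+ j :> R by rewrite exprn_ege1 // ler1n.
  have h1 : 8 * lambda i * N <= 8 * Lam * 16 ^+ j * N'.
    apply: le_trans (_ : 8 * Lam * N <= _).
      by rewrite -!mulrA ler_pM2l // ler_wpM2r // lamL.
    apply: ler_pM => //; first by rewrite mulr_ge0 // (le_trans _ Lam1).
    by rewrite ler_peMr // mulr_ge0 // (le_trans _ Lam1).
  have h2 : 40 * (C * 16 ^+ j) * N' <= 40 * C * Lam * 16 ^+ j * N'.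
    rewrite ler_wpM2r // mulrA ler_wpM2r ?exprn_ge0 // ler_peMr // mulr_ge0 // ltW //.
  apply: le_trans (ler_wpM2l cp (lerD h1 h2)) _.
  have -> : c * (8 * Lam * 16 ^+ j * N' + 40 * C * Lam * 16 ^+ j * N') =
    (c * 16 ^+ j) * ((8 + 40 * C) * Lam * N') by ring.
  by rewrite cE le_eqVlt; apply/orP; left; apply/eqP; field; rewrite gt_eqF.
apply: le_trans (ler_sum _ (fun i _ => one i)) _.
rewrite big_split /= -!mulr_sumr lerD2r -!mulrA ler_pM2l // exchange_big /=.
have -> : kappa%:R ^+ n * (4 ^+ n) ^+ j = #|{: {ffun 'I_n -> 'I_(4 ^ j * kappa)}}|%:R :> R.
  rewrite card_ffun !card_ord natrX natrM natrX exprMn mulrC -!exprM; congr (_ ^+ _ * _).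
  by rewrite mulnC.
rewrite -sumr_const; apply: ler_sum => m _; exact: bessel_cell.
Qed.

(** [kappa] is the least order of magnitude, sqrt Lam, for which the coefficient in
    [local_mass_recursion] is at most half of [4 ^- n], the inverse of the growth rate
    of the number of cells. *)
Lemma local_weyl_bound : exists C' : R, forall l (Lam : R), 1 <= Lam ->
  (forall i, (i < l)%N -> lambda i <= Lam) ->
  local_mass l 0%N <= C' * Num.sqrt Lam ^+ n.
Proof.
have Cp := loc_const_gt0 L.
pose E := C * (8 + 40 * C); have E0 : 0 < E by rewrite mulr_gt0 // addr_gt0 // mulr_gt0.
pose D := 2 * 4 ^+ n * E; have D0 : 0 < D by apply: mulr_gt0 E0; apply: mulr_gt0 => //; exact: exprn_gt0.
exists (8 * (Num.sqrt D + 1) ^+ n) => l Lam Lam1 lamL.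
have Lam0 : 0 < Lam by exact: lt_le_trans Lam1.
set r : R := Num.sqrt (D * Lam); have r0 : 0 <= r by exact: sqrtr_ge0.
pose kappa := (Num.truncn r).+1.
have kr : r < kappa%:R by exact: truncnS_gt.
have kp : 0 < kappa%:R :> R by rewrite ltr0n.
have kr1 : kappa%:R <= r + 1 by rewrite -natr1 lerD2r truncn_le.
have k2 : D * Lam <= kappa%:R ^+ 2.
  have DL0 : 0 <= D * Lam by apply: mulr_ge0; apply: ltW.
  by rewrite -(sqr_sqrtr DL0) -/r lerXn2r ?nnegrE // ltW.
have four : 1 <= 4 ^+ n :> R by rewrite exprn_ege1 // ler1n.
have eps_le : E * Lam / kappa%:R ^+ 2 * 4 ^+ n <= 1/2.
  have -> : E * Lam / kappa%:R ^+ 2 * 4 ^+ n = D * Lam / kappa%:R ^+ 2 / 2.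
    by rewrite /D; field; rewrite gt_eqF.
  by rewrite ler_pM2r ?invr_gt0 // ler_pdivrMr ?mul1r // exprn_gt0.
have eps0 : 0 <= E * Lam / kappa%:R ^+ 2 by rewrite divr_ge0 ?sqr_ge0 // mulr_ge0 // ltW.
have := @geometric_recursion R (local_mass l) (4 * kappa%:R ^+ n) (4 ^+ n)
  (E * Lam / kappa%:R ^+ 2) l%:R.
have k0 : (0 < kappa)%N by [].
move=> /(_ _ _ eps0 _ eps_le _ (local_mass_le l) (fun j => local_mass_recursion j k0 Lam1 lamL)) H.
apply: le_trans (H _ _ _ _) _.
- by rewrite mulr_ge0 // exprn_ge0 // ltW.
- exact: exprn_ge0.
- by apply: le_trans eps_le; rewrite ler_peMr.
- exact: ler0n.
rewrite mulrA (_ : 2 * 4 = 8 :> R); last by rewrite -natrM.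
rewrite -mulrA ler_pM2l // -exprMn.
have kle : kappa%:R <= (Num.sqrt D + 1) * Num.sqrt Lam.
  rewrite mulrDl mul1r; apply: le_trans kr1 _.
  by rewrite /r sqrtrM ?(ltW D0) // lerD2l -[leLHS]sqrtr1; exact: ler_wsqrtr.
by rewrite lerXn2r // nnegrE ?(ltW kp) // (le_trans _ kle) // ltW.
Qed.

End local_weyl.

(** * Average mass in small sets *)

Section diagonal.
Context {R : realType}.

Lemma cesaro_squeeze (s : nat -> R) (c : R) (u : nat -> nat -> R) :
  (forall l, 0 <= s l) -> (forall N, u N @ \oo --> 0) ->
  (forall N l, s l <= u N l + c / N.+1%:R) -> 0 <= c -> s @ \oo --> 0.
Proof.
move=> s0 u0 su c0; apply/cvgrPdist_le => eps eps0.
pose N := Num.truncn (2 * c / eps).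
have cN : c / N.+1%:R <= eps / 2.
  rewrite ler_pdivrMr ?ltr0n // mulrAC ler_pdivlMr // -ler_pdivrMl // mulrC.
  by apply: ltW; rewrite [c * 2]mulrC; exact: truncnS_gt.
have e2 : 0 < eps / 2 by rewrite divr_gt0.
have /cvgrPdist_le /(_ _ e2) := u0 N; apply: filterS => l.
rewrite !sub0r !normrN => H; rewrite ger0_norm //; apply: le_trans (su N l) _.
apply: le_trans (lerD (le_trans (ler_norm _) H) cN) _; lra.
Qed.

(** Diagonal argument: the maximum [b] of the first sequences, with weights
    [m.+1%:R^-1], still has vanishing Cesaro means, because for each [N] all but the
    first [N] sequences contribute at most [1 / N.+1%:R]; and it dominates every
    [y m] up to a constant, from index [m.+1] on. *)
Lemma common_density_one (y : nat -> nat -> R) : (forall m i, 0 <= y m i) ->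
  (forall m i, y m i <= 1) ->
  (forall m, (fun l : nat => l%:R^-1 * \sum_(i < l) y m i) @ \oo --> 0) ->
  exists2 Sigma : set nat, has_density Sigma (1 : R) &
    forall m, y m @ within Sigma \oo --> 0.
Proof.
move=> y0 y1 yc.
(* Restricting to [m < i] makes the maximum finite. *)
pose b (i : nat) : R := \big[Num.max/0]_(m < i) (y m i / (m.+1)%:R).
have b0 i : 0 <= b i by exact: bigmax_ge_id.
have yb m i : (m < i)%N -> y m i <= m.+1%:R * b i.
  move=> mi; rewrite -ler_pdivrMl ?ltr0n // mulrC.
  exact: (le_bigmax _ (fun m : 'I_i => y m i / (m.+1)%:R) (Ordinal mi)).
have bN N i : b i <= \sum_(m < N) y m i + 1 / N.+1%:R.
  have S0 : 0 <= \sum_(m < N) y m i by apply: sumr_ge0.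
  apply: bigmax_le => [|m _]; first by rewrite addr_ge0 // divr_ge0.
  case: (ltnP m N) => mN.
    apply: (@le_trans _ _ (y m i)).
      by rewrite ler_pdivrMr ?ltr0n // ler_peMr // ler1n.
    apply: (@le_trans _ _ (\sum_(m < N) y m i)); last by rewrite lerDl divr_ge0.
    by rewrite (bigD1 (Ordinal mN)) //= lerDl sumr_ge0.
  apply: (@le_trans _ _ (1 / N.+1%:R)); last by rewrite lerDr.
  by apply: ler_pM => //; rewrite lef_pV2 ?posrE ?ltr0n // ler_nat.
have bc : (fun l : nat => l%:R^-1 * \sum_(i < l) b i) @ \oo --> 0.
  apply: (@cesaro_squeeze _ 1 (fun N l => \sum_(m < N) (l%:R^-1 * \sum_(i < l) y m i))) => //.
  - by move=> l; rewrite mulr_ge0 ?invr_ge0 // sumr_ge0.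
  - move=> N; elim: N => [|N IH].
      rewrite (_ : (fun l => _) = cst 0); first exact: cvg_cst.
      by apply/funext => l; rewrite big_ord0.
    rewrite (_ : (fun l => _) = fun l : nat => \sum_(m < N) (l%:R^-1 * \sum_(i < l) y m i)
        + l%:R^-1 * \sum_(i < l) y N i).
      by rewrite -[X in _ --> X](addr0 0); apply: cvgD; [exact: IH|exact: yc].
    by apply/funext => l; rewrite big_ord_recr.
  - move=> N [|l]; first by rewrite big_ord0 mulr0 addr_ge0 ?divr_ge0 // sumr_ge0 // => m _; rewrite big_ord0 mulr0.
    have H : \sum_(i < l.+1) b i <= \sum_(m < N) \sum_(i < l.+1) y m i + l.+1%:R * (1 / N.+1%:R).
      rewrite exchange_big /= -[X in X%:R * (1 / _)](card_ord l.+1) mulr_natl -sumr_const -big_split /=.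
      by apply: ler_sum => i _; exact: bN.
    have lp : 0 < l.+1%:R :> R by rewrite ltr0n.
    rewrite ler_pdivrMl // mulrDr -mulr_sumr mulVKf ?gt_eqF //.
have [Sigma dS bS] := density_one_of_cesaro b0 bc.
exists Sigma => // m.
have cb : (fun i => m.+1%:R * b i) @ within Sigma \oo --> 0.
  by rewrite -[X in _ --> X](mulr0 m.+1%:R); apply: cvgM => //; exact: cvg_cst.
apply: (squeeze_cvgr _ (cvg_cst 0) cb).
have : \forall i \near \oo, (m < i)%N by exists m.+1.
rewrite /within; apply: filterS => i mi _ /=.
by rewrite y0 yb.
Qed.

End diagonal.

Section averages.
Context {R : realType} {n : nat} {M : ptopologicalType} {A : smooth_atlas R n M}.
Variables (g : riemannian_metric A) (mu : {measure set (borel M) -> \bar R}).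
Hypothesis weylM : (fun t : R => counting_function mu (neg_laplace_beltrami g mu) t
        * ((t `^ (n%:R / 2))^-1)%:E)%E @ +oo --> +oo%E.
Variables (phi : nat -> borel M -> R[i]) (lambda : nat -> R).
Hypothesis phi_basis : orthonormal_basis mu phi.
Hypothesis phi_eigen : forall i,
  eigenfunction (neg_laplace_beltrami g mu) (lambda i)%:C (phi i).
Hypothesis lambda_mono : forall i j : nat, (i <= j)%N -> lambda i <= lambda j.

Lemma powR_half (t : R) : 0 <= t -> t `^ (n%:R / 2) = Num.sqrt t ^+ n.
Proof.
by move=> t0; rewrite mulrC powRrM powR12_sqrt // powR_mulrn // sqrtr_ge0.
Qed.

(** Only half of the eigenvalue is used in the counting function because
    [counting_function_le] needs a strict inequality. *)
Lemma counting_growth (B : R) : exists T : R, forall l, T < lambda l ->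
  B * Num.sqrt (lambda l / 2) ^+ n <= l%:R.
Proof.
have /cvgeyPge /(_ B) [T [_ HT]] := weylM.
exists (2 * Num.max T 0) => l Tl.
have lt2 : Num.max T 0 < lambda l / 2 by rewrite ltr_pdivlMr // mulrC.
have : T < lambda l / 2 by apply: le_lt_trans lt2; rewrite le_max lexx.
have l0 : 0 < lambda l / 2 by apply: le_lt_trans lt2; rewrite le_max lexx orbT.
set t := lambda l / 2 in l0 *.
move=> /HT; rewrite (powR_half (ltW l0)) => H.
have w0 : 0 < Num.sqrt t ^+ n by rewrite exprn_gt0 // sqrtr_gt0.
rewrite -ler_pdivlMr // -lee_fin; apply: le_trans H _.
rewrite EFinM; apply: lee_wpmul2r; first by rewrite lee_fin invr_ge0 ltW.
apply: (counting_function_le phi_basis phi_eigen) => i li.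
apply: lt_le_trans (lambda_mono li); rewrite /t in l0 *; lra.
Qed.

(** When [lambda l] is bounded, the mass is bounded while the denominator grows;
    otherwise the local Weyl bound is compared with [counting_growth]. *)
Lemma cesaro_local (chi : nat -> M -> R) (K : set M) (C : R) : localizer g mu chi K C ->
  (fun l : nat => l%:R^-1 * local_mass mu chi phi l 0%N) @ \oo --> 0.
Proof.
move=> L; have [C' HC] := local_weyl_bound L phi_basis phi_eigen.
have [phiL _ _] := phi_basis.
have m0 l : 0 <= local_mass mu chi phi l 0%N.
  apply: sumr_ge0 => i _; apply: nrm_ge0; apply: in_L2_cut => //.
  - exact: measurable_chi L 0%N.
  - exact: loc_ge0 L 0%N.
  - exact: loc_le1 L 0%N.
apply/cvgrPdist_le => eps eps0.
pose D := `|C'| * Num.sqrt 2 ^+ n.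
have D0 : 0 <= D by rewrite mulr_ge0 // exprn_ge0 // sqrtr_ge0.
have [T HT] := counting_growth (D / eps).
pose T1 := Num.max T 1.
pose E := `|C'| * Num.sqrt T1 ^+ n.
have E0 : 0 <= E by rewrite mulr_ge0 // exprn_ge0 // sqrtr_ge0.
exists (Num.truncn (E / eps)).+1 => // -[//|l] /= El.
have lp : 0 < l.+1%:R :> R by rewrite ltr0n.
rewrite sub0r normrN ger0_norm; last by rewrite mulr_ge0 ?invr_ge0.
rewrite mulrC ler_pdivrMr //.
have bound Lam : 1 <= Lam -> lambda l.+1 <= Lam ->
    local_mass mu chi phi l.+1 0%N <= `|C'| * Num.sqrt Lam ^+ n.
  move=> L1 lL; apply: le_trans (HC _ _ L1 _) _.
    by move=> i il; apply: le_trans lL; apply: lambda_mono; exact: ltnW.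
  by rewrite ler_wpM2r ?ler_norm // exprn_ge0 // sqrtr_ge0.
(* The cutoff [lambda l.+1] bounds the eigenvalues with index below [l.+1]. *)
have [lT|Tl] := leP (lambda l.+1) T1.
  apply: le_trans (bound T1 _ lT) _; first by rewrite le_max lexx orbT.
  rewrite -/E mulrC -ler_pdivrMr //; apply: ltW; apply: lt_le_trans (truncnS_gt _) _.
  by rewrite ler_nat.
have [T1l l1] : T < lambda l.+1 /\ 1 <= lambda l.+1.
  by move: Tl; rewrite gt_max => /andP[-> /ltW].
apply: le_trans (bound (lambda l.+1) l1 (lexx _)) _.
have := HT _ T1l.
have -> : `|C'| * Num.sqrt (lambda l.+1) ^+ n = eps * (D / eps * Num.sqrt (lambda l.+1 / 2) ^+ n).
  have -> : Num.sqrt (lambda l.+1) = Num.sqrt 2 * Num.sqrt (lambda l.+1 / 2).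
    by rewrite -sqrtrM // mulrC divfK.
  by rewrite /D exprMn; field; rewrite gt_eqF.
by move=> H; rewrite ler_pM2l.
Qed.

End averages.

(** * From small sets to compact sets *)

Section negligible_open_sets.
Context {R : realType} {M : ptopologicalType}.
Variables (mu : {measure set (borel M) -> \bar R}) (phi : nat -> borel M -> R[i]).
Hypothesis phiL : forall i, in_L2 mu (phi i).
Hypothesis phi1 : forall i, nrm mu (phi i) = 1.

Definition mass (O : set M) i : R := fine (\int[mu]_(x in (O : set (borel M))) (csq (phi i x))%:E)%E.

Lemma mass_ge0 O i : 0 <= mass O i.
Proof. by apply: fine_ge0; apply: integral_ge0 => x _; exact: csq_EFin_ge0. Qed.

Lemma mass_le_norm O i : (\int[mu]_(x in (O : set (borel M))) (csq (phi i x))%:E <= 1)%E.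
Proof.
rewrite -[X in (_ <= X%:E)%E](phi1 i) nrmE // integral_mkcond; apply: ge0_le_integral_set => x _.
  by apply: erestrict_ge0 => y _; exact: csq_EFin_ge0.
by rewrite patchE; case: ifP => // _; exact: csq_EFin_ge0.
Qed.

Lemma massE O i : (mass O i)%:E = (\int[mu]_(x in (O : set (borel M))) (csq (phi i x))%:E)%E.
Proof.
rewrite /mass fineK // ge0_fin_numE.
  exact: le_lt_trans (mass_le_norm O i) (ltry 1).
by apply: integral_ge0 => x _; exact: csq_EFin_ge0.
Qed.

Lemma mass_le1 O i : mass O i <= 1.
Proof. by rewrite -lee_fin massE mass_le_norm. Qed.

Lemma mass_subset O O' i : O `<=` O' -> mass O i <= mass O' i.
Proof.
move=> OO'; rewrite -lee_fin !massE integral_mkcond [leRHS]integral_mkcond.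
apply: ge0_le_integral_set => x _; first by apply: erestrict_ge0 => y _; exact: csq_EFin_ge0.
rewrite !patchE; case: ifP => [/set_mem /OO' H|_]; first by rewrite mem_set.
by case: ifP => // _; exact: csq_EFin_ge0.
Qed.

Definition negligible_mass (O : set M) : Prop :=
  (fun l : nat => l%:R^-1 * \sum_(i < l) mass O i) @ \oo --> (0 : R).

Lemma negligible_massS O (c : R) (m : nat -> R) : (forall i, mass O i <= c * m i) ->
  (fun l : nat => l%:R^-1 * \sum_(i < l) m i) @ \oo --> 0 -> negligible_mass O.
Proof.
move=> Om m0; apply: (squeeze_cvgr _ (cvg_cst 0) (h := fun l : nat => c * (l%:R^-1 * \sum_(i < l) m i))).
  near=> l; rewrite mulr_ge0 ?invr_ge0 ?sumr_ge0 //=; last by move=> i _; exact: mass_ge0.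
  by rewrite [leRHS]mulrCA ler_wpM2l ?invr_ge0 // mulr_sumr ler_sum.
by rewrite -[X in _ --> X](mulr0 c); apply: cvgM => //; exact: cvg_cst.
Unshelve. all: by end_near. Qed.

Lemma negligible_mass_subset O O' : O `<=` O' -> negligible_mass O' -> negligible_mass O.
Proof.
by move=> OO'; apply: (negligible_massS (c := 1)) => i; rewrite mul1r mass_subset.
Qed.

Lemma mass_cover (D : seq nat) (O : nat -> set M) (U : set M) i :
  (forall m, open (O m)) -> U `<=` \bigcup_(m in [set` D]) O m ->
  (\int[mu]_(x in (U : set (borel M))) (csq (phi i x))%:E <= (\sum_(m <- D) mass (O m) i)%:E)%E.
Proof.
move=> oO UO; have [mr mi _] := phiL i; have mc := measurable_csq mr mi.
pose f m x := (((fun x => (csq (phi i x))%:E) \_ (O m : set (borel M))) x)%E.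
have f0 m x : (0 <= f m x)%E by apply: erestrict_ge0 => y _; exact: csq_EFin_ge0.
rewrite -sumEFin (eq_bigr (fun m => \int[mu]_x f m x)%E); last first.
  by move=> m _; rewrite massE integral_mkcond.
rewrite -(ge0_integral_sum mu measurableT _ (fun m x _ => f0 m x)); last first.
  move=> m; apply/(measurable_restrictT _ (borel_open (oO m))).
  exact: measurable_funTS.
rewrite [leLHS]integral_mkcond; apply: ge0_le_integral_set => x _.
  by apply: erestrict_ge0 => y _; exact: csq_EFin_ge0.
rewrite patchE; case: ifP => [/set_mem /UO [m /= mD Om]|_]; last by apply: sume_ge0.
rewrite (big_rem m) //=; apply: (@le_trans _ _ (f m x)).
  by rewrite /f patchE mem_set.
by rewrite leeDl // sume_ge0.
Qed.

(** The basic open sets with negligible mass still cover [M]; numbering them by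
    natural numbers (with the empty set for unused numbers) gives countably many
    sequences in [[0, 1]] to which [common_density_one] applies. *)
Lemma density_one_of_local : @second_countable M ->
  (forall x, exists O, [/\ open O, O x & negligible_mass O]) ->
  exists2 Sigma : set nat, has_density Sigma (1 : R) &
    forall U : set M, compact U ->
      (fun i : nat => (\int[mu]_(x in (U : set (borel M))) (csq (phi i x))%:E)%E)
        @ within Sigma \oo --> 0%E.
Proof.
move=> [B cB [oB bB]] loc; have /countable_injP[f finj] := cB.
pose P m V := [/\ B V, negligible_mass V & f V = m].
pose O m : set M := if pselect (exists V, P m V) is left H then projT1 (cid H) else set0.
have OP m : O m = set0 \/ P m (O m).
  rewrite /O; case: pselect => [H|H]; [right; exact: (projT2 (cid H))|by left].
have oO m : open (O m).
  by case: (OP m) => [->|[/oB //]]; exact: open0.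
have nO m : negligible_mass (O m).
  case: (OP m) => [->|[]//]; rewrite /negligible_mass.
  rewrite (_ : (fun l => _) = cst 0); first exact: cvg_cst.
  by apply/funext => l; rewrite big1 ?mulr0 // => i _; rewrite /mass integral_set0.
have cover x : exists m, O m x.
  have [W [oW Wx nW]] := loc x.
  have [V [BV Vx] VW] := bB x W (open_nbhs_nbhs (conj oW Wx)).
  have PV : P (f V) V by split => //; exact: negligible_mass_subset nW.
  exists (f V); rewrite /O; case: pselect => [H|[]]; last by exists V.
  have [BV' _ fV] := projT2 (cid H).
  by rewrite (finj _ _ _ _ fV) // inE.
have [Sigma dS cS] := common_density_one (fun m i => mass_ge0 (O m) i)
  (fun m i => mass_le1 (O m) i) nO.
exists Sigma => // U; rewrite compact_cover => /(_ nat setT O (fun m _ => oO m)) [].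
  by move=> x Ux; have [m Om] := cover x; exists m.
move=> D _ UD.
have sum0 (s : seq nat) : (fun i => \sum_(m <- s) mass (O m) i) @ within Sigma \oo --> (0 : R).
  elim: s => [|m s IH].
    have -> : (fun i => \sum_(m <- [::]) mass (O m) i) = cst 0.
      by apply/funext => i; rewrite big_nil.
    exact: cvg_cst.
  have -> : (fun i => \sum_(k <- m :: s) mass (O k) i) = mass (O m) \+ (fun i => \sum_(k <- s) mass (O k) i).
    by apply/funext => i; rewrite big_cons.
  by have H := cvgD (cS m) IH; rewrite addr0 in H; exact: H.
apply: (squeeze_cvge (f := cst 0%E)
  (h := fun i => (\sum_(m <- finmap.enum_fset D) mass (O m) i)%:E)).
- near=> i; apply/andP; split; first by apply: integral_ge0 => x _; exact: csq_EFin_ge0.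
  by apply: mass_cover.
- exact: cvg_cst.
- apply: cvg_EFin; first by near=> i.
  exact: sum0.
Unshelve. all: by end_near. Qed.

End negligible_open_sets.

Theorem theorem1p4 (R : realType) (n : nat) (M : ptopologicalType)
    (hausdorffM : hausdorff_space M) (countableM : @second_countable M)
    (A : smooth_atlas R n M) (g : riemannian_metric A)
    (mu : {measure set (borel M) -> \bar R}) (mu_g : riemannian_measure g mu)
    (discreteM : discrete_spectrum mu (laplace_beltrami g mu))
    (weylM : (fun lambda : R =>
        counting_function mu (neg_laplace_beltrami g mu) lambda
        * ((lambda `^ (n%:R / 2))^-1)%:E)%E @ +oo --> +oo%E)
    (phi : nat -> borel M -> R[i]) (lambda : nat -> R)
    (phi_basis : orthonormal_basis mu phi)
    (phi_eigen : forall i : nat,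
        eigenfunction (neg_laplace_beltrami g mu) (lambda i)%:C (phi i))
    (lambda_mono : forall i j : nat, (i <= j)%N -> lambda i <= lambda j) :
  exists2 Sigma : set nat, has_density Sigma (1 : R) &
    forall U : set M, compact U ->
      (fun i : nat => (\int[mu]_(x in (U : set (borel M))) (csq (phi i x))%:E)%E)
        @ within Sigma \oo --> 0%E.
Proof.
have [phiL phiO _] := phi_basis.
have phi1 i : nrm mu (phi i) = 1 by rewrite /nrm phiO eqxx.
apply: density_one_of_local => // x.
have [chi [K [C [L chix]]]] := exists_localizer hausdorffM mu_g x.
have X0 := loc_ge0 L 0%N; have X1 := loc_le1 L 0%N; have mX := measurable_chi L 0%N.
pose c := chi 0%N x / 2; have c0 : 0 < c by rewrite divr_gt0.
pose O := [set y | c < chi 0%N y].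
have oO : open O.
  have cX : continuous (chi 0%N) := csmooth_continuous (loc_smooth L 0%N 1).
  rewrite (_ : O = chi 0%N @^-1` [set t | c < t]) //.
  by apply: open_comp => [y _|]; [exact: cX|exact: open_gt].
exists O; split => //; first by rewrite /O /= /c; lra.
apply: (negligible_massS (c := (c ^+ 2)^-1)
  (m := fun i => nrm mu (cut (chi 0%N : borel M -> R) (phi i)))); last first.
  have H := cesaro_local weylM phi_basis phi_eigen lambda_mono L; exact: H.
move=> i; have cutL : in_L2 mu (cut (chi 0%N : borel M -> R) (phi i)) by exact: in_L2_cut.
have [mr mi _] := cutL; have c2 : 0 < c ^+ 2 by rewrite exprn_gt0.
have k0 : (0 <= ((c ^+ 2)^-1)%:E)%E by rewrite lee_fin invr_ge0 ltW.
rewrite -lee_fin massE // EFinM nrmE // integral_mkcond.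
rewrite -(ge0_integralZl mu measurableT (measurable_csq mr mi) (fun x _ => csq_EFin_ge0 _ x) k0).
apply: ge0_le_integral_set => y _; first by apply: erestrict_ge0 => z _; exact: csq_EFin_ge0.
rewrite patchE; case: ifP => [/set_mem Oy|_]; last by rewrite mule_ge0 // csq_EFin_ge0.
rewrite -EFinM lee_fin csq_cut mulrA ler_peMl ?csq_ge0 // mulrC ler_pdivlMr // mul1r.
have cy : c <= chi 0%N y by apply: ltW.
by rewrite lerXn2r ?nnegrE ?X0 // ltW.
Qed.
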